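(* Let $X$ be an open subset of $\mathbb{C}$ and $f\in\mathcal{O}_{\mathbb{C}}(X)$. Let $U\in\mathrm{Op}^c_{X_{sa}}$ be such that $f|_{\overline U}$ is an injective map. Let $h$ be a holomorphic function on $f(U)$. Then $h\in\mathcal{O}^t_{\mathbb{C}_{sa}}\big(f(U)\big)$ if and only if $h\circ f\in\mathcal{O}^t_{X_{sa}}(U)$.
   Context: $\mathcal{O}_{\mathbb{C}}$ is the sheaf of holomorphic functions on $\mathbb{C}$. For an open set $Y\subset\mathbb{C}$, $\mathrm{Op}^c_{Y_{sa}}$ is the family of relatively compact subanalytic open subsets of $Y$ (viewed as a real analytic manifold; closures of such sets are compact in $Y$). For $V\in\mathrm{Op}^c_{Y_{sa}}$, $\mathcal{O}^t_{Y_{sa}}(V)$ is the space of tempered holomorphic functions on $V$: holomorphic functions on $V$ which, as distributions, are restrictions to $V$ of distributions defined on $Y$. Equivalently (known): holomorphic $g$ on $V$ for which there exist $C,M>0$ with $|g(z)|\le C\,\mathrm{dist}(z,\partial V)^{-M}$ for all $z\in V$. *)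

(* Defs.v *)
From Stdlib Require Import Reals List.
From mathcomp Require Import all_boot.
From Coquelicot Require Import Coquelicot.

Set Implicit Arguments.
Unset Strict Implicit.
Unset Printing Implicit Defensive.

Local Open Scope R_scope.

(** ** Topology *)

Definition subset_of {T : Type} (A B : T -> Prop) : Prop :=
  forall x, A x -> B x.

Definition compact_set {T : UniformSpace} (K : T -> Prop) : Prop :=
  forall (I : Type) (V : I -> T -> Prop),
    (forall i, open (V i)) ->
    (forall x, K x -> exists i, V i x) ->
    exists l : list I, forall x, K x -> exists i, List.In i l /\ V i x.

Definition closure_set {T : UniformSpace} (A : T -> Prop) (x : T) : Prop :=
  forall V : T -> Prop, locally x V -> exists y, V y /\ A y.

Definition relatively_compact_in {T : UniformSpace} (Y A : T -> Prop) : Prop :=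
  compact_set (closure_set A) /\ subset_of (closure_set A) Y.

Definition direct_image (f : C -> C) (A : C -> Prop) (w : C) : Prop :=
  exists z, A z /\ f z = w.

Definition injective_on (f : C -> C) (A : C -> Prop) : Prop :=
  forall z w, A z -> A w -> f z = f w -> z = w.

(** ** Subanalytic sets *)

(** [R^m] is ['I_m -> R], with the uniform structure of the sup norm. The index
    [a] at degree [k] ranges over the multi-indices of length [m] and total
    degree [k], whose entries are at most [k]. *)
Definition monomial (m k : nat) (a : {ffun 'I_m -> 'I_k.+1}) (v : 'I_m -> R)
    : R :=
  \big[Rmult/1]_(i < m) (v i ^ a i)%R.

Definition homogeneous_sum (m k : nat) (F : {ffun 'I_m -> 'I_k.+1} -> R) : R :=
  \big[Rplus/0]_(a : {ffun 'I_m -> 'I_k.+1}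
                 | (\sum_(i < m) (a i : nat))%N == k) F a.

Definition analytic_at (m : nat) (g : ('I_m -> R) -> R) (p : 'I_m -> R)
    : Prop :=
  exists (c : forall k : nat, {ffun 'I_m -> 'I_k.+1} -> R) (r : R),
    0 < r /\
    forall x : 'I_m -> R, (forall i, Rabs (x i - p i) < r) ->
      let v := fun i => x i - p i in
      ex_series (fun k => homogeneous_sum
                            (fun a => Rabs (c k a * monomial a v))) /\
      is_series (fun k => homogeneous_sum (fun a => c k a * monomial a v)) (g x).

(** A pair [(E, P)] of lists of functions stands for the basic set where all
    the functions in [E] vanish and all the functions in [P] are positive; [S]
    stands for the union of its members. *)
Definition semianalytic_in (m : nat) (M A : ('I_m -> R) -> Prop) : Prop :=
  subset_of A M /\
  forall p, M p ->
    exists (W : ('I_m -> R) -> Prop)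
           (S : list (list (('I_m -> R) -> R) * list (('I_m -> R) -> R))),
      open W /\ W p /\ subset_of W M /\
      (forall s g, List.In s S -> List.In g s.1 \/ List.In g s.2 ->
         forall q, W q -> analytic_at g q) /\
      (forall x, W x ->
         (A x <-> exists s, List.In s S /\
                    (forall g, List.In g s.1 -> g x = 0) /\
                    (forall g, List.In g s.2 -> 0 < g x))).

(** The projection from [R^(2+n)], seen as [C * R^n], to [C]. *)
Definition proj_C (n : nat) (x : 'I_n.+2 -> R) : C :=
  (x ord0, x (lift ord0 ord0)).

(** Locally on [Y], a subanalytic set is the projection of a relatively compact
    semianalytic subset of [Y * R^n]. The condition is required at all the
    points of [Y], not only at those of [A]. *)
Definition subanalytic_in (Y A : C -> Prop) : Prop :=
  subset_of A Y /\
  forall z, Y z ->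
    exists (W : C -> Prop) (n : nat) (B : ('I_n.+2 -> R) -> Prop),
      open W /\ W z /\ subset_of W Y /\
      semianalytic_in (fun x => Y (proj_C x)) B /\
      relatively_compact_in (fun x => Y (proj_C x)) B /\
      (forall w, (A w /\ W w) <-> exists x, B x /\ proj_C x = w).

Definition Op_c_sa (Y U : C -> Prop) : Prop :=
  open U /\ subanalytic_in Y U /\ relatively_compact_in Y U.

(** ** Distributions *)

(** Partial derivatives of a real function of [x + i y]: with respect to [x]
    for [true], to [y] for [false]. *)
Definition partial (d : bool) (u : C -> R) (z : C) : R :=
  if d then Derive (fun t => u (t, Im z)) (Re z)
  else Derive (fun t => u (Re z, t)) (Im z).

Definition partials (w : list bool) (u : C -> R) : C -> R :=
  fold_right partial u w.

Definition smooth_real (u : C -> R) : Prop :=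
  forall (w : list bool) (z : C),
    continuous (partials w u) z /\
    ex_derive (fun t => partials w u (t, Im z)) (Re z) /\
    ex_derive (fun t => partials w u (Re z, t)) (Im z).

Definition smooth (phi : C -> C) : Prop :=
  smooth_real (fun z => Re (phi z)) /\ smooth_real (fun z => Im (phi z)).

Definition supported_in (K : C -> Prop) (phi : C -> C) : Prop :=
  forall z, ~ K z -> phi z = 0%C.

(** Elements of [C_c^oo(Y)], extended by zero to the whole plane. *)
Definition test_function (Y : C -> Prop) (phi : C -> C) : Prop :=
  smooth phi /\
  exists K, compact_set K /\ subset_of K Y /\ supported_in K phi.

Definition derivatives_bounded (k : nat) (B : R) (phi : C -> C) : Prop :=
  forall (w : list bool) (z : C), (size w <= k)%N ->
    Rabs (partials w (fun z => Re (phi z)) z) <= B /\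
    Rabs (partials w (fun z => Im (phi z)) z) <= B.

(** Only the values of [T] on test functions on [Y] are meaningful. *)
Definition distribution (Y : C -> Prop) (T : (C -> C) -> C) : Prop :=
  (forall (a b : C) (phi psi : C -> C),
     test_function Y phi -> test_function Y psi ->
     T (fun z => a * phi z + b * psi z)%C = (a * T phi + b * T psi)%C) /\
  (forall K : C -> Prop, compact_set K -> subset_of K Y ->
     exists (k : nat) (M : R),
       forall (phi : C -> C) (B : R),
         test_function Y phi -> supported_in K phi ->
         derivatives_bounded k B phi -> Cmod (T phi) <= M * B).

Definition in_square (A : R) (z : C) : Prop :=
  Rabs (Re z) <= A /\ Rabs (Im z) <= A.

Definition square_integral (A : R) (F : C -> C) : C :=
  RInt (V := C_R_CompleteNormedModule)
    (fun x => RInt (V := C_R_CompleteNormedModule)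
                (fun y => F (x, y)) (- A) A) (- A) A.

(** The restriction of [T] to [V] is the distribution of density [g]. As [phi]
    vanishes off [V], so does the integrand, whatever the values of [g] there;
    the integral does not depend on the square containing the support. *)
Definition restricts_to (V : C -> Prop) (T : (C -> C) -> C) (g : C -> C)
    : Prop :=
  forall (phi : C -> C) (A : R),
    test_function V phi -> supported_in (in_square A) phi ->
    T phi = square_integral A (fun z => g z * phi z)%C.

(** ** Holomorphic and tempered holomorphic functions *)

(** Functions on an open set are total functions on [C], considered on that set
    only; differentiability is over [C]. *)
Definition holomorphic_on (V : C -> Prop) (g : C -> C) : Prop :=
  forall z, V z -> ex_derive (K := C_AbsRing) (V := C_NormedModule) g z.

Definition tempered_holomorphic (Y V : C -> Prop) (g : C -> C) : Prop :=
  holomorphic_on V g /\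
  exists T : (C -> C) -> C, distribution Y T /\ restricts_to V T g.

(* Main.v *)
Require Import Defs.
From Stdlib Require Import Reals.
From Coquelicot Require Import Coquelicot.
From Stdlib Require Import Lra Lia List Classical ClassicalEpsilon
  FunctionalExtensionality.
From mathcomp Require Import ssreflect ssrfun ssrbool.
From mathcomp Require seq ssrnat classical_sets.


(** Temperedness is a condition of growth at the boundary. For a holomorphic
    function [g] on a bounded open set [V], it means that [|g z| * r^N] is bounded
    over all discs of centre [z] and radius [r <= 1] contained in [V], for some
    [N] (predicate [growth]).

    If [g] extends to a distribution, that distribution has finite order [k] on a
    compact set containing [V]. By the mean value formula [g z] is, up to a
    factor of order [r^-2], the pairing of [g] with a radial test function
    supported in the disc of radius [r], whose derivatives of order [k] are of
    order [r^-k]; hence [|g z| = O(r^(-k-2))] ([tempered_growth]). Conversely a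
    test function on [V] vanishes to infinite order outside [V], so by Taylor's
    formula its product with [g] is bounded by finitely many of its derivatives
    when [g] has polynomial growth. The pairing with [g] is then dominated by a
    norm of class C^k, and the Hahn-Banach theorem extends it to all test
    functions ([growth_tempered]).

    It remains to compare the discs contained in [U] with those contained in
    [f(U)], up to constants and powers. If [U] does not contain the disc of radius
    [r] around [z], some boundary point [b] is at distance less than [r] from [z];
    as [f] is injective on the closure, [f b] is not in [f(U)], and it is at
    distance less than [L r] from [f z] ([preimage_contains_disc]). In the other
    direction, [f(U)] contains the disc of radius [c r^N] around [f z] when [U]
    contains the disc of radius [r] around [z] ([image_contains_disc]). This is
    local around a point [p] of the closure, where [f - f p] is a power
    [(z - p)^m] times a nonvanishing Lipschitz function ([local_normal_form]). If
    [p] is in [U], the open mapping theorem at [p] suffices. Otherwise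
    [|z - p| >= r], and on a small circle around [z] of radius proportional to
    [r] the distance of [f] to [f z] is at least of order [r^m]; the minimum
    principle ([open_mapping]) then yields the disc.

    The complex analysis is derived from Goursat's theorem on rectangles.
    Distributions pair with smooth functions on the plane, so the contour of
    Cauchy's formula is replaced throughout by a smooth radial weight supported
    in an annulus: the integral of [(z - z0) q(z)] against the weight vanishes
    for every [q] with a primitive ([weighted_integral_zero]), and applying this
    to a difference quotient gives Cauchy's formula ([transform_formula]), the
    mean value formula, and Taylor expansions with remainder. *)

Local Open Scope R_scope.

(** * The topology of the plane in terms of the modulus *)

Definition disc (z : C) (r : R) (w : C) : Prop := Cmod (w - z)%C < r.

Lemma Cmod_split (z : C) :
  Rabs (Re z) <= Cmod z /\ Rabs (Im z) <= Cmod z /\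
  Cmod z <= Rabs (Re z) + Rabs (Im z).
Proof.
split; first exact: re_le_Cmod.
split.
- have H := Rmax_Cmod z. have H1 := Rmax_r (Rabs (fst z)) (Rabs (snd z)).
  rewrite /Im. lra.
- case: z => x y. rewrite /Re /Im /=.
  have -> : (x, y) = (RtoC x + Ci * RtoC y)%C.
  { rewrite /RtoC /Ci /Cplus /Cmult /=; f_equal; ring. }
  have H := Cmod_triangle (RtoC x) (Ci * RtoC y)%C.
  rewrite Cmod_mult Cmod_Ci !Cmod_R in H. lra.
Qed.

Lemma Cmod_sub_split (z w : C) :
  Rabs (Re z - Re w) <= Cmod (z - w)%C /\ Rabs (Im z - Im w) <= Cmod (z - w)%C /\
  Cmod (z - w)%C <= Rabs (Re z - Re w) + Rabs (Im z - Im w).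
Proof. exact: (Cmod_split (z - w)%C). Qed.

Lemma Cmod_sqr (z : C) : Cmod z ^ 2 = Re z ^ 2 + Im z ^ 2.
Proof.
rewrite /Cmod pow2_sqrt //. have := pow2_ge_0 (fst z). have := pow2_ge_0 (snd z). lra.
Qed.

Lemma Cmod_sub_sqr (z w : C) :
  Cmod (z - w)%C ^ 2 = (Re z - Re w) ^ 2 + (Im z - Im w) ^ 2.
Proof. exact: (Cmod_sqr (z - w)%C). Qed.

Lemma Csub_eq0 (a b : C) : (a - b)%C = 0%C -> a = b.
Proof. move=> E. have -> : a = (a - b + b)%C by ring. rewrite E. ring. Qed.

Lemma pos_min (a b : R) : 0 < a -> 0 < b -> exists t, 0 < t /\ t <= a /\ t <= b.
Proof.
move=> Ha Hb. exists (Rmin a b).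
split; [exact: Rmin_glb_lt|split; [exact: Rmin_l|exact: Rmin_r]].
Qed.

Lemma Cmod_triangle_minus (a b : C) : Cmod a <= Cmod b + Cmod (a - b)%C.
Proof.
have -> : Cmod a = Cmod (b + (a - b))%C by congr Cmod; ring.
exact: Cmod_triangle.
Qed.

Lemma Cmod_minus_sym (a b : C) : Cmod (a - b)%C = Cmod (b - a)%C.
Proof. by rewrite -Cmod_opp; congr Cmod; ring. Qed.

Lemma Cmod_dist (a b c : C) :
  Cmod (a - c)%C <= Cmod (a - b)%C + Cmod (b - c)%C.
Proof.
have -> : (a - c = (a - b) + (b - c))%C by ring.
exact: Cmod_triangle.
Qed.

Lemma disc_of_parts (x y u v d : R) :
  Rabs (u - x) < d / 2 -> Rabs (v - y) < d / 2 -> disc (x, y) d (u, v).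
Proof.
move=> Hu Hv. apply: Rle_lt_trans (proj2 (proj2 (Cmod_sub_split _ _))) _.
rewrite /Re /Im /=. lra.
Qed.

Lemma parts_of_disc (x y u v d : R) :
  disc (x, y) d (u, v) -> Rabs (u - x) < d /\ Rabs (v - y) < d.
Proof.
rewrite /disc => H. have [H1 [H2 _]] := Cmod_sub_split (u, v) (x, y).
rewrite /Re /Im [fst _]/= [snd _]/= in H1 H2. split; [exact: Rle_lt_trans H1 H|exact: Rle_lt_trans H2 H].
Qed.

Lemma disc_center (z : C) (r : R) : 0 < r -> disc z r z.
Proof. by move=> Hr; rewrite /disc /Cminus Cplus_opp_r Cmod_0. Qed.

Lemma locally_disc (z : C) (P : C -> Prop) :
  locally z P <-> exists d, 0 < d /\ forall w, disc z d w -> P w.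
Proof.
split.
- move=> [d Hd]. exists d; split; first exact: cond_pos.
  move=> w Hw. apply: Hd. rewrite /disc in Hw.
  have [H1 [H2 _]] := Cmod_split (w - z)%C.
  split; rewrite /ball /= /AbsRing_ball /abs /minus /plus /opp /=.
  + apply: Rle_lt_trans Hw. exact: H1.
  + apply: Rle_lt_trans Hw. exact: H2.
- move=> [d [Hd HP]].
  have Hd2 : 0 < d / 2 by lra.
  exists (mkposreal _ Hd2) => w [H1 H2].
  apply: HP. rewrite /disc.
  have [_ [_ H3]] := Cmod_split (w - z)%C.
  rewrite /ball /= /AbsRing_ball /abs /minus /plus /opp /= in H1 H2.
  rewrite /Re /Im /= in H3. lra.
Qed.

Lemma open_disc (V : C -> Prop) :
  open V <-> forall z, V z -> exists d, 0 < d /\ forall w, disc z d w -> V w.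
Proof.
split=> H z Hz.
- by apply/locally_disc; exact: H.
- by apply/locally_disc; exact: H.
Qed.

Lemma closure_disc (A : C -> Prop) (z : C) :
  closure_set A z <-> forall d, 0 < d -> exists y, disc z d y /\ A y.
Proof.
split.
- move=> H d Hd. apply: H. apply/locally_disc. by exists d.
- move=> H V /locally_disc [d [Hd HV]].
  have [y [Hy HA]] := H d Hd. exists y; split=> //. exact: HV.
Qed.

Lemma subset_closure (A : C -> Prop) (z : C) : A z -> closure_set A z.
Proof.
move=> Hz. apply/closure_disc => d Hd. exists z. split=> //. exact: disc_center.
Qed.

(** All the passages from local to uniform constants go through this form.
    Indexing the property by a natural number in which it improves spares the
    comparison of the local constants. *)
Lemma compact_uniform (K : C -> Prop) (P : nat -> C -> Prop) :
  compact_set K ->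
  (forall n m z, (n <= m)%nat -> P n z -> P m z) ->
  (forall z, K z -> exists n d, 0 < d /\ forall w, disc z d w -> P n w) ->
  exists n, forall z, K z -> P n z.
Proof.
move=> HK Hmon Hloc.
have [l Hl] : exists l : list nat, forall x, K x ->
    exists i, In i l /\ locally x (P i).
{ apply: (HK nat (fun n x => locally x (P n))).
  - move=> n x. exact: locally_locally.
  - move=> x /Hloc [n [d H]]. exists n. apply/locally_disc. by exists d. }
have [N HN] : exists N, forall i, In i l -> (i <= N)%nat.
{ elim: (l) => [|a l' [N HN]]; first by exists 0%nat.
  exists (max a N) => i [<-|Hi]; first by lia.
  have := HN i Hi; lia. }
exists N => z /Hl [i [Hi Hz]].
apply: (Hmon i) => //; first exact: HN.
exact: locally_singleton Hz.
Qed.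

Lemma inv_INR_lt (e : R) : 0 < e -> exists n : nat, / (INR n + 1) < e.
Proof.
move=> He. have [n Hn] := nfloor_ex (/ e) (Rlt_le _ _ (Rinv_0_lt_compat _ He)).
exists n. rewrite -(Rinv_inv e). apply: Rinv_lt_contravar.
- apply: Rmult_lt_0_compat; first exact: Rinv_0_lt_compat.
  have := pos_INR n; lra.
- lra.
Qed.

Lemma inv_INR_pos (n : nat) : 0 < / (INR n + 1).
Proof. apply: Rinv_0_lt_compat. have := pos_INR n; lra. Qed.

Lemma inv_INR_antimono (n m : nat) :
  (n <= m)%nat -> / (INR m + 1) <= / (INR n + 1).
Proof.
move=> H. apply: Rinv_le_contravar.
- have := pos_INR n; lra.
- have := le_INR _ _ H; lra.
Qed.

Lemma INR_above (x : R) : exists n : nat, x <= INR n.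
Proof.
have [n Hn] := nfloor_ex (Rabs x) (Rabs_pos x).
exists (S n). rewrite S_INR. have := Rle_abs x. lra.
Qed.

Lemma compact_bound (K : C -> Prop) (g : C -> R) :
  compact_set K ->
  (forall z, K z -> exists B d, 0 < d /\ forall w, disc z d w -> g w <= B) ->
  exists B, 0 < B /\ forall z, K z -> g z <= B.
Proof.
move=> HK Hloc.
have [n Hn] : exists n : nat, forall z, K z -> g z <= INR n.
{ apply: (compact_uniform K (fun n z => g z <= INR n)) => //.
  - move=> n m z /le_INR; lra.
  - move=> z /Hloc [B [d [Hd H]]]. have [n Hn] := INR_above B.
    exists n, d. split=> // w /H; lra. }
exists (INR n + 1). split; first by have := pos_INR n; lra.
move=> z /Hn; lra.
Qed.

Lemma compact_bounded (K : C -> Prop) :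
  compact_set K -> exists B, 0 < B /\ forall z, K z -> Cmod z <= B.
Proof.
move=> HK. apply: compact_bound => // z _.
exists (Cmod z + 1), 1. split; first lra.
move=> w Hw. rewrite /disc in Hw.
have := Cmod_triangle_minus w z. lra.
Qed.

Lemma compact_away (K : C -> Prop) (b : C) :
  compact_set K -> ~ K b ->
  exists d, 0 < d /\ forall z, disc b d z -> ~ K z.
Proof.
move=> HK Hb.
have [n Hn] : exists n : nat, forall z, K z -> / (INR n + 1) <= Cmod (z - b)%C.
{ apply: (compact_uniform K (fun n z => / (INR n + 1) <= Cmod (z - b)%C)) => //.
  - move=> n m z /inv_INR_antimono; lra.
  - move=> z Hz.
    have Hzb : 0 < Cmod (z - b)%C.
    { apply: (proj1 (Cmod_gt_0 _)) => E. apply: Hb.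
      by have -> : b = z by rewrite -(Cplus_0_l b) -E; ring. }
    have [n Hn] := inv_INR_lt (Cmod (z - b)%C / 2) ltac:(lra).
    exists n, (Cmod (z - b)%C / 2). split; first lra.
    move=> w Hw. rewrite /disc in Hw.
    have := Cmod_dist z w b. have := Cmod_minus_sym w z. lra. }
exists (/ (INR n + 1)). split; first exact: inv_INR_pos.
move=> z Hz /Hn. rewrite /disc in Hz. lra.
Qed.

Lemma compact_inter_closed (K F : C -> Prop) :
  compact_set K ->
  (forall z, ~ F z -> exists d, 0 < d /\ forall w, disc z d w -> ~ F w) ->
  compact_set (fun z => K z /\ F z).
Proof.
move=> HK HF I V HV Hcov.
have [l Hl] : exists l : list (option I), forall x, K x ->
    exists i, In i l /\
      match i with Some j => V j x | None => ~ F x end.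
{ apply: (HK (option I)
      (fun i x => match i with Some j => V j x | None => ~ F x end)).
  - move=> [i|]; first exact: HV.
    apply/open_disc => z Hz. exact: HF.
  - move=> x Hx. case: (classic (F x)) => HFx.
    + have [i Hi] := Hcov x (conj Hx HFx). by exists (Some i).
    + by exists None. }
exists (flat_map (fun o => match o with Some j => j :: nil | None => nil end) l).
move=> x [Hx HFx]. have [[i|] [Hi Hix]] := Hl x Hx.
- exists i. split=> //. apply/in_flat_map. exists (Some i). split=> //. by left.
- by [].
Qed.

Lemma compact_image (K : C -> Prop) (f : C -> C) :
  compact_set K ->
  (forall z, K z -> forall e, 0 < e ->
     exists d, 0 < d /\ forall w, disc z d w -> disc (f z) e (f w)) ->
  compact_set (direct_image f K).
Proof.
move=> HK Hf I V HV Hcov.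
have [l Hl] : exists l : list I, forall x, K x ->
    exists i, In i l /\ locally x (fun y => V i (f y)).
{ apply: (HK I (fun i x => locally x (fun y => V i (f y)))).
  - move=> i x. exact: locally_locally.
  - move=> x Hx. have [i Hi] : exists i, V i (f x) by apply: Hcov; exists x.
    exists i. apply/locally_disc.
    have [e [He HVe]] := proj1 (open_disc (V i)) (HV i) _ Hi.
    have [d [Hd Hfd]] := Hf x Hx e He.
    exists d. split=> // w Hw. apply: HVe. exact: Hfd. }
exists l => _ [x [Hx <-]]. have [i [Hi Hxi]] := Hl x Hx.
exists i. split=> //. exact: (locally_singleton x (fun y => V i (f y))).
Qed.

(** If the infimum were not attained, [g] would exceed it near each point by
    some [1 / (n + 1)], hence uniformly. *)
Lemma compact_min (K : C -> Prop) (g : C -> R) (z0 : C) :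
  compact_set K -> K z0 -> (forall z, 0 <= g z) ->
  (forall z, K z -> forall e, 0 < e ->
     exists d, 0 < d /\ forall w, disc z d w -> g z - e < g w) ->
  exists z, K z /\ forall w, K w -> g z <= g w.
Proof.
move=> HK Hz0 Hpos Hlsc.
pose E := fun x => exists z, K z /\ x = - g z.
have [m [Hm1 Hm2]] : {m | is_lub E m}.
{ apply: completeness.
  - exists 0 => _ [z [_ ->]]. have := Hpos z; lra.
  - exists (- g z0), z0. by []. }
apply: NNPP => Hno.
have Hlt : forall z, K z -> - m < g z.
{ move=> z Hz. have H1 : - g z <= m by apply: Hm1; exists z.
  case: (Rle_lt_or_eq_dec _ _ H1) => [|H2]; first lra.
  case: Hno. exists z. split=> // w Hw.
  have : - g w <= m by apply: Hm1; exists w.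
  lra. }
have [n Hn] : exists n : nat, forall z, K z -> - m + / (INR n + 1) <= g z.
{ apply: (compact_uniform K (fun n z => - m + / (INR n + 1) <= g z)) => //.
  - move=> n k z /inv_INR_antimono; lra.
  - move=> z Hz. have Hz' := Hlt z Hz.
    have [n Hn] := inv_INR_lt ((g z + m) / 2) ltac:(lra).
    have [d [Hd H]] := Hlsc z Hz ((g z + m) / 2) ltac:(lra).
    exists n, d. split=> // w /H. lra. }
have : m <= m - / (INR n + 1).
{ apply: Hm2 => _ [z [/Hn Hz ->]]. lra. }
have := inv_INR_pos n. lra.
Qed.

(** * Iterated integrals of continuous functions on rectangles *)

Definition cont2 (u : R -> R -> R) : Prop := forall x y, continuity_2d_pt u x y.

Definition II (a b c d : R) (u : R -> R -> R) : R :=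
  RInt (fun x => RInt (fun y => u x y) c d) a b.

Lemma continuity_2d_pt_swap u x y :
  continuity_2d_pt u x y -> continuity_2d_pt (fun p q => u q p) y x.
Proof.
move=> H e. have [d Hd] := H e. exists d => p q Hp Hq. exact: Hd.
Qed.

Lemma cont2_swap u : cont2 u -> cont2 (fun x y => u y x).
Proof. move=> H x y. exact: continuity_2d_pt_swap. Qed.

Lemma continuity_2d_pt_snd u x y :
  continuity_2d_pt u x y -> continuous (u x) y.
Proof.
move=> H. apply/continuity_pt_filterlim => e He.
have [d Hd] := H (mkposreal e He).
exists d. split; first exact: cond_pos.
move=> z [_ Hz]. apply: Hd => //.
rewrite Rminus_diag Rabs_R0. exact: cond_pos.
Qed.

Lemma continuity_2d_pt_fst u x y :
  continuity_2d_pt u x y -> continuous (fun t => u t y) x.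
Proof. move=> /continuity_2d_pt_swap. exact: continuity_2d_pt_snd. Qed.

Lemma continuity_2d_pt_of_snd (f : R -> R) x y :
  continuous f y -> continuity_2d_pt (fun _ v => f v) x y.
Proof.
move=> H. apply: (continuity_1d_2d_pt_comp f (fun _ v => v)).
- exact/continuity_pt_filterlim.
- exact: continuity_2d_pt_id2.
Qed.

Lemma sq_dist_cont x0 y0 : cont2 (fun x y => (x - x0) ^ 2 + (y - y0) ^ 2).
Proof.
have Hsq : forall c t, continuous (fun t => (t - c) ^ 2) t.
{ move=> c t. apply: ex_derive_continuous. by auto_derive. }
move=> x y. apply: (continuity_2d_pt_plus (fun x _ => (x - x0) ^ 2)).
- apply: (continuity_2d_pt_swap (fun _ x => (x - x0) ^ 2)).
  exact: (continuity_2d_pt_of_snd (fun t => (t - x0) ^ 2)).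
- exact: (continuity_2d_pt_of_snd (fun t => (t - y0) ^ 2)).
Qed.

Lemma cont2_ex_RInt u x c d : cont2 u -> ex_RInt (u x) c d.
Proof.
move=> H. apply: ex_RInt_continuous => y _. exact: continuity_2d_pt_snd.
Qed.

Lemma RInt_param_continuous u c d x :
  cont2 u -> continuous (fun x => RInt (fun y => u x y) c d) x.
Proof.
move=> H. apply/continuity_pt_filterlim => e He.
have [k [Hk Hke]] : exists k, 0 < k /\ Rabs (d - c) * k < e.
{ have HR := Rabs_pos (d - c).
  exists (e / (Rabs (d - c) + 1)).
  split; first by apply: Rdiv_lt_0_compat => //; lra.
  have E : Rabs (d - c) * (e / (Rabs (d - c) + 1)) =
    e - e / (Rabs (d - c) + 1) by field; lra.
  rewrite E. suff : 0 < e / (Rabs (d - c) + 1) by lra.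
  by apply: Rdiv_lt_0_compat => //; lra. }
have [dl Hdl] := uniform_continuity_2d_1d' u (Rmin c d) (Rmax c d) x
  (fun y _ => H x y) (mkposreal _ Hk).
exists dl. split; first exact: cond_pos.
move=> z [_ Hz]. rewrite /= /R_dist in Hz |- *.
have -> : RInt (fun y => u z y) c d - RInt (fun y => u x y) c d =
  RInt (fun y => u z y - u x y) c d.
{ symmetry. apply: (RInt_minus (V := R_CompleteNormedModule));
    exact: cont2_ex_RInt. }
apply: Rle_lt_trans Hke.
have HB : forall t, Rmin c d <= t <= Rmax c d -> Rabs (u z t - u x t) <= k.
{ move=> t Ht. apply: Rlt_le. have Hd' := cond_pos dl.
  have Hz' := Rabs_def2 _ _ Hz.
  apply: Hdl => //; [lra | lra | ].
  rewrite Rminus_diag Rabs_R0 //. }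
have Hex : forall p q, ex_RInt (fun t => u z t - u x t) p q.
{ move=> p q. apply: (ex_RInt_minus (V := R_NormedModule));
  exact: cont2_ex_RInt. }
case: (Rle_dec c d) => Hcd.
- rewrite (Rabs_right (d - c)); last lra.
  apply: abs_RInt_le_const => // t Ht.
  apply: HB. rewrite Rmin_left ?Rmax_right; lra.
- rewrite -(opp_RInt_swap (V := R_CompleteNormedModule)) // /opp /= Rabs_Ropp.
  rewrite Rabs_minus_sym (Rabs_right (c - d)); last lra.
  apply: abs_RInt_le_const => //; first lra.
  move=> t Ht.
  apply: HB. rewrite Rmin_right ?Rmax_left; lra.
Qed.

Lemma cont2_ex_RInt_outer u a b c d :
  cont2 u -> ex_RInt (fun x => RInt (fun y => u x y) c d) a b.
Proof.
move=> H. apply: ex_RInt_continuous => x _. exact: RInt_param_continuous.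
Qed.

Lemma II_plus a b c d u v : cont2 u -> cont2 v ->
  II a b c d (fun x y => u x y + v x y) = II a b c d u + II a b c d v.
Proof.
move=> Hu Hv. rewrite /II.
etransitivity;
  last by apply: (RInt_plus (V := R_CompleteNormedModule));
          exact: cont2_ex_RInt_outer.
apply: RInt_ext => x _.
by apply: (RInt_plus (V := R_CompleteNormedModule)); exact: cont2_ex_RInt.
Qed.

Lemma II_scal a b c d k u : cont2 u ->
  II a b c d (fun x y => k * u x y) = k * II a b c d u.
Proof.
move=> Hu. rewrite /II.
etransitivity;
  last by apply: (RInt_scal (V := R_CompleteNormedModule));
          exact: cont2_ex_RInt_outer.
apply: RInt_ext => x _.
by apply: (RInt_scal (V := R_CompleteNormedModule)); exact: cont2_ex_RInt.
Qed.

Lemma II_minus a b c d u v : cont2 u -> cont2 v ->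
  II a b c d (fun x y => u x y - v x y) = II a b c d u - II a b c d v.
Proof.
move=> Hu Hv. rewrite /II.
etransitivity;
  last by apply: (RInt_minus (V := R_CompleteNormedModule));
          exact: cont2_ex_RInt_outer.
apply: RInt_ext => x _.
by apply: (RInt_minus (V := R_CompleteNormedModule)); exact: cont2_ex_RInt.
Qed.

Lemma II_ext a b c d u v : (forall x y, u x y = v x y) ->
  II a b c d u = II a b c d v.
Proof. move=> H. apply: RInt_ext => x _. apply: RInt_ext => y _. exact: H. Qed.

Lemma II_const a b c d k : II a b c d (fun _ _ => k) = (b - a) * ((d - c) * k).
Proof. rewrite /II !RInt_const. by []. Qed.

Lemma II_le a b c d u v : a <= b -> c <= d -> cont2 u -> cont2 v ->
  (forall x y, a < x < b -> c < y < d -> u x y <= v x y) ->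
  II a b c d u <= II a b c d v.
Proof.
move=> Hab Hcd Hu Hv H. apply: RInt_le => //; [exact: cont2_ex_RInt_outer..|].
move=> x Hx. apply: RInt_le => //; [exact: cont2_ex_RInt..|].
move=> y Hy. exact: H.
Qed.

Lemma cont2_const k : cont2 (fun _ _ => k).
Proof. move=> x y. exact: continuity_2d_pt_const. Qed.

Lemma II_abs_le a b c d u M : a <= b -> c <= d -> cont2 u ->
  (forall x y, a < x < b -> c < y < d -> Rabs (u x y) <= M) ->
  Rabs (II a b c d u) <= (b - a) * ((d - c) * M).
Proof.
move=> Hab Hcd Hu H. apply: Rabs_le.
rewrite -!(II_const a b c d).
have -> : - II a b c d (fun _ _ => M) = II a b c d (fun _ _ => - M).
{ rewrite !II_const. ring. }
split; apply: II_le => //; try exact: cont2_const;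
  move=> x y Hx Hy; have := H x y Hx Hy; move/Rabs_le_between; lra.
Qed.

Lemma Fubini_continuous a b c d u : a <= b -> cont2 u ->
  II a b c d u = RInt (fun y => RInt (fun x => u x y) a b) c d.
Proof.
move=> Hab Hu.
pose G := fun t => RInt (fun x => RInt (fun y => u x y) c d) a t.
pose H := fun t => RInt (fun y => RInt (fun x => u x y) a t) c d.
have HG : forall t, is_derive G t (RInt (fun y => u t y) c d).
{ move=> t. apply: (is_derive_RInt (fun x => RInt (fun y => u x y) c d) G a).
  - exists (mkposreal 1 Rlt_0_1) => z _. apply: RInt_correct.
    exact: cont2_ex_RInt_outer.
  - exact: RInt_param_continuous. }
have Hf : forall t y, is_derive (fun t => RInt (fun x => u x y) a t) t (u t y).
{ move=> t y. apply: (is_derive_RInt (fun x => u x y) _ a).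
  - exists (mkposreal 1 Rlt_0_1) => z _. apply: RInt_correct.
    apply: (cont2_ex_RInt (fun y x => u x y)). exact: cont2_swap.
  - exact: continuity_2d_pt_fst. }
have HH : forall t, is_derive H t (RInt (fun y => u t y) c d).
{ move=> t.
  have E : RInt (fun y => u t y) c d =
    RInt (fun y => Derive (fun s => RInt (fun x => u x y) a s) t) c d.
  { apply: RInt_ext => y _. symmetry. exact: is_derive_unique. }
  rewrite E.
  apply: (is_derive_RInt_param (fun t y => RInt (fun x => u x y) a t) c d t).
  - exists (mkposreal 1 Rlt_0_1) => z _ y _. by exists (u z y).
  - move=> y _. apply: (continuity_2d_pt_ext u) => // p q.
    symmetry. exact: is_derive_unique.
  - exists (mkposreal 1 Rlt_0_1) => z _.
    apply: (cont2_ex_RInt_outer (fun y x => u x y)). exact: cont2_swap. }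
have E0 : G a - H a = 0.
{ rewrite /G /H RInt_point.
  rewrite (RInt_ext _ (fun _ => 0)); last by move=> y _; rewrite RInt_point.
  rewrite RInt_const /scal /= /mult /= /zero /=. ring. }
case: (Rle_lt_or_eq_dec _ _ Hab) => [Hlt|E]; last first.
{ rewrite -E. rewrite /G /H in E0. rewrite /II. lra. }
have E1 : G a - H a = G b - H b.
{ apply: (eq_is_derive (fun t => G t - H t)) => // t _.
  rewrite -(minus_eq_zero (RInt (fun y => u t y) c d)).
  exact: (is_derive_minus G H). }
rewrite /G /H in E0, E1. rewrite /II. lra.
Qed.

Lemma RInt_support (g : R -> R) a b a' b' :
  a' <= a -> a <= b -> b <= b' -> (forall x, continuous g x) ->
  (forall x, x < a \/ b < x -> g x = 0) ->
  RInt g a' b' = RInt g a b.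
Proof.
move=> H1 H2 H3 Hg H0.
have Hex : forall p q, ex_RInt g p q.
{ move=> p q. apply: ex_RInt_continuous => x _. exact: Hg. }
rewrite -(RInt_Chasles g a' a b') // -(RInt_Chasles g a b b') //.
rewrite (RInt_ext g (fun _ => 0) a' a); last first.
{ move=> x. rewrite Rmin_left // Rmax_right // => Hx. apply: H0. lra. }
rewrite (RInt_ext g (fun _ => 0) b b'); last first.
{ move=> x. rewrite Rmin_left // Rmax_right // => Hx. apply: H0. lra. }
rewrite !RInt_const /scal /plus /= /mult /=. ring.
Qed.

Lemma II_support a b c d a' b' c' d' u :
  a' <= a -> a <= b -> b <= b' -> c' <= c -> c <= d -> d <= d' -> cont2 u ->
  (forall x y, x < a \/ b < x \/ y < c \/ d < y -> u x y = 0) ->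
  II a' b' c' d' u = II a b c d u.
Proof.
move=> H1 H2 H3 H4 H5 H6 Hu H0. rewrite /II.
rewrite (RInt_ext (fun x => RInt (fun y => u x y) c' d')
                  (fun x => RInt (fun y => u x y) c d)); last first.
{ move=> x _. apply: RInt_support => //.
  - move=> y. exact: continuity_2d_pt_snd.
  - move=> y Hy. apply: H0. tauto. }
apply: RInt_support => //.
- move=> x. exact: RInt_param_continuous.
- move=> x Hx. rewrite (RInt_ext _ (fun _ => 0)).
  + rewrite RInt_const /scal /= /mult /=. ring.
  + move=> y _. apply: H0. tauto.
Qed.

(** Integrating a partial derivative leaves boundary terms only; Fubini is
    what makes this true for both variables. *)
Lemma II_dy a b c d w wy : c <= d ->
  (forall x y, is_derive (fun t => w x t) y (wy x y)) -> cont2 wy ->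
  (forall x, w x c = 0) -> (forall x, w x d = 0) ->
  II a b c d wy = 0.
Proof.
move=> Hcd Hw Hc H1 H2. rewrite /II.
rewrite (RInt_ext _ (fun _ => 0)).
- rewrite RInt_const /scal /= /mult /=. ring.
- move=> x _. apply: is_RInt_unique.
  have -> : 0 = minus (w x d) (w x c).
  { rewrite H1 H2 /minus /plus /opp /=. ring. }
  apply: is_RInt_derive => y _; first exact: Hw.
  exact: continuity_2d_pt_snd.
Qed.

Lemma II_dx a b c d w wx : a <= b -> c <= d ->
  (forall x y, is_derive (fun t => w t y) x (wx x y)) -> cont2 wx ->
  (forall y, w a y = 0) -> (forall y, w b y = 0) ->
  II a b c d wx = 0.
Proof.
move=> Hab Hcd Hw Hc H1 H2. rewrite Fubini_continuous //.
apply: (II_dy c d a b (fun y x => w x y) (fun y x => wx x y)) => //.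
exact: cont2_swap.
Qed.

Lemma RInt_subinterval (g : R -> R) a b a' b' :
  a' <= a -> a <= b -> b <= b' -> (forall x, continuous g x) ->
  (forall x, 0 <= g x) -> RInt g a b <= RInt g a' b'.
Proof.
move=> H1 H2 H3 Hg H0.
have Hex : forall p q, ex_RInt g p q.
{ move=> p q. apply: ex_RInt_continuous => x _. exact: Hg. }
rewrite -(RInt_Chasles g a' a b') // -(RInt_Chasles g a b b') //.
have P1 : 0 <= RInt g a' a by apply: RInt_ge_0.
have P2 : 0 <= RInt g b b' by apply: RInt_ge_0.
rewrite /plus /=. lra.
Qed.

Lemma II_lower a b c d a' b' c' d' u k :
  a' <= a -> a <= b -> b <= b' -> c' <= c -> c <= d -> d <= d' -> cont2 u ->
  (forall x y, 0 <= u x y) ->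
  (forall x y, a < x < b -> c < y < d -> k <= u x y) ->
  (b - a) * ((d - c) * k) <= II a' b' c' d' u.
Proof.
move=> H1 H2 H3 H4 H5 H6 Hu H0 Hk.
rewrite -(II_const a b c d).
apply: (Rle_trans _ (II a b c d u)).
{ apply: II_le => //. exact: cont2_const. }
apply: (Rle_trans _ (II a' b' c d u)).
- apply: RInt_subinterval => // x; first exact: RInt_param_continuous.
  apply: RInt_ge_0 => //. exact: cont2_ex_RInt.
- apply: RInt_le; [lra| exact: cont2_ex_RInt_outer.. |].
  move=> x _. apply: RInt_subinterval => // y. exact: continuity_2d_pt_snd.
Qed.

(** * Closed one-forms and their primitives *)

Section Bisection.

Variable P : R -> R -> R -> R -> Prop.

Let rect : Type := (R * R) * (R * R).
Let holds (q : rect) : Prop := P q.1.1 q.1.2 q.2.1 q.2.2.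
Let lower (p : R * R) : R * R := (p.1, (p.1 + p.2) / 2).
Let upper (p : R * R) : R * R := ((p.1 + p.2) / 2, p.2).

Let halving (p q : R * R) : Prop := q = lower p \/ q = upper p.

Let nested (p : nat -> R * R) : (p O).1 <= (p O).2 ->
  (forall n, halving (p n) (p (S n))) ->
  exists x, forall n, (p n).1 <= x <= (p n).2 /\
    (p O).1 <= (p n).1 /\ (p n).2 <= (p O).2 /\
    (p n).2 - (p n).1 = ((p O).2 - (p O).1) / 2 ^ n.
Proof.
move=> H0 Hp.
have Hw : forall n, (p n).2 - (p n).1 = ((p O).2 - (p O).1) / 2 ^ n.
{ elim=> [|n IH]; first by rewrite /=; field.
  have H2 : 2 ^ n <> 0 by apply: pow_nonzero; lra.
  have E : ((p O).2 - (p O).1) / 2 ^ S n = ((p O).2 - (p O).1) / 2 ^ n / 2.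
  { rewrite /=. field. exact: H2. }
  case: (Hp n) => -> /=; rewrite E -IH; field. }
have Hle : forall n, (p n).1 <= (p n).2.
{ move=> n. have : 0 <= ((p O).2 - (p O).1) / 2 ^ n.
  { apply: Rmult_le_pos; first lra.
    apply: Rlt_le. apply: Rinv_0_lt_compat. apply: pow_lt. lra. }
  rewrite -Hw. lra. }
have Hmon : forall n k, (p n).1 <= (p (n + k)%nat).1 /\
    (p (n + k)%nat).2 <= (p n).2.
{ move=> n. elim=> [|k IH]; first by rewrite Nat.add_0_r; lra.
  rewrite Nat.add_succ_r. have Hk := Hle (n + k)%nat.
  case: (Hp (n + k)%nat) => -> /=; lra. }
have Hcross : forall n m, (p n).1 <= (p m).2.
{ move=> n m. have [H1 _] := Hmon n m. have [_ H2] := Hmon m n.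
  rewrite Nat.add_comm in H2. have := Hle (n + m)%nat. lra. }
have [x [Hx1 Hx2]] : {x | is_lub (fun t => exists n, t = (p n).1) x}.
{ apply: completeness.
  - exists (p O).2 => _ [n ->]. exact: Hcross.
  - by exists (p O).1, O. }
exists x => n. split; last split; last split.
- split; first by apply: Hx1; exists n.
  apply: Hx2 => _ [m ->]. exact: Hcross.
- exact: (proj1 (Hmon O n)).
- exact: (proj2 (Hmon O n)).
- exact: Hw.
Qed.

Hypothesis quarter : forall a b c d,
  P a ((a + b) / 2) c ((c + d) / 2) -> P ((a + b) / 2) b c ((c + d) / 2) ->
  P a ((a + b) / 2) ((c + d) / 2) d -> P ((a + b) / 2) b ((c + d) / 2) d ->
  P a b c d.

(** Induction on rectangles by quartering: if the property failed, it would
    fail on one of the quarters, and so on down to a point, where it holds by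
    assumption on small rectangles. *)
Lemma rectangle_induction (a b c d : R) : a <= b -> c <= d ->
  (forall x y, a <= x <= b -> c <= y <= d -> exists e, 0 < e /\
     forall a' b' c' d', a <= a' -> a' <= x <= b' -> b' <= b ->
       c <= c' -> c' <= y <= d' -> d' <= d ->
       b' - a' < e -> d' - c' < e -> P a' b' c' d') ->
  P a b c d.
Proof.
move=> Hab Hcd Hloc. apply: NNPP => Hno.
have Hstep : forall q : rect, exists q' : rect,
  (halving q.1 q'.1 /\ halving q.2 q'.2) /\ (~ holds q -> ~ holds q').
{ move=> [[a0 b0] [c0 d0]]. apply: NNPP => Hq.
  have Hall : forall p r, halving (a0, b0) p -> halving (c0, d0) r ->
    P p.1 p.2 r.1 r.2.
  { move=> p r Hp Hr. apply: NNPP => H. apply: Hq.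
    by exists (p, r). }
  apply: Hq. exists (lower (a0, b0), lower (c0, d0)). split.
  - split; by left.
  - move=> H _. apply: H. rewrite /holds /=.
    apply: quarter.
    + apply: (Hall (lower (a0, b0)) (lower (c0, d0))); by left.
    + apply: (Hall (upper (a0, b0)) (lower (c0, d0))); [by right|by left].
    + apply: (Hall (lower (a0, b0)) (upper (c0, d0))); [by left|by right].
    + apply: (Hall (upper (a0, b0)) (upper (c0, d0))); by right. }
pose next q := proj1_sig (constructive_indefinite_description _ (Hstep q)).
have Hnext : forall q, (halving q.1 (next q).1 /\ halving q.2 (next q).2) /\
    (~ holds q -> ~ holds (next q)).
{ move=> q. exact: (proj2_sig (constructive_indefinite_description _ (Hstep q))). }
pose s n := Nat.iter n next ((a, b), (c, d)).
have Hs : forall n, ~ holds (s n).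
{ elim=> [|n IH]; first exact: Hno.
  exact: (proj2 (Hnext (s n))). }
have [x Hx] := nested (fun n => (s n).1) Hab
  (fun n => proj1 (proj1 (Hnext (s n)))).
have [y Hy] := nested (fun n => (s n).2) Hcd
  (fun n => proj2 (proj1 (Hnext (s n)))).
have [e [He HP]] := Hloc x y (proj1 (Hx O)) (proj1 (Hy O)).
have [N HN] : exists N, b - a < e * 2 ^ N /\ d - c < e * 2 ^ N.
{ have [N HN] := Pow_x_infinity 2 ltac:(rewrite Rabs_right; lra)
    ((b - a + (d - c)) / e + 1).
  exists N. have := HN N (le_n N).
  rewrite Rabs_right; last by apply: Rle_ge; apply: pow_le; lra.
  move=> /Rge_le H. have : e * ((b - a + (d - c)) / e + 1) <= e * 2 ^ N.
  { apply: Rmult_le_compat_l; lra. }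
  have -> : e * ((b - a + (d - c)) / e + 1) = b - a + (d - c) + e by field; lra.
  lra. }
have H2 : 0 < 2 ^ N by apply: pow_lt; lra.
apply: (Hs N). have HxN := Hx N. have HyN := Hy N. rewrite /= in HxN HyN.
apply: HP; try lra.
- have [_ [_ [_ ->]]] := HxN. apply/Rlt_div_l => //. lra.
- have [_ [_ [_ ->]]] := HyN. apply/Rlt_div_l => //. lra.
Qed.

End Bisection.

(** The integral of [p dx + r dy] along the boundary of a rectangle. *)
Definition boundary_integral (p r : R -> R -> R) (a b c d : R) : R :=
  RInt (fun x => p x c - p x d) a b + RInt (fun y => r b y - r a y) c d.

(** [p dx + r dy] is differentiable at the point, and closed there. *)
Definition closed_at (p r : R -> R -> R) (x0 y0 : R) : Prop :=
  exists p1 k r2, forall e, 0 < e -> exists dl, 0 < dl /\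
    forall x y, Rabs (x - x0) < dl -> Rabs (y - y0) < dl ->
    Rabs (p x y - p x0 y0 - p1 * (x - x0) - k * (y - y0)) <=
      e * (Rabs (x - x0) + Rabs (y - y0)) /\
    Rabs (r x y - r x0 y0 - k * (x - x0) - r2 * (y - y0)) <=
      e * (Rabs (x - x0) + Rabs (y - y0)).

Section ClosedForm.

Variables p r : R -> R -> R.
Hypothesis (Hp : cont2 p) (Hr : cont2 r).

Let p_int y a b : ex_RInt (fun x => p x y) a b.
Proof. apply: (cont2_ex_RInt (fun y x => p x y)). exact: cont2_swap. Qed.
Let r_int x a b : ex_RInt (fun y => r x y) a b.
Proof. exact: cont2_ex_RInt. Qed.

Lemma boundary_integral_split a b c d :
  boundary_integral p r a b c d =
  RInt (fun x => p x c) a b - RInt (fun x => p x d) a b +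
  (RInt (r b) c d - RInt (r a) c d).
Proof.
rewrite /boundary_integral; congr (_ + _);
  by apply: (RInt_minus (V := R_CompleteNormedModule)).
Qed.

Let Chasles f a b c :
  ex_RInt f a b -> ex_RInt f b c -> RInt f a c = RInt f a b + RInt f b c.
Proof.
by move=> H1 H2; rewrite -(RInt_Chasles (V := R_CompleteNormedModule) f a b c).
Qed.

Lemma boundary_integral_hsplit a b c d m :
  boundary_integral p r a b c d =
  boundary_integral p r a m c d + boundary_integral p r m b c d.
Proof.
rewrite !boundary_integral_split (Chasles _ a m b) //
  (Chasles (fun x => p x d) a m b) //. ring.
Qed.

Lemma boundary_integral_vsplit a b c d m :
  boundary_integral p r a b c d =
  boundary_integral p r a b c m + boundary_integral p r a b m d.
Proof.
rewrite !boundary_integral_split (Chasles _ c m d) //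
  (Chasles (r a) c m d) //. ring.
Qed.

Lemma boundary_integral_vswap a b c d :
  boundary_integral p r a b d c = - boundary_integral p r a b c d.
Proof.
have := boundary_integral_vsplit a b c c d.
rewrite [X in X = _]boundary_integral_split !RInt_point /zero /=. lra.
Qed.

Lemma boundary_integral_hswap a b c d :
  boundary_integral p r b a c d = - boundary_integral p r a b c d.
Proof.
have := boundary_integral_hsplit a a c d b.
rewrite [X in X = _]boundary_integral_split !RInt_point /zero /=. lra.
Qed.

Lemma RInt_near_const (f : R -> R) a b k e : a <= b -> ex_RInt f a b ->
  (forall x, a <= x <= b -> Rabs (f x - k) <= e) ->
  Rabs (RInt f a b - (b - a) * k) <= (b - a) * e.
Proof.
move=> Hab Hf H.
have E : RInt f a b - (b - a) * k = RInt (fun x => f x - k) a b.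
{ rewrite (RInt_minus (V := R_CompleteNormedModule) f (fun _ => k)) //.
  - by rewrite RInt_const.
  - exact: ex_RInt_const. }
rewrite E. apply: abs_RInt_le_const => //.
apply: (ex_RInt_minus (V := R_NormedModule) f (fun _ => k)) => //.
exact: ex_RInt_const.
Qed.

(** An affine closed form integrates to zero; only the error of the first order
    expansion contributes. *)
Lemma boundary_integral_small x0 y0 e : closed_at p r x0 y0 -> 0 < e ->
  exists dl, 0 < dl /\ forall a b c d, a <= x0 <= b -> c <= y0 <= d ->
    b - a < dl -> d - c < dl ->
    Rabs (boundary_integral p r a b c d) <= e * (b - a + (d - c)) ^ 2.
Proof.
move=> [p1 [k [r2 H]]] He.
have [dl [Hdl Hloc]] := H (e / 2) ltac:(lra).
exists dl. split=> // a b c d Hx Hy Hab Hcd.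
have Hs : forall x y, a <= x <= b -> c <= y <= d ->
  Rabs (p x y - p x0 y0 - p1 * (x - x0) - k * (y - y0)) <=
    e / 2 * (b - a + (d - c)) /\
  Rabs (r x y - r x0 y0 - k * (x - x0) - r2 * (y - y0)) <=
    e / 2 * (b - a + (d - c)).
{ move=> x y Hx' Hy'.
  have Hx1 : Rabs (x - x0) <= b - a by apply: Rabs_le; lra.
  have Hy1 : Rabs (y - y0) <= d - c by apply: Rabs_le; lra.
  have [H1 H2] := Hloc x y ltac:(lra) ltac:(lra).
  have H3 : e / 2 * (Rabs (x - x0) + Rabs (y - y0)) <=
    e / 2 * (b - a + (d - c)) by apply: Rmult_le_compat_l; lra.
  split; lra. }
rewrite /boundary_integral.
have B1 : Rabs (RInt (fun x => p x c - p x d) a b - (b - a) * (k * (c - d))) <=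
    (b - a) * (e * (b - a + (d - c))).
{ apply: RInt_near_const; first lra.
  - by apply: (ex_RInt_minus (V := R_NormedModule)).
  - move=> x Hx'.
    have [/Rabs_le_between H1 _] := Hs x c Hx' ltac:(lra).
    have [/Rabs_le_between H2 _] := Hs x d Hx' ltac:(lra).
    apply: Rabs_le. lra. }
have B2 : Rabs (RInt (fun y => r b y - r a y) c d - (d - c) * (k * (b - a))) <=
    (d - c) * (e * (b - a + (d - c))).
{ apply: RInt_near_const; first lra.
  - by apply: (ex_RInt_minus (V := R_NormedModule)).
  - move=> y Hy'.
    have [_ /Rabs_le_between H1] := Hs b y ltac:(lra) Hy'.
    have [_ /Rabs_le_between H2] := Hs a y ltac:(lra) Hy'.
    apply: Rabs_le. lra. }
move/Rabs_le_between: B1 => B1. move/Rabs_le_between: B2 => B2.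
apply: Rabs_le. lra.
Qed.

(** Goursat's theorem. The estimate is taken in the form [e * (s + t)^2], where
    [s] and [t] are the sides: near a point it follows from closedness, and it
    is additive under quartering, four quarters of the rectangle contributing a
    quarter of the bound each. *)
Lemma Goursat a b c d : a <= b -> c <= d ->
  (forall x y, a <= x <= b -> c <= y <= d -> closed_at p r x y) ->
  boundary_integral p r a b c d = 0.
Proof.
move=> Hab Hcd Hcl.
have HB : forall e, 0 < e ->
    Rabs (boundary_integral p r a b c d) <= e * (b - a + (d - c)) ^ 2.
{ move=> e He.
  apply: (rectangle_induction (fun a b c d =>
    Rabs (boundary_integral p r a b c d) <= e * (b - a + (d - c)) ^ 2)) => //.
  - move=> a' b' c' d' H1 H2 H3 H4.
    rewrite (boundary_integral_vsplit _ _ _ _ ((c' + d') / 2))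
      (boundary_integral_hsplit a' b' c' _ ((a' + b') / 2))
      (boundary_integral_hsplit a' b' _ d' ((a' + b') / 2)).
    move/Rabs_le_between: H1 => H1. move/Rabs_le_between: H2 => H2.
    move/Rabs_le_between: H3 => H3. move/Rabs_le_between: H4 => H4.
    apply: Rabs_le. lra.
  - move=> x y Hx Hy.
    have [dl [Hdl H]] := boundary_integral_small x y e (Hcl x y Hx Hy) He.
    exists dl. split=> // *. apply: H; lra. }
apply: NNPP => Hne.
have Hpos := Rabs_pos_lt _ Hne.
have Hs : 0 <= (b - a + (d - c)) ^ 2 by apply: pow2_ge_0.
set s := (b - a + (d - c)) ^ 2 in HB Hs.
set L := Rabs (boundary_integral p r a b c d) in HB Hpos.
have := HB (L / 2 / (s + 1)) ltac:(by apply: Rdiv_lt_0_compat; lra).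
have -> : L / 2 / (s + 1) * s = L / 2 - L / 2 / (s + 1) by field; lra.
have : 0 < L / 2 / (s + 1) by apply: Rdiv_lt_0_compat; lra.
lra.
Qed.

Lemma zero_by_continuity (f : R -> R) t0 (A : R -> Prop) :
  continuous f t0 -> (forall t, A t -> f t = 0) ->
  (forall e, 0 < e -> exists t, A t /\ Rabs (t - t0) < e) -> f t0 = 0.
Proof.
move=> Hf HA Hacc. apply: NNPP => Hne.
have [e He] := proj1 (filterlim_locally _ _) Hf (mkposreal _ (Rabs_pos_lt _ Hne)).
have [t [Ht Hte]] := Hacc e (cond_pos e).
have := He t Hte. rewrite /ball /= /AbsRing_ball /abs /minus /plus /opp /=.
rewrite HA // Rplus_0_l Rabs_Ropp. lra.
Qed.

Let bottom_continuous a b d t :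
  continuous (fun t => boundary_integral p r a b t d) t.
Proof.
apply: (continuous_plus (V := R_NormedModule)).
- apply: (RInt_param_continuous (fun t x => p x t - p x d)).
  move=> x y. apply: continuity_2d_pt_minus.
  + exact: (cont2_swap p).
  + apply: (continuity_2d_pt_of_snd (fun x => p x d)).
    exact: (continuity_2d_pt_fst p).
- apply: (continuous_RInt_2 (V := R_NormedModule) _ t d).
  exists (mkposreal 1 Rlt_0_1) => z _. apply: RInt_correct.
  by apply: (ex_RInt_minus (V := R_NormedModule)).
Qed.

(** Continuity of the form makes a horizontal line of singularities removable:
    a rectangle touching the line is a limit of rectangles that avoid it. *)
Lemma Goursat_off_line a b c d y0 : a <= b -> c <= d ->
  (forall x y, a <= x <= b -> c <= y <= d -> y <> y0 -> closed_at p r x y) ->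
  boundary_integral p r a b c d = 0.
Proof.
move=> Hab Hcd Hcl.
have Havoid : forall y y', c <= y <= y' -> y' <= d -> y0 < y \/ y' < y0 ->
  boundary_integral p r a b y y' = 0.
{ move=> y y' Hy Hy' Hy0. apply: Goursat => //; first lra.
  move=> x t Hx Ht. apply: Hcl => //; lra. }
case: (Rlt_dec y0 c) => H1; first by apply: Havoid; lra.
case: (Rlt_dec d y0) => H2; first by apply: Havoid; lra.
have Htouch : forall y, c <= y <= d -> boundary_integral p r a b y0 y = 0.
{ move=> y Hy.
  apply: (zero_by_continuity (fun t => boundary_integral p r a b t y) y0
    (fun t => exists s, 0 < s <= 1 /\ t = y0 + s * (y - y0))) => //.
  - move=> _ [s [Hs ->]].
    case: (Rtotal_order y y0) => [Hlt|[->|Hlt]].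
    + rewrite boundary_integral_vswap Havoid; first ring; nra.
    + rewrite Rminus_diag Rmult_0_r Rplus_0_r.
      have := boundary_integral_vswap a b y0 y0. lra.
    + apply: Havoid; nra.
  - move=> e He.
    have [s [Hs [S1 S2]]] := pos_min 1 (e / (Rabs (y - y0) + 1)) Rlt_0_1
      ltac:(have := Rabs_pos (y - y0) => ?; apply: Rdiv_lt_0_compat; lra).
    exists (y0 + s * (y - y0)). split; first by exists s.
    have -> : y0 + s * (y - y0) - y0 = s * (y - y0) by ring.
    have HR := Rabs_pos (y - y0).
    have H3 : s * (Rabs (y - y0) + 1) <= e by apply/Rle_div_r; lra.
    rewrite Rabs_mult Rabs_right; lra. }
rewrite (boundary_integral_vsplit _ _ _ _ y0) boundary_integral_vswap.
rewrite !Htouch; lra.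
Qed.

(** The primitive is an integral along a broken line. Its two expressions, one
    for each order of the sides, differ by a boundary integral, and each of them
    gives one of the partial derivatives. *)
Lemma closed_form_exact a b c d y0 : a < b -> c < d ->
  (forall x y, a < x < b -> c < y < d -> y <> y0 -> closed_at p r x y) ->
  exists Q : R -> R -> R, forall x y, a < x < b -> c < y < d ->
    is_derive (fun t => Q t y) x (p x y) /\
    is_derive (fun t => Q x t) y (r x y).
Proof.
move=> Hab Hcd Hcl.
have HL : forall x x' y y', a < x < b -> a < x' < b -> c < y < d -> c < y' < d ->
  boundary_integral p r x x' y y' = 0.
{ have H1 : forall x x' y y', a < x < b -> a < x' < b -> c < y < d ->
    c < y' < d -> x <= x' -> boundary_integral p r x x' y y' = 0.
  { move=> x x' y y' Hx Hx' Hy Hy' Hle.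
    have [Hle'|Hle'] : y <= y' \/ y' <= y by lra.
    - apply: (Goursat_off_line _ _ _ _ y0) => // *; apply: Hcl => //; lra.
    - rewrite boundary_integral_vswap (Goursat_off_line _ _ _ _ y0) //; first ring.
      move=> *; apply: Hcl => //; lra. }
  move=> x x' y y' Hx Hx' Hy Hy'.
  have [Hle|Hle] : x <= x' \/ x' <= x by lra.
  - exact: H1.
  - rewrite boundary_integral_hswap H1 //. ring. }
pose x1 := (a + b) / 2. pose y1 := (c + d) / 2.
have Hx1 : a < x1 < b by rewrite /x1; lra.
have Hy1 : c < y1 < d by rewrite /y1; lra.
pose Q x y := RInt (fun t => p t y1) x1 x + RInt (r x) y1 y.
have HQ : forall x y, a < x < b -> c < y < d ->
  Q x y = RInt (fun t => p t y) x1 x + RInt (r x1) y1 y.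
{ move=> x y Hx Hy. have := HL x1 x y1 y Hx1 Hx Hy1 Hy.
  rewrite boundary_integral_split /Q. lra. }
exists Q => x y Hx Hy. split.
- apply: (is_derive_ext_loc
    (fun x => RInt (fun t => p t y) x1 x + RInt (r x1) y1 y)).
  + have Hm : 0 < Rmin (x - a) (b - x) by apply: Rmin_glb_lt; lra.
    exists (mkposreal _ Hm) => z Hz. symmetry. apply: HQ => //.
    rewrite /ball /= /AbsRing_ball /abs /minus /plus /opp /= in Hz.
    have H3 := Rmin_l (x - a) (b - x). have H4 := Rmin_r (x - a) (b - x).
    have [H5 H6] := Rabs_def2 _ _ Hz. lra.
  + rewrite -[X in is_derive _ _ X]Rplus_0_r.
    apply: (is_derive_plus (V := R_NormedModule)); last first.
    { exact: (is_derive_const (V := R_NormedModule)). }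
    apply: (is_derive_RInt (fun t => p t y) _ x1).
    * exists (mkposreal 1 Rlt_0_1) => z _. exact: RInt_correct.
    * exact: (continuity_2d_pt_fst p).
- rewrite /Q -[X in is_derive _ _ X]Rplus_0_l.
  apply: (is_derive_plus (V := R_NormedModule)).
  { exact: (is_derive_const (V := R_NormedModule)). }
  apply: (is_derive_RInt (r x) _ y1).
  + exists (mkposreal 1 Rlt_0_1) => z _. exact: RInt_correct.
  + exact: (continuity_2d_pt_snd r).
Qed.

End ClosedForm.

(** * Continuity and differentiability over the complex numbers *)

Definition ccont (F : C -> C) (z : C) : Prop :=
  forall e, 0 < e -> exists d, 0 < d /\ forall w, disc z d w -> disc (F z) e (F w).

Definition re2 (F : C -> C) (x y : R) : R := Re (F (x, y)).
Definition im2 (F : C -> C) (x y : R) : R := Im (F (x, y)).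

Lemma ccont_parts F x y : ccont F (x, y) <->
  continuity_2d_pt (re2 F) x y /\ continuity_2d_pt (im2 F) x y.
Proof.
split.
- move=> H.
  have Hpart : forall P : C -> R, (forall z w, Rabs (P z - P w) <= Cmod (z - w)%C) ->
    continuity_2d_pt (fun x y => P (F (x, y))) x y.
  { move=> P HP e. have [d [Hd HF]] := H e (cond_pos e).
    have Hd2 : 0 < d / 2 by lra.
    exists (mkposreal _ Hd2) => u v /= Hu Hv.
    apply: Rle_lt_trans (HP _ _) _. apply: HF. exact: disc_of_parts. }
  split; apply: Hpart => z w.
  + exact: (proj1 (Cmod_sub_split z w)).
  + exact: (proj1 (proj2 (Cmod_sub_split z w))).
- move=> [H1 H2] e He.
  have He2 : 0 < e / 2 by lra.
  have [d1 Hd1] := H1 (mkposreal _ He2). have [d2 Hd2] := H2 (mkposreal _ He2).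
  exists (Rmin d1 d2). split.
  { apply: Rmin_glb_lt; exact: cond_pos. }
  case=> u v /parts_of_disc [A1 A2].
  have B1 := Rmin_l d1 d2. have B2 := Rmin_r d1 d2.
  have [_ [_ H3]] := Cmod_split (F (u, v) - F (x, y))%C.
  have H4 : Rabs (re2 F u v - re2 F x y) < e / 2.
  { apply: Hd1; lra. }
  have H5 : Rabs (im2 F u v - im2 F x y) < e / 2.
  { apply: Hd2; lra. }
  rewrite /re2 /im2 in H4 H5. rewrite /disc. apply: Rle_lt_trans H3 _.
  have E1 : Re (F (u, v) - F (x, y))%C = Re (F (u, v)) - Re (F (x, y)) by [].
  have E2 : Im (F (u, v) - F (x, y))%C = Im (F (u, v)) - Im (F (x, y)) by [].
  rewrite E1 E2. lra.
Qed.

Lemma ccont_ext F G z : (exists d, 0 < d /\ forall w, disc z d w -> F w = G w) ->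
  ccont F z -> ccont G z.
Proof.
move=> [d [Hd H]] HF e He. have [d' [Hd' HF']] := HF e He.
exists (Rmin d d'). split; first exact: Rmin_glb_lt.
move=> w Hw. rewrite -(H z); last exact: disc_center.
rewrite -(H w); last exact: Rlt_le_trans Hw (Rmin_l _ _).
apply: HF'. exact: Rlt_le_trans Hw (Rmin_r _ _).
Qed.

Lemma ccont_const k z : ccont (fun _ => k) z.
Proof. move=> e He. exists 1. split; [lra|] => w _. exact: disc_center. Qed.

Lemma ccont_id z : ccont (fun w => w) z.
Proof. move=> e He. by exists e. Qed.

Lemma ccont_mult F G z : ccont F z -> ccont G z -> ccont (fun w => F w * G w)%C z.
Proof.
case: z => x y /ccont_parts [H1 H2] /ccont_parts [H3 H4].
apply/ccont_parts. split.
- apply: (continuity_2d_pt_minus (fun x y => re2 F x y * re2 G x y)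
    (fun x y => im2 F x y * im2 G x y)); exact: continuity_2d_pt_mult.
- apply: (continuity_2d_pt_plus (fun x y => re2 F x y * im2 G x y)
    (fun x y => im2 F x y * re2 G x y)); exact: continuity_2d_pt_mult.
Qed.

Lemma ccont_minus F G z : ccont F z -> ccont G z -> ccont (fun w => F w - G w)%C z.
Proof.
case: z => x y /ccont_parts [H1 H2] /ccont_parts [H3 H4].
apply/ccont_parts. split.
- exact: (continuity_2d_pt_minus (re2 F) (re2 G)).
- exact: (continuity_2d_pt_minus (im2 F) (im2 G)).
Qed.

Lemma ccont_inv F z : ccont F z -> F z <> 0%C -> ccont (fun w => / F w)%C z.
Proof.
case: z => x y /ccont_parts [H1 H2] Hne.
have HN : continuity_2d_pt
    (fun x y => / (re2 F x y * re2 F x y + im2 F x y * im2 F x y)) x y.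
{ apply: continuity_2d_pt_inv.
  - apply: continuity_2d_pt_plus; exact: continuity_2d_pt_mult.
  - move=> H. apply: Hne. rewrite /re2 /im2 in H.
    move: H. case: (F (x, y)) => p q. rewrite /Re /Im /= => H.
    have := pow2_ge_0 p. have := pow2_ge_0 q. move=> Hq' Hp'.
    have Hp : p = 0 by apply: Rsqr_0_uniq; rewrite /Rsqr; nra.
    have Hq : q = 0 by apply: Rsqr_0_uniq; rewrite /Rsqr; nra.
    by rewrite Hp Hq. }
apply/ccont_parts. split.
- apply: (continuity_2d_pt_ext (fun x y => re2 F x y *
    / (re2 F x y * re2 F x y + im2 F x y * im2 F x y))).
  + move=> u v. rewrite /re2 /im2. case: (F (u, v)) => p q.
    rewrite /Re /Im /Cinv /= !Rmult_1_r. by [].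
  + exact: continuity_2d_pt_mult.
- apply: (continuity_2d_pt_ext (fun x y => - im2 F x y *
    / (re2 F x y * re2 F x y + im2 F x y * im2 F x y))).
  + move=> u v. rewrite /re2 /im2. case: (F (u, v)) => p q.
    rewrite /Re /Im /Cinv /= !Rmult_1_r. by [].
  + apply: continuity_2d_pt_mult => //. exact: continuity_2d_pt_opp.
Qed.

Lemma ccont_pow F n z : ccont F z -> ccont (fun w => F w ^ n)%C z.
Proof.
move=> H. elim: n => [|n IH]; first exact: ccont_const.
apply: (ccont_mult F (fun w => F w ^ n)%C) => //.
Qed.

Lemma ccont_real u x y : continuity_2d_pt u x y ->
  ccont (fun z => RtoC (u (Re z) (Im z))) (x, y).
Proof.
move=> H. apply/ccont_parts. split; first exact: H.
exact: continuity_2d_pt_const.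
Qed.

(** Multiplication by a cut-off turns a function that is continuous on part of
    the plane into one that is continuous everywhere, the only kind that is
    integrated here. *)
Lemma ccont_cutoff (F m : C -> C) z : ccont m z ->
  ccont F z \/ (exists d, 0 < d /\ forall w, disc z d w -> m w = 0%C) ->
  ccont (fun w => F w * m w)%C z.
Proof.
move=> Hm [HF|[d [Hd H0]]]; first exact: ccont_mult.
apply: (ccont_ext (fun _ => 0%C)); last exact: ccont_const.
exists d. split=> // w Hw. rewrite H0 //. ring.
Qed.

Definition has_cderiv (g : C -> C) (z l : C) : Prop :=
  forall e, 0 < e -> exists d, 0 < d /\ forall w, disc z d w ->
    Cmod (g w - g z - l * (w - z))%C <= e * Cmod (w - z)%C.

Lemma ex_derive_has_cderiv (g : C -> C) (z : C) :
  ex_derive (K := C_AbsRing) (V := C_NormedModule) g z ->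
  exists l, has_cderiv g z l.
Proof.
move=> [l [_ Hl]]. exists l => e He.
have [d Hd] := Hl z (fun P H => H) (mkposreal e He).
exists d. split; first exact: cond_pos.
move=> w Hw. have := Hd w Hw. rewrite /norm /= /abs /=.
move=> H. apply: Rle_trans H. right. congr Cmod.
rewrite /minus /plus /opp /scal /= /mult /=. ring.
Qed.

Lemma has_cderiv_lipschitz g z l : has_cderiv g z l ->
  exists d, 0 < d /\ forall w, disc z d w ->
    Cmod (g w - g z)%C <= (Cmod l + 1) * Cmod (w - z)%C.
Proof.
move=> H. have [d [Hd Hw]] := H 1 ltac:(lra).
exists d. split=> // w /Hw H1.
have E : (g w - g z = (g w - g z - l * (w - z)) + l * (w - z))%C by ring.
rewrite E. have := Cmod_triangle (g w - g z - l * (w - z))%C (l * (w - z))%C.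
rewrite Cmod_mult. lra.
Qed.

Lemma has_cderiv_ccont g z l : has_cderiv g z l -> ccont g z.
Proof.
move=> /has_cderiv_lipschitz [d [Hd H]] e He.
have Hl := Cmod_ge_0 l.
have Hk : 0 < e / (Cmod l + 1) by apply: Rdiv_lt_0_compat; lra.
exists (Rmin d (e / (Cmod l + 1))). split; first exact: Rmin_glb_lt.
move=> w Hw. have Hw1 : disc z d w by exact: Rlt_le_trans Hw (Rmin_l _ _).
have Hw2 : Cmod (w - z)%C < e / (Cmod l + 1).
{ exact: Rlt_le_trans Hw (Rmin_r _ _). }
apply: Rle_lt_trans (H w Hw1) _.
apply: (Rlt_le_trans _ ((Cmod l + 1) * (e / (Cmod l + 1)))).
- apply: Rmult_lt_compat_l; lra.
- right. field. lra.
Qed.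

Definition CI (a b c d : R) (F : C -> C) : C :=
  (II a b c d (re2 F), II a b c d (im2 F)).

Lemma ccont_re2 F : (forall z, ccont F z) -> cont2 (re2 F).
Proof. move=> H x y. by have [] := proj1 (ccont_parts F x y) (H (x, y)). Qed.

Lemma ccont_im2 F : (forall z, ccont F z) -> cont2 (im2 F).
Proof. move=> H x y. by have [] := proj1 (ccont_parts F x y) (H (x, y)). Qed.

Lemma CI_ext a b c d F G : (forall z, F z = G z) -> CI a b c d F = CI a b c d G.
Proof.
move=> H. rewrite /CI; congr (_, _); apply: II_ext => x y;
by rewrite /re2 /im2 H.
Qed.

Lemma CI_plus a b c d F G : (forall z, ccont F z) -> (forall z, ccont G z) ->
  CI a b c d (fun z => F z + G z)%C = (CI a b c d F + CI a b c d G)%C.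
Proof.
move=> HF HG. rewrite /CI /Cplus /=. congr (_, _).
- rewrite -II_plus //; exact: ccont_re2.
- rewrite -II_plus //; exact: ccont_im2.
Qed.

Lemma cont2_scal k u : cont2 u -> cont2 (fun x y => k * u x y).
Proof.
move=> H x y. apply: continuity_2d_pt_mult => //. exact: continuity_2d_pt_const.
Qed.

Lemma CI_scal a b c d k F : (forall z, ccont F z) ->
  CI a b c d (fun z => k * F z)%C = (k * CI a b c d F)%C.
Proof.
move=> HF. have H1 := ccont_re2 _ HF. have H2 := ccont_im2 _ HF.
rewrite /CI /Cmult /=. congr (_, _).
- rewrite -!II_scal // -II_minus //; exact: cont2_scal.
- rewrite -!II_scal // -II_plus //; exact: cont2_scal.
Qed.

Lemma CI_le a b c d F M : a <= b -> c <= d -> (forall z, ccont F z) ->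
  (forall x y, a < x < b -> c < y < d -> Cmod (F (x, y)) <= M) ->
  Cmod (CI a b c d F) <= 2 * ((b - a) * ((d - c) * M)).
Proof.
move=> Hab Hcd HF HM.
have H1 : Rabs (II a b c d (re2 F)) <= (b - a) * ((d - c) * M).
{ apply: II_abs_le => // [|x y Hx Hy]; first exact: ccont_re2.
  have [H _] := Cmod_split (F (x, y)). have := HM x y Hx Hy. rewrite /re2. lra. }
have H2 : Rabs (II a b c d (im2 F)) <= (b - a) * ((d - c) * M).
{ apply: II_abs_le => // [|x y Hx Hy]; first exact: ccont_im2.
  have [_ [H _]] := Cmod_split (F (x, y)). have := HM x y Hx Hy. rewrite /im2. lra. }
have [_ [_ H3]] := Cmod_split (CI a b c d F).
rewrite /Re /Im /= in H3. lra.
Qed.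

(** * Angular derivatives and radial weights *)

Lemma continuous_of_partials (Q : R -> R -> R) (p : R -> R -> R) x y e :
  0 < e ->
  (forall u v, Rabs (u - x) < e -> Rabs (v - y) < e ->
     is_derive (fun t => Q t v) u (p u v)) ->
  continuity_2d_pt p x y -> continuous (Q x) y -> continuity_2d_pt Q x y.
Proof.
move=> He HQ Hp Hy eps.
have [d1 Hd1] := Hp (mkposreal 1 Rlt_0_1). rewrite /= in Hd1.
have Heps := cond_pos eps.
have [d2 Hd2] := proj1 (filterlim_locally _ _) Hy
  (mkposreal (eps / 2) ltac:(lra)).
set M := Rabs (p x y) + 1.
have HM : 0 < M by rewrite /M; have := Rabs_pos (p x y); lra.
have Hk : 0 < eps / 2 / M by apply: Rdiv_lt_0_compat; lra.
have Hd : 0 < Rmin (Rmin d1 d2) (Rmin e (eps / 2 / M)).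
{ apply: Rmin_glb_lt; apply: Rmin_glb_lt => //; exact: cond_pos. }
exists (mkposreal _ Hd) => u v /= Hu Hv.
have A1 := Rmin_l (Rmin d1 d2) (Rmin e (eps / 2 / M)).
have A2 := Rmin_r (Rmin d1 d2) (Rmin e (eps / 2 / M)).
have A3 := Rmin_l d1 d2. have A4 := Rmin_r d1 d2.
have A5 := Rmin_l e (eps / 2 / M). have A6 := Rmin_r e (eps / 2 / M).
have B1 : Rabs (Q x v - Q x y) < eps / 2.
{ apply: Hd2. rewrite /ball /= /AbsRing_ball /abs /minus /plus /opp /=.
  rewrite /Rminus in Hv. lra. }
have B2 : Rabs (Q u v - Q x v) <= eps / 2.
{ have [t [Et Ht]] := MVT_cor4 (fun t => Q t v) (fun t => p t v) x
    (Rabs (u - x)) (fun c Hc => HQ c v ltac:(lra) ltac:(lra)) u (Rle_refl _).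
  rewrite Et Rabs_mult.
  have B3 : Rabs (p t v) <= M.
  { have H3 : Rabs (p t v - p x y) < 1 by apply: Hd1; lra.
    have := Rabs_triang (p x y) (p t v - p x y).
    have -> : p x y + (p t v - p x y) = p t v by ring.
    rewrite /M. lra. }
  apply: (Rle_trans _ (M * (eps / 2 / M))).
  - apply: Rmult_le_compat => //; try exact: Rabs_pos. lra.
  - right. field. lra. }
have -> : Q u v - Q x y = (Q u v - Q x v) + (Q x v - Q x y) by ring.
have := Rabs_triang (Q u v - Q x v) (Q x v - Q x y). lra.
Qed.

Lemma cont2_cutoff (u m : R -> R -> R) :
  (forall x y, continuity_2d_pt m x y) ->
  (forall x y, continuity_2d_pt u x y \/ locally_2d (fun x y => m x y = 0) x y) ->
  cont2 (fun x y => u x y * m x y).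
Proof.
move=> Hm Hu x y. case: (Hu x y) => [H|H]; first exact: continuity_2d_pt_mult.
apply: (continuity_2d_pt_ext_loc (fun _ _ => 0)).
- apply: locally_2d_impl H. apply: locally_2d_forall => a b ->. ring.
- exact: continuity_2d_pt_const.
Qed.

Lemma open_interval_margin c A x : c - A < x < c + A ->
  exists e, 0 < e /\ forall u, Rabs (u - x) < e -> c - A < u < c + A.
Proof.
move=> Hx. have [e [He [H1 H2]]] := pos_min (x - (c - A)) (c + A - x) ltac:(lra) ltac:(lra).
exists e. split=> // u Hu. have := Rabs_def2 _ _ Hu. lra.
Qed.

Section Radial.

Variables x0 y0 A A' : R.
Variables rho rho' : R -> R.
Hypothesis (HA : 0 < A) (HAA : A < A').
Hypothesis rho_deriv : forall s, is_derive rho s (rho' s).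
Hypothesis rho'_cont : forall s, continuous rho' s.
Hypothesis rho_supp : forall s, A ^ 2 <= s -> rho s = 0.

Let s2 x y := (x - x0) ^ 2 + (y - y0) ^ 2.

Let s2_cont : cont2 s2.
Proof. exact: sq_dist_cont. Qed.

Let rho_cont s : continuous rho s.
Proof. apply: ex_derive_continuous. by exists (rho' s). Qed.

Lemma rho'_supp s : A ^ 2 < s -> rho' s = 0.
Proof.
move=> Hs. rewrite -(is_derive_unique _ _ _ (rho_deriv s)).
apply: is_derive_unique.
apply: (is_derive_ext_loc (fun _ => 0)).
- exists (mkposreal (s - A ^ 2) ltac:(lra)) => t Ht.
  rewrite /ball /= /AbsRing_ball /abs /minus /plus /opp /= in Ht.
  symmetry. apply: rho_supp. have := Rabs_def2 _ _ Ht. lra.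
- exact: (is_derive_const (V := R_NormedModule)).
Qed.

Let comp_s2 (g : R -> R) : (forall s, continuous g s) ->
  cont2 (fun x y => g (s2 x y)).
Proof.
move=> Hg x y. apply: (continuity_1d_2d_pt_comp g s2); last exact: s2_cont.
apply/continuity_pt_filterlim. exact: Hg.
Qed.

Let inside x y := x0 - A' < x < x0 + A' /\ y0 - A' < y < y0 + A'.

Let inside_or_far x y :
  inside x y \/ locally_2d (fun x y => A ^ 2 < s2 x y) x y.
Proof.
case: (Rlt_dec (A ^ 2) (s2 x y)) => H.
- right. have [d Hd] := s2_cont x y (mkposreal (s2 x y - A ^ 2) ltac:(lra)).
  exists d => u v Hu Hv. have := Rabs_def2 _ _ (Hd u v Hu Hv). rewrite /=. lra.
- left. rewrite /s2 in H. have H1 := pow2_ge_0 (x - x0).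
  have H2 := pow2_ge_0 (y - y0). rewrite /inside. split; split; nra.
Qed.

Variables p r Q : R -> R -> R.
Hypothesis (Hp : cont2 p) (Hr : cont2 r).
Hypothesis HQ : forall x y, x0 - A' < x < x0 + A' -> y0 - A' < y < y0 + A' ->
  is_derive (fun t => Q t y) x (p x y) /\ is_derive (fun t => Q x t) y (r x y).

Let inside_open x y : inside x y -> exists e, 0 < e /\
  forall u v, Rabs (u - x) < e -> Rabs (v - y) < e -> inside u v.
Proof.
move=> [/open_interval_margin [e1 [He1 H1]] /open_interval_margin [e2 [He2 H2]]].
have [e [He [E1 E2]]] := pos_min e1 e2 He1 He2.
exists e. split=> // u v Hu Hv. split; [apply: H1|apply: H2]; lra.
Qed.

Let Q_cont x y : inside x y -> continuity_2d_pt Q x y.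
Proof.
move=> Hin. have [e [He H]] := inside_open x y Hin.
apply: (continuous_of_partials Q p x y e) => //.
- move=> u v Hu Hv. have [H1 H2] := H u v Hu Hv. exact: (proj1 (HQ u v H1 H2)).
- apply: ex_derive_continuous. exists (r x y).
  exact: (proj2 (HQ x y (proj1 Hin) (proj2 Hin))).
Qed.

Let mixed x y := Q x y * (2 * (x - x0) * (y - y0) * rho' (s2 x y)).

Let poly_cont : cont2 (fun x y => 2 * (x - x0) * (y - y0)).
Proof.
move=> x y. apply: continuity_2d_pt_mult.
- apply: continuity_2d_pt_mult; first exact: continuity_2d_pt_const.
  apply: continuity_2d_pt_minus; first exact: continuity_2d_pt_id1.
  exact: continuity_2d_pt_const.
- apply: continuity_2d_pt_minus; first exact: continuity_2d_pt_id2.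
  exact: continuity_2d_pt_const.
Qed.

Let mixed_cont : cont2 mixed.
Proof.
apply: (cont2_cutoff Q (fun x y => 2 * (x - x0) * (y - y0) * rho' (s2 x y))).
- move=> x y. apply: (continuity_2d_pt_mult
    (fun x y => 2 * (x - x0) * (y - y0)) (fun x y => rho' (s2 x y))).
  + exact: poly_cont.
  + exact: comp_s2.
- move=> x y. case: (inside_or_far x y) => H; first by left; exact: Q_cont.
  right. apply: locally_2d_impl H. apply: locally_2d_forall => u v Huv.
  rewrite rho'_supp //. ring.
Qed.

Let fx x y := p x y * ((y - y0) * rho (s2 x y)).
Let fy x y := r x y * ((x - x0) * rho (s2 x y)).

Let fx_cont : cont2 fx.
Proof.
move=> x y. apply: continuity_2d_pt_mult => //.
apply: continuity_2d_pt_mult; last exact: comp_s2.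
apply: continuity_2d_pt_minus; first exact: continuity_2d_pt_id2.
exact: continuity_2d_pt_const.
Qed.

Let fy_cont : cont2 fy.
Proof.
move=> x y. apply: continuity_2d_pt_mult => //.
apply: continuity_2d_pt_mult; last exact: comp_s2.
apply: continuity_2d_pt_minus; first exact: continuity_2d_pt_id1.
exact: continuity_2d_pt_const.
Qed.

Let dx x y : is_derive (fun t => Q t y * ((y - y0) * rho (s2 t y))) x
  (fx x y + mixed x y).
Proof.
case: (inside_or_far x y) => [Hin|Hfar].
- have HQx := proj1 (HQ x y (proj1 Hin) (proj2 Hin)).
  rewrite /fx /mixed /s2. auto_derive.
  + split; first by exists (p x y). split=> //.
    by exists (rho' (s2 x y)); exact: rho_deriv.
  + rewrite (is_derive_unique _ _ _ HQx).
    rewrite (is_derive_unique (fun x => rho x) _ _ (rho_deriv _)).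
    have -> : (x + - x0) * ((x + - x0) * 1) + (y - y0) * ((y - y0) * 1) =
      (x - x0) ^ 2 + (y - y0) ^ 2 by ring.
    ring.
- have Hs := locally_2d_singleton _ _ _ Hfar.
  rewrite /fx /mixed rho'_supp // rho_supp; last lra.
  apply: (is_derive_ext_loc (fun _ => 0)).
  + have [d Hd] := locally_2d_1d_const_y _ _ _ Hfar.
    exists d => t Ht. have := Hd t Ht => H.
    rewrite rho_supp ?Rmult_0_r //; lra.
  + have -> : p x y * ((y - y0) * 0) + Q x y * (2 * (x - x0) * (y - y0) * 0) = 0.
    { ring. }
    exact: (is_derive_const (V := R_NormedModule)).
Qed.

Let dy x y : is_derive (fun t => Q x t * ((x - x0) * rho (s2 x t))) y
  (fy x y + mixed x y).
Proof.
case: (inside_or_far x y) => [Hin|Hfar].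
- have HQy := proj2 (HQ x y (proj1 Hin) (proj2 Hin)).
  rewrite /fy /mixed /s2. auto_derive.
  + split; first by exists (r x y). split=> //.
    by exists (rho' (s2 x y)); exact: rho_deriv.
  + rewrite (is_derive_unique (fun t => Q x t) _ _ HQy).
    rewrite (is_derive_unique (fun x => rho x) _ _ (rho_deriv _)).
    have -> : (x - x0) * ((x - x0) * 1) + (y + - y0) * ((y + - y0) * 1) =
      (x - x0) ^ 2 + (y - y0) ^ 2 by ring.
    ring.
- have Hs := locally_2d_singleton _ _ _ Hfar.
  rewrite /fy /mixed rho'_supp // rho_supp; last lra.
  apply: (is_derive_ext_loc (fun _ => 0)).
  + have [d Hd] := locally_2d_1d_const_x _ _ _ Hfar.
    exists d => t Ht. have := Hd t Ht => H.
    rewrite rho_supp ?Rmult_0_r //; lra.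
  + have -> : r x y * ((x - x0) * 0) + Q x y * (2 * (x - x0) * (y - y0) * 0) = 0.
    { ring. }
    exact: (is_derive_const (V := R_NormedModule)).
Qed.

(** [y Qx - x Qy] is the derivative of [Q] along circles, on which the weight is
    constant. In Cartesian coordinates: the two terms are partial derivatives of
    [y Q rho] and [x Q rho] up to the same function [mixed], and these products
    vanish on the sides of the square. *)
Lemma angular_derivative_integral :
  II (x0 - A') (x0 + A') (y0 - A') (y0 + A')
    (fun x y => p x y * ((y - y0) * rho (s2 x y))
              - r x y * ((x - x0) * rho (s2 x y))) = 0.
Proof.
have Hedge : forall x y, A' <= Rabs (x - x0) \/ A' <= Rabs (y - y0) ->
  rho (s2 x y) = 0.
{ move=> x y H. apply: rho_supp. rewrite /s2.
  have H1 := pow2_ge_0 (x - x0). have H2 := pow2_ge_0 (y - y0).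
  have H3 : forall t, A' <= Rabs t -> A ^ 2 <= t ^ 2.
  { move=> t Ht. rewrite -(pow2_abs t). apply: pow_incr. lra. }
  case: H => /H3; lra. }
have Hplus : forall u v, cont2 u -> cont2 v -> cont2 (fun x y => u x y + v x y).
{ move=> u v Hu Hv x y. exact: continuity_2d_pt_plus. }
have E1 : II (x0 - A') (x0 + A') (y0 - A') (y0 + A')
    (fun x y => fx x y + mixed x y) = 0.
{ apply: (II_dx _ _ _ _ (fun x y => Q x y * ((y - y0) * rho (s2 x y)))) => //;
    try lra.
  - exact: Hplus.
  - move=> y. rewrite Hedge ?Rmult_0_r //. left. rewrite Rabs_left; lra.
  - move=> y. rewrite Hedge ?Rmult_0_r //. left. rewrite Rabs_right; lra. }
have E2 : II (x0 - A') (x0 + A') (y0 - A') (y0 + A')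
    (fun x y => fy x y + mixed x y) = 0.
{ apply: (II_dy _ _ _ _ (fun x y => Q x y * ((x - x0) * rho (s2 x y)))) => //;
    try lra.
  - exact: Hplus.
  - move=> x. rewrite Hedge ?Rmult_0_r //. right. rewrite Rabs_left; lra.
  - move=> x. rewrite Hedge ?Rmult_0_r //. right. rewrite Rabs_right; lra. }
rewrite II_plus // in E1. rewrite II_plus // in E2.
rewrite (II_minus _ _ _ _ fx fy) //. lra.
Qed.

End Radial.

(** * Difference quotients of holomorphic functions *)

Lemma has_cderiv_quotient g w l k z : has_cderiv g w l -> w <> z ->
  exists l', has_cderiv (fun t => (g t - k) / (t - z))%C w l'.
Proof.
move=> Hg Hwz.
have HD0 : (w - z)%C <> 0%C.
{ move=> E. apply: Hwz. have -> : w = (w - z + z)%C by ring. rewrite E. ring. }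
have Hpos := proj1 (Cmod_gt_0 _) HD0.
set D0 := (w - z)%C in HD0 Hpos.
set m := (l - (g w - k) / D0)%C.
exists (m / D0)%C => e He.
have Hm := Cmod_ge_0 m.
set a := Cmod D0 in Hpos.
have Ha2 : 0 < a ^ 2 by apply: pow_lt.
have [d1 [Hd1 H1]] := Hg (e * a / 4) ltac:(nra).
have Hk : 0 < e * a ^ 2 / (4 * (Cmod m + 1)).
{ apply: Rdiv_lt_0_compat; nra. }
have [d2 [Hd2 [B3 B4]]] := pos_min (a / 2) _ ltac:(lra) Hk.
have [d [Hd [B1 B2]]] := pos_min d1 d2 Hd1 Hd2.
exists d. split=> // t Ht. rewrite /disc in Ht.
have HE := H1 t ltac:(rewrite /disc; lra).
set E := (g t - g w - l * (t - w))%C in HE.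
set h := (t - w)%C in Ht HE.
set D := (t - z)%C.
have ED : D = (D0 + h)%C by rewrite /D /D0 /h; ring.
have HDm : a / 2 <= Cmod D.
{ have := Cmod_triangle_minus D0 D.
  have -> : (D0 - D = - h)%C by rewrite ED; ring.
  rewrite Cmod_opp -/a. lra. }
have HD : D <> 0%C by move=> E0; rewrite E0 Cmod_0 in HDm; lra.
have -> : ((g t - k) / D - (g w - k) / D0 - m / D0 * h =
  E / D - m * h * h / (D * D0))%C.
{ have Eg : (g t = E + g w + l * h)%C by rewrite /E /h; ring.
  rewrite Eg /m. have Eh : h = (D - D0)%C by rewrite ED; ring.
  rewrite Eh. field. by split. }
have T := Cmod_triangle (E / D)%C (- (m * h * h / (D * D0)))%C.
rewrite Cmod_opp in T. apply: Rle_trans T _.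
rewrite !Cmod_div // ?Cmod_mult; last by apply: Cmult_neq_0.
rewrite -/a.
have Hh := Cmod_ge_0 h.
set x := Cmod h in Ht HE Hh *.
have HDp : 0 < Cmod D by lra.
have C1 : Cmod E / Cmod D <= e / 2 * x.
{ apply/Rle_div_l => //. apply: Rle_trans HE _.
  have : e / 2 * x * (a / 2) <= e / 2 * x * Cmod D.
  { apply: Rmult_le_compat_l => //. nra. }
  lra. }
have C2 : Cmod m * x * x / (Cmod D * a) <= e / 2 * x.
{ apply/Rle_div_l; first by nra.
  have H4 : x * (4 * (Cmod m + 1)) <= e * a ^ 2.
  { apply/Rle_div_r; [lra|]. lra. }
  have H5 : e / 2 * x * (a / 2 * a) <= e / 2 * x * (Cmod D * a).
  { apply: Rmult_le_compat_l; [nra|]. apply: Rmult_le_compat_r; lra. }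
  have H6 : Cmod m * x * x <= e / 2 * x * (a / 2 * a).
  { have H7 : Cmod m * x <= e * a ^ 2 / 4 by nra.
    have : Cmod m * x * x <= e * a ^ 2 / 4 * x by apply: Rmult_le_compat_r.
    nra. }
  lra. }
lra.
Qed.

Definition diff_quotient (g : C -> C) (z l t : C) : C :=
  match excluded_middle_informative (t = z) with
  | left _ => l
  | right _ => ((g t - g z) / (t - z))%C
  end.

Lemma diff_quotient_mul g z l t :
  (diff_quotient g z l t * (t - z) = g t - g z)%C.
Proof.
rewrite /diff_quotient. case: excluded_middle_informative => [->|H]; first ring.
field. move=> E. apply: H. have -> : t = (t - z + z)%C by ring. rewrite E. ring.
Qed.

Lemma diff_quotient_near g z l w : w <> z -> exists d, 0 < d /\
  forall t, disc w d t -> ((g t - g z) / (t - z))%C = diff_quotient g z l t.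
Proof.
move=> H. exists (Cmod (w - z)). split.
- apply: (proj1 (Cmod_gt_0 _)) => E. apply: H.
  have -> : w = (w - z + z)%C by ring. rewrite E. ring.
- move=> t Ht. rewrite /diff_quotient.
  case: excluded_middle_informative => // E. rewrite /disc E in Ht.
  rewrite Cmod_minus_sym in Ht. lra.
Qed.

Lemma has_cderiv_ext f g w l :
  (exists d, 0 < d /\ forall t, disc w d t -> f t = g t) ->
  has_cderiv f w l -> has_cderiv g w l.
Proof.
move=> [d [Hd H]] Hf e He. have [d' [Hd' Hf']] := Hf e He.
exists (Rmin d d'). split; first exact: Rmin_glb_lt.
move=> t Ht. rewrite -(H w); last exact: disc_center.
rewrite -(H t); last exact: Rlt_le_trans Ht (Rmin_l _ _).
apply: Hf'. exact: Rlt_le_trans Ht (Rmin_r _ _).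
Qed.

Lemma diff_quotient_cderiv g z l w l' : has_cderiv g w l' -> w <> z ->
  exists l'', has_cderiv (diff_quotient g z l) w l''.
Proof.
move=> Hg Hw. have [l'' H] := has_cderiv_quotient g w l' (g z) z Hg Hw.
exists l''. apply: (has_cderiv_ext _ _ _ _ _ H). exact: diff_quotient_near.
Qed.

Lemma diff_quotient_ccont g z l w l' : has_cderiv g z l -> has_cderiv g w l' ->
  ccont (diff_quotient g z l) w.
Proof.
move=> Hz Hw. case: (classic (w = z)) => [->|Hne]; last first.
{ have [l'' H] := diff_quotient_cderiv g z l w l' Hw Hne.
  exact: has_cderiv_ccont H. }
move=> e He. have [d [Hd H]] := Hz (e / 2) ltac:(lra).
exists d. split=> // t Ht. rewrite /disc.
have Ez : diff_quotient g z l z = l.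
{ rewrite /diff_quotient. by case: excluded_middle_informative. }
rewrite Ez. rewrite /diff_quotient.
case: excluded_middle_informative => [_|Hne].
{ by apply: disc_center. }
have Htz : (t - z)%C <> 0%C.
{ move=> E. apply: Hne. have -> : t = (t - z + z)%C by ring. rewrite E. ring. }
have -> : ((g t - g z) / (t - z) - l = (g t - g z - l * (t - z)) / (t - z))%C.
{ by field. }
rewrite Cmod_div //. have Hp := proj1 (Cmod_gt_0 _) Htz.
apply/Rlt_div_l => //. apply: Rle_lt_trans (H t Ht) _.
apply: Rmult_lt_compat_r => //. lra.
Qed.

Lemma II_ext_rect a b c d u v : a <= b -> c <= d ->
  (forall x y, a < x < b -> c < y < d -> u x y = v x y) ->
  II a b c d u = II a b c d v.
Proof.
move=> Hab Hcd H. apply: RInt_ext => x.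
rewrite Rmin_left // Rmax_right // => Hx.
apply: RInt_ext => y. rewrite Rmin_left // Rmax_right // => Hy. exact: H.
Qed.

Definition radial (rho : R -> R) (z0 z : C) : C :=
  RtoC (rho ((Re z - Re z0) ^ 2 + (Im z - Im z0) ^ 2)).

Definition square_CI (z0 : C) (A : R) (F : C -> C) : C :=
  CI (Re z0 - A) (Re z0 + A) (Im z0 - A) (Im z0 + A) F.

Definition in_box (z0 : C) (A : R) (z : C) : Prop :=
  Rabs (Re z - Re z0) <= A /\ Rabs (Im z - Im z0) <= A.

Lemma in_box_disc z0 A z : in_box z0 A z -> Cmod (z - z0)%C <= 2 * A.
Proof. move=> [H1 H2]. have [_ [_ H3]] := Cmod_sub_split z z0. lra. Qed.

Lemma disc_in_box z0 A z : Cmod (z - z0)%C <= A -> in_box z0 A z.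
Proof. move=> H. have [H1 [H2 _]] := Cmod_sub_split z z0. split; lra. Qed.

(** Retracts the line onto an interval. Composing with it extends a function
    continuous on a closed square to the plane. *)
Definition clamp (c A t : R) : R := Rmax (c - A) (Rmin (c + A) t).

Lemma clamp_id c A t : Rabs (t - c) <= A -> clamp c A t = t.
Proof.
move=> /Rabs_le_between H. rewrite /clamp Rmin_right ?Rmax_right; lra.
Qed.

Lemma clamp_lipschitz c A t u : Rabs (clamp c A t - clamp c A u) <= Rabs (t - u).
Proof.
rewrite /clamp /Rmin; repeat case: Rle_dec => ?;
  rewrite /Rmax; repeat case: Rle_dec => ?; rewrite /Rabs; repeat case: Rcase_abs => ?; lra.
Qed.

Lemma clamp_range c A t : 0 <= A -> Rabs (clamp c A t - c) <= A.
Proof.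
move=> HA. apply: Rabs_le. rewrite /clamp.
have H1 := Rmax_l (c - A) (Rmin (c + A) t).
have H2 : Rmax (c - A) (Rmin (c + A) t) <= c + A.
{ apply: Rmax_lub; [lra|exact: Rmin_l]. }
lra.
Qed.

Lemma cderiv_closed_at F l x y : has_cderiv F (x, y) l ->
  closed_at (re2 F) (fun x y => - im2 F x y) x y /\
  closed_at (fun x y => - im2 F x y) (fun x y => - re2 F x y) x y.
Proof.
case: l => a b HF.
have Hloc : forall e, 0 < e -> exists dl, 0 < dl /\
    forall u v, Rabs (u - x) < dl -> Rabs (v - y) < dl ->
    Rabs (re2 F u v - re2 F x y - a * (u - x) - - b * (v - y)) <=
      e * (Rabs (u - x) + Rabs (v - y)) /\
    Rabs (im2 F u v - im2 F x y - b * (u - x) - a * (v - y)) <=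
      e * (Rabs (u - x) + Rabs (v - y)).
{ move=> e He. have [d [Hd H]] := HF e He.
  exists (d / 2). split; first lra.
  move=> u v Hu Hv. have Hw : disc (x, y) d (u, v) by exact: disc_of_parts.
  have Hm : Cmod ((u, v) - (x, y))%C <= Rabs (u - x) + Rabs (v - y).
  { exact: (proj2 (proj2 (Cmod_split ((u, v) - (x, y))%C))). }
  have H2 := H _ Hw.
  have [H3 [H4 _]] := Cmod_split (F (u, v) - F (x, y) - (a, b) * ((u, v) - (x, y)))%C.
  have H5 : e * Cmod ((u, v) - (x, y))%C <= e * (Rabs (u - x) + Rabs (v - y)).
  { apply: Rmult_le_compat_l => //. lra. }
  have E1 : Re (F (u, v) - F (x, y) - (a, b) * ((u, v) - (x, y)))%C =
    re2 F u v - re2 F x y - a * (u - x) - - b * (v - y).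
  { rewrite /re2 /Re /=. ring. }
  have E2 : Im (F (u, v) - F (x, y) - (a, b) * ((u, v) - (x, y)))%C =
    im2 F u v - im2 F x y - b * (u - x) - a * (v - y).
  { rewrite /im2 /Im /=. ring. }
  rewrite E1 in H3. rewrite E2 in H4. split; lra. }
split.
- exists a, (- b), (- a) => e He. have [dl [Hdl H]] := Hloc e He.
  exists dl. split=> // u v Hu Hv. have [H1 H2] := H u v Hu Hv. split=> //.
  rewrite -Rabs_Ropp. apply: Rle_trans H2. right. congr Rabs. ring.
- exists (- b), (- a), b => e He. have [dl [Hdl H]] := Hloc e He.
  exists dl. split=> // u v Hu Hv. have [H1 H2] := H u v Hu Hv.
  split; rewrite -Rabs_Ropp.
  + apply: Rle_trans H2. right. congr Rabs. ring.
  + apply: Rle_trans H1. right. congr Rabs. ring.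
Qed.

Section Weight.

Variables (z0 : C) (A A' : R).
Variables rho rho' : R -> R.
Hypothesis (HA : 0 < A) (HAA : A < A').
Hypothesis rho_deriv : forall s, is_derive rho s (rho' s).
Hypothesis rho'_cont : forall s, continuous rho' s.
Hypothesis rho_supp : forall s, A ^ 2 <= s -> rho s = 0.

Lemma radial_ccont z : ccont (radial rho z0) z.
Proof.
case: z => x y.
apply: (ccont_real (fun x y => rho ((x - Re z0) ^ 2 + (y - Im z0) ^ 2))).
apply: (continuity_1d_2d_pt_comp rho); last exact: sq_dist_cont.
apply/continuity_pt_filterlim. apply: ex_derive_continuous.
eexists; exact: rho_deriv.
Qed.

Lemma radial_zero z : A <= Cmod (z - z0)%C -> radial rho z0 z = 0%C.
Proof.
move=> H. rewrite /radial rho_supp // -Cmod_sub_sqr. apply: pow_incr. lra.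
Qed.

Lemma in_box_or_far z : in_box z0 A' z \/
  (exists d, 0 < d /\ forall w, disc z d w -> radial rho z0 w = 0%C).
Proof.
case: (Rlt_dec A (Cmod (z - z0)%C)) => H.
- right. exists (Cmod (z - z0)%C - A). split; first lra.
  move=> w Hw. apply: radial_zero. rewrite /disc in Hw.
  have := Cmod_dist z w z0. rewrite (Cmod_minus_sym z w). lra.
- left. have [H1 [H2 _]] := Cmod_sub_split z z0. rewrite /in_box. lra.
Qed.

Lemma square_CI_ext F G : (forall z, in_box z0 A' z -> F z = G z) ->
  square_CI z0 A' F = square_CI z0 A' G.
Proof.
move=> H. rewrite /square_CI /CI; congr (_, _);
  apply: II_ext_rect; try lra; move=> x y Hx Hy; rewrite /re2 /im2 H //;
  split; apply: Rabs_le; rewrite /Re /Im /= in Hx Hy *; lra.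
Qed.

(** If [Q' = q] then [(z - z0) q(z)] is the angular derivative of [Q] up to the
    factor [i], so that [angular_derivative_integral] applies to the real and
    imaginary parts of [Q]. The point [ze] is meant for the singularity of a
    difference quotient. *)
Lemma weighted_integral_zero (q : C -> C) (ze : C) :
  (forall z, in_box z0 A' z -> ccont q z) ->
  (forall z, in_box z0 A' z -> z <> ze -> exists l, has_cderiv q z l) ->
  square_CI z0 A' (fun z => q z * (z - z0) * radial rho z0 z)%C = 0%C.
Proof.
move=> Hc Hd.
pose cz z : C := (clamp (Re z0) A' (Re z), clamp (Im z0) A' (Im z)).
pose q' z := q (cz z).
have HA' : 0 <= A' by lra.
have Hcz : forall z, in_box z0 A' z -> cz z = z.
{ move=> [x y] [H1 H2]. by rewrite /cz !clamp_id. }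
have Hq' : forall z, ccont q' z.
{ move=> z e He.
  have [d [Hd' H]] := Hc (cz z) (conj (clamp_range _ _ _ HA')
     (clamp_range _ _ _ HA')) e He.
  exists (d / 2). split; first lra.
  case: z H => x y H [u v] /parts_of_disc [Hu Hv].
  apply: H. apply: disc_of_parts.
  - exact: Rle_lt_trans (clamp_lipschitz _ _ _ _) Hu.
  - exact: Rle_lt_trans (clamp_lipschitz _ _ _ _) Hv. }
have Hq'd : forall x y, Re z0 - A' < x < Re z0 + A' ->
    Im z0 - A' < y < Im z0 + A' -> y <> Im ze -> exists l, has_cderiv q' (x, y) l.
{ move=> x y Hx Hy Hne.
  have Hbox : in_box z0 A' (x, y).
  { split; apply: Rabs_le; rewrite /Re /Im /= in Hx Hy *; lra. }
  have [l Hl] := Hd (x, y) Hbox ltac:(by move=> E; apply: Hne; rewrite -E).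
  exists l. apply: (has_cderiv_ext _ _ _ _ _ Hl).
  have [e1 [He1 H1]] := open_interval_margin _ _ _ Hx.
  have [e2 [He2 H2]] := open_interval_margin _ _ _ Hy.
  have [e [He [E1 E2]]] := pos_min e1 e2 He1 He2.
  exists e. split=> // -[u v] /parts_of_disc [Hu Hv]. rewrite /q' Hcz //.
  have B1 := H1 u ltac:(lra). have B2 := H2 v ltac:(lra).
  split; apply: Rabs_le; rewrite /Re /Im /= in B1 B2 *; lra. }
have Hre : cont2 (re2 q') by exact: ccont_re2.
have Him : cont2 (im2 q') by exact: ccont_im2.
have Hnim : cont2 (fun x y => - im2 q' x y).
{ move=> x y. exact: continuity_2d_pt_opp. }
have Hnre : cont2 (fun x y => - re2 q' x y).
{ move=> x y. exact: continuity_2d_pt_opp. }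
have [Q1 HQ1] := closed_form_exact _ _ Hre Hnim (Re z0 - A') (Re z0 + A')
  (Im z0 - A') (Im z0 + A') (Im ze) ltac:(lra) ltac:(lra)
  (fun x y Hx Hy Hne => match Hq'd x y Hx Hy Hne with
     | ex_intro l Hl => proj1 (cderiv_closed_at _ _ _ _ Hl) end).
have [Q2 HQ2] := closed_form_exact _ _ Hnim Hnre (Re z0 - A') (Re z0 + A')
  (Im z0 - A') (Im z0 + A') (Im ze) ltac:(lra) ltac:(lra)
  (fun x y Hx Hy Hne => match Hq'd x y Hx Hy Hne with
     | ex_intro l Hl => proj2 (cderiv_closed_at _ _ _ _ Hl) end).
have E1 := angular_derivative_integral _ _ A A' rho rho' HA HAA rho_deriv
  rho'_cont rho_supp _ _ Q1 Hre Hnim HQ1.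
have E2 := angular_derivative_integral _ _ A A' rho rho' HA HAA rho_deriv
  rho'_cont rho_supp _ _ Q2 Hnim Hnre HQ2.
rewrite (square_CI_ext _ (fun z => q' z * (z - z0) * radial rho z0 z)%C);
  last first.
{ move=> z Hz. by rewrite /q' Hcz. }
rewrite /square_CI /CI. congr (_, _).
- rewrite -[RHS]E2. apply: II_ext => x y.
  rewrite /re2 /im2 /radial /Re /Im /=. ring.
- rewrite -[RHS]E1. apply: II_ext => x y.
  rewrite /re2 /im2 /radial /Re /Im /=. ring.
Qed.

End Weight.

(** * Flat functions *)

(** [exp (-1/t) / t^k] for positive [t]: these functions vanish to infinite
    order at [0], and the division by [t^k] makes the family stable under
    differentiation. *)
Definition flat (k : nat) (t : R) : R :=
  match Rlt_dec 0 t with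
  | left _ => exp (- / t) / t ^ k
  | right _ => 0
  end.

Lemma flat_pos k t : 0 < t -> flat k t = exp (- / t) / t ^ k.
Proof. rewrite /flat. by case: Rlt_dec. Qed.

Lemma flat_neg k t : t <= 0 -> flat k t = 0.
Proof. rewrite /flat. case: Rlt_dec => //. lra. Qed.

Lemma flat_ge0 k t : 0 <= flat k t.
Proof.
rewrite /flat. case: Rlt_dec => [H|_]; last lra.
apply: Rlt_le. apply: Rdiv_lt_0_compat; [exact: exp_pos|exact: pow_lt].
Qed.

Lemma flat0_gt0 t : 0 < t -> 0 < flat 0 t.
Proof.
move=> H. rewrite flat_pos //. apply: Rdiv_lt_0_compat; [exact: exp_pos|].
rewrite /=. lra.
Qed.

Lemma flat0_le1 t : flat 0 t <= 1.
Proof.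
rewrite /flat. case: Rlt_dec => [H|_]; last lra.
rewrite /= Rdiv_1_r -exp_0. apply: Rlt_le. apply: exp_increasing.
have := Rinv_0_lt_compat _ H. lra.
Qed.

Lemma flat_incr t u : 0 < t -> t <= u -> flat 0 t <= flat 0 u.
Proof.
move=> Ht Hu. rewrite !flat_pos /=; try lra. rewrite !Rdiv_1_r.
case: Hu => [Hu|->]; last lra. apply: Rlt_le. apply: exp_increasing.
apply: Ropp_lt_contravar. apply: Rinv_lt_contravar => //. nra.
Qed.

Lemma exp_pow_INR x n : exp x ^ n = exp (INR n * x).
Proof.
elim: n => [|n IH]; first by rewrite /= Rmult_0_l exp_0.
rewrite S_INR /= IH -exp_plus. congr exp. ring.
Qed.

Lemma flat_quadratic k t : 0 < t -> flat k t <= INR (S (S k)) ^ S (S k) * t ^ 2.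
Proof.
move=> Ht. rewrite flat_pos //.
have Hn : 0 < INR (S (S k)) by apply: lt_0_INR; lia.
set n := S (S k) in Hn *. have Hnt : 0 < INR n * t by apply: Rmult_lt_0_compat.
have H1 : / (INR n * t) <= exp (/ (INR n * t)).
{ have := exp_ineq1_le (/ (INR n * t)). lra. }
have Hinv := Rinv_0_lt_compat _ Hnt.
have H2 : (/ (INR n * t)) ^ n <= exp (/ t).
{ have -> : exp (/ t) = exp (/ (INR n * t)) ^ n.
  { rewrite exp_pow_INR. congr exp. field. split; lra. }
  apply: pow_incr. lra. }
have Hp : 0 < (INR n * t) ^ n by apply: pow_lt.
have H3 : exp (- / t) <= (INR n * t) ^ n.
{ rewrite exp_Ropp -(Rinv_inv ((INR n * t) ^ n)).
  apply: Rinv_le_contravar; first by apply: Rinv_0_lt_compat.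
  by rewrite -pow_inv. }
have Htk : 0 < t ^ k by apply: pow_lt.
apply/Rle_div_l => //. apply: Rle_trans H3 _. right.
rewrite Rpow_mult_distr /n /=. ring.
Qed.

Lemma flat_derive k t :
  is_derive (flat k) t (- INR k * flat (S k) t + flat (S (S k)) t).
Proof.
case: (Rtotal_order t 0) => [H|[->|H]].
- rewrite !flat_neg; try lra.
  apply: (is_derive_ext_loc (fun _ => 0)).
  + exists (mkposreal (- t) ltac:(lra)) => u Hu.
    rewrite /ball /= /AbsRing_ball /abs /minus /plus /opp /= in Hu.
    have := Rabs_def2 _ _ Hu. move=> B. rewrite flat_neg //; lra.
  + have -> : - INR k * 0 + 0 = 0 by ring.
    exact: (is_derive_const (V := R_NormedModule)).
- rewrite !flat_neg; try lra. have -> : - INR k * 0 + 0 = 0 by ring.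
  apply/is_derive_Reals => e He.
  set M := INR (S (S k)) ^ S (S k).
  have HM : 0 < M by apply: pow_lt; apply: lt_0_INR; lia.
  have Hd : 0 < e / M by apply: Rdiv_lt_0_compat.
  exists (mkposreal _ Hd) => h Hh0 /= Hh.
  rewrite Rplus_0_l (flat_neg k 0); last lra.
  case: (Rlt_dec 0 h) => Hh'.
  + rewrite Rabs_right in Hh; last lra.
    have H1 := flat_quadratic k h Hh'. have H2 := flat_ge0 k h. rewrite -/M in H1.
    have H3 : (flat k h - 0) / h - 0 = flat k h / h by field; lra.
    rewrite H3 Rabs_right; last first.
    { apply: Rle_ge. apply: Rmult_le_pos => //.
      apply: Rlt_le. exact: Rinv_0_lt_compat. }
    apply/Rlt_div_l => //. have : h * M < e by apply/Rlt_div_r.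
    nra.
  + rewrite flat_neg; last lra.
    have -> : (0 - 0) / h - 0 = 0 by field. by rewrite Rabs_R0.
- rewrite !flat_pos //.
  apply: (is_derive_ext_loc (fun t => exp (- / t) / t ^ k)).
  + exists (mkposreal t H) => u Hu.
    rewrite /ball /= /AbsRing_ball /abs /minus /plus /opp /= in Hu.
    have := Rabs_def2 _ _ Hu. move=> B. rewrite flat_pos //; lra.
  + have Htk : t ^ k <> 0 by apply: pow_nonzero; lra.
    auto_derive; first by split; [lra|].
    case: k Htk => [|k] Htk; rewrite /= ?S_INR /=; field; try lra.
    have Hk : t ^ k <> 0 by apply: pow_nonzero; lra.
    by split=> //; lra.
Qed.

Lemma flat_continuous k t : continuous (flat k) t.
Proof.
apply: ex_derive_continuous. eexists. exact: flat_derive.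
Qed.

(** * Cauchy's formula *)

(** The weight as a function of the square of the distance [s]: it is smooth and
    supported in [a^2 <= s <= 9 a^2]. Being a function of [s / a^2], it scales
    with [a], and being smooth it is also a test function. *)
Definition annular (a s : R) : R := flat 0 (s / a ^ 2 - 1) * flat 0 (9 - s / a ^ 2).

Definition annular' (a s : R) : R :=
  (flat 2 (s / a ^ 2 - 1) * flat 0 (9 - s / a ^ 2) -
   flat 0 (s / a ^ 2 - 1) * flat 2 (9 - s / a ^ 2)) / a ^ 2.

Lemma annular_deriv a s : a <> 0 -> is_derive (annular a) s (annular' a s).
Proof.
move=> Ha. have H k t : is_derive (fun x => flat k x) t
    (- INR k * flat (S k) t + flat (S (S k)) t) by exact: flat_derive.
rewrite /annular /annular'. auto_derive.
- split; [|split=> //]; eexists; exact: H.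
- rewrite !(is_derive_unique _ _ _ (H _ _)) /Rminus /Rdiv /=. ring.
Qed.

Lemma annular'_cont a s : continuous (annular' a) s.
Proof.
have H k t : ex_derive (fun x => flat k x) t by eexists; exact: flat_derive.
apply: ex_derive_continuous. rewrite /annular'. auto_derive. by repeat split.
Qed.

Lemma annular_ge0 a s : 0 <= annular a s.
Proof. apply: Rmult_le_pos; exact: flat_ge0. Qed.

Lemma annular_le1 a s : annular a s <= 1.
Proof.
have := flat0_le1 (s / a ^ 2 - 1). have := flat0_le1 (9 - s / a ^ 2).
have := flat_ge0 0 (s / a ^ 2 - 1). have := flat_ge0 0 (9 - s / a ^ 2).
rewrite /annular. nra.
Qed.

Section Formulas.

Variables (z0 : C) (a : R).
Hypothesis Ha : 0 < a.

Let Ha2 : 0 < a ^ 2.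
Proof. exact: pow_lt. Qed.

Lemma annular_supp s : (3 * a) ^ 2 <= s -> annular a s = 0.
Proof.
move=> H. have : 9 <= s / a ^ 2 by apply/Rle_div_r; lra.
move=> H9. rewrite /annular (flat_neg 0 (9 - _)); [ring|lra].
Qed.

Lemma annular_hole s : s <= a ^ 2 -> annular a s = 0.
Proof.
move=> H. have : s / a ^ 2 <= 1 by apply/Rle_div_l; lra.
move=> H9. rewrite /annular flat_neg; [ring|lra].
Qed.

Let H3a : 0 < 3 * a.
Proof. lra. Qed.
Let H34 : 3 * a < 4 * a.
Proof. lra. Qed.
Let deriv s : is_derive (annular a) s (annular' a s).
Proof. apply: annular_deriv. lra. Qed.

Definition weight : C -> C := radial (annular a) z0.

(** Integration over the annulus between the radii [a] and [3 a], which plays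
    the part of a contour around [z0]. *)
Definition weighted (F : C -> C) : C :=
  square_CI z0 (4 * a) (fun t => F t * weight t)%C.

Lemma weight_hole t : Cmod (t - z0)%C <= a -> weight t = 0%C.
Proof.
move=> H. rewrite /weight /radial annular_hole // -Cmod_sub_sqr. apply: pow_incr.
split=> //. exact: Cmod_ge_0.
Qed.

Lemma weight_supp t : 3 * a <= Cmod (t - z0)%C -> weight t = 0%C.
Proof.
exact: (radial_zero z0 (3 * a) (annular a) H3a annular_supp).
Qed.

Lemma weight_le1 t : Cmod (weight t) <= 1.
Proof.
rewrite /weight /radial Cmod_R Rabs_right; last by apply: Rle_ge; exact: annular_ge0.
exact: annular_le1.
Qed.

Lemma weight_ccont t : ccont weight t.
Proof. exact: (radial_ccont z0 (annular a) (annular' a) deriv). Qed.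

(** Continuity on a neighbourhood of the annulus. The inner radius [a / 2] leaves
    room for the pole of Cauchy's kernel. *)
Definition regular (F : C -> C) : Prop :=
  forall t, in_box z0 (4 * a) t -> a / 2 < Cmod (t - z0)%C -> ccont F t.

Lemma weighted_ccont F t : regular F -> ccont (fun t => F t * weight t)%C t.
Proof.
move=> HF. apply: ccont_cutoff; first exact: weight_ccont.
case: (Rlt_dec (a / 2) (Cmod (t - z0)%C)) => Ht.
- case: (in_box_or_far z0 (3 * a) (4 * a) (annular a) H3a H34 annular_supp t) => H;
    [left|by right].
  exact: HF.
- right. exists (a / 2). split; first lra.
  move=> w Hw. rewrite /disc in Hw. apply: weight_hole.
  have := Cmod_dist w t z0. lra.
Qed.

Lemma weighted_ext (F G : C -> C) : (forall t, a < Cmod (t - z0)%C -> F t = G t) ->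
  weighted F = weighted G.
Proof.
move=> H. apply: CI_ext => t.
case: (Rlt_dec a (Cmod (t - z0)%C)) => Ht; first by rewrite H.
rewrite weight_hole; [ring|lra].
Qed.

Lemma weighted_lin (k l : C) F G : regular F -> regular G ->
  weighted (fun t => k * F t + l * G t)%C = (k * weighted F + l * weighted G)%C.
Proof.
move=> HF HG. have CF := fun t => weighted_ccont F t HF.
have CG := fun t => weighted_ccont G t HG.
rewrite /weighted /square_CI -!CI_scal // -CI_plus.
- apply: CI_ext => t. ring.
- move=> t. apply: ccont_mult => //. exact: ccont_const.
- move=> t. apply: ccont_mult => //. exact: ccont_const.
Qed.

Lemma weighted_minus F G : regular F -> regular G ->
  weighted (fun t => F t - G t)%C = (weighted F - weighted G)%C.
Proof.
move=> HF HG. have -> : (weighted F - weighted G = 1 * weighted F + - (1) * weighted G)%C.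
{ ring. }
rewrite -weighted_lin //. apply: weighted_ext => t _. ring.
Qed.

Lemma weighted_le (F : C -> C) M : 0 <= M -> regular F ->
  (forall t, in_box z0 (4 * a) t -> a < Cmod (t - z0)%C -> Cmod (F t) <= M) ->
  Cmod (weighted F) <= 8 * (4 * a) ^ 2 * M.
Proof.
move=> HM HF Hle.
have -> : 8 * (4 * a) ^ 2 * M = 2 * ((Re z0 + 4 * a - (Re z0 - 4 * a)) *
    ((Im z0 + 4 * a - (Im z0 - 4 * a)) * M)) by ring.
apply: CI_le; try lra.
- move=> t. exact: weighted_ccont.
- move=> x y Hx Hy. rewrite Cmod_mult.
  case: (Rlt_dec a (Cmod ((x, y) - z0)%C)) => Ht.
  + have H1 := weight_le1 (x, y).
    have H2 : Cmod (F (x, y)) <= M.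
    { apply: Hle => //. split; apply: Rabs_le; rewrite /Re /Im /= in Hx Hy *; lra. }
    have := Cmod_ge_0 (F (x, y)). have := Cmod_ge_0 (weight (x, y)). nra.
  + rewrite weight_hole; last lra. rewrite Cmod_0. lra.
Qed.

Definition mass : C := weighted (fun _ => 1%C).

(** The weight is at least [flat 0 1 * flat 0 1] on a rectangle with sides
    [a / 2] and [a] inside the annulus. *)
Lemma mass_ge : flat 0 1 * flat 0 1 / 2 * a ^ 2 <= Cmod mass.
Proof.
have Hlow := II_lower (Re z0 + 3 / 2 * a) (Re z0 + 2 * a) (Im z0) (Im z0 + a)
  (Re z0 - 4 * a) (Re z0 + 4 * a) (Im z0 - 4 * a) (Im z0 + 4 * a)
  (re2 weight) (flat 0 1 * flat 0 1)
  ltac:(lra) ltac:(lra) ltac:(lra) ltac:(lra) ltac:(lra) ltac:(lra)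
  (ccont_re2 _ weight_ccont) (fun x y => annular_ge0 _ _).
have E : mass = square_CI z0 (4 * a) weight by apply: CI_ext => t; ring.
have [Hc _] := Cmod_split mass. apply: Rle_trans Hc. apply: Rle_trans (Rle_abs _).
rewrite E. apply: (Rle_trans _ ((Re z0 + 2 * a - (Re z0 + 3 / 2 * a)) *
    ((Im z0 + a - Im z0) * (flat 0 1 * flat 0 1)))); first by right; field.
apply: Hlow => x y Hx Hy.
rewrite -[re2 _ _ _]/(annular a ((x - Re z0) ^ 2 + (y - Im z0) ^ 2)) /annular.
have X1 : (3 / 2 * a) ^ 2 <= (x - Re z0) ^ 2 by apply: pow_incr; lra.
have X2 : (x - Re z0) ^ 2 <= (2 * a) ^ 2 by apply: pow_incr; lra.
have Y1 := pow2_ge_0 (y - Im z0).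
have Y2 : (y - Im z0) ^ 2 <= a ^ 2 by apply: pow_incr; lra.
set s := (x - Re z0) ^ 2 + (y - Im z0) ^ 2.
have S1 : 2 <= s / a ^ 2 by apply/Rle_div_r => //; rewrite /s; lra.
have S2 : s / a ^ 2 <= 8 by apply/Rle_div_l => //; rewrite /s; lra.
apply: Rmult_le_compat; try exact: flat_ge0; apply: flat_incr; lra.
Qed.

Lemma mass_neq0 : mass <> 0%C.
Proof.
move=> E. have := mass_ge. rewrite E Cmod_0.
have H1 : 0 < flat 0 1 by apply: flat0_gt0; lra.
have : 0 < flat 0 1 * flat 0 1 / 2 * a ^ 2.
{ apply: Rmult_lt_0_compat => //. nra. }
lra.
Qed.

(** Cauchy's kernel divided by [(t - z0)^n]. *)
Definition kernel (n : nat) (z t : C) : C :=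
  ((t - z0) / (t - z) * / (t - z0) ^ n)%C.

(** At [z = z0] these are the Taylor coefficients of [g], at other points the
    remainders of its Taylor expansion, up to normalisation. *)
Definition transform (g : C -> C) (n : nat) (z : C) : C :=
  weighted (fun t => g t * kernel n z t)%C.

Lemma outside_hole z t : Cmod (z - z0)%C <= a / 2 -> a < Cmod (t - z0)%C ->
  Cmod (t - z0)%C / 2 <= Cmod (t - z)%C /\ (t - z0)%C <> 0%C /\ (t - z)%C <> 0%C.
Proof.
move=> Hz Ht.
have H := Cmod_dist t z z0.
split; first lra. split=> E.
- rewrite E Cmod_0 in Ht. lra.
- rewrite E Cmod_0 in H. lra.
Qed.

Lemma kernel_ccont n z t : Cmod (z - z0)%C < a / 2 -> a / 2 < Cmod (t - z0)%C ->
  ccont (kernel n z) t.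
Proof.
move=> Hz Ht. have H := Cmod_dist t z z0.
have Ht0 : (t - z0)%C <> 0%C by move=> E; rewrite E Cmod_0 in Ht; lra.
have Htz : (t - z)%C <> 0%C by move=> E; rewrite E Cmod_0 in H; lra.
have Hid : forall k, ccont (fun t => t - k)%C t.
{ move=> k. apply: ccont_minus; [exact: ccont_id|exact: ccont_const]. }
apply: ccont_mult.
- apply: ccont_mult => //. exact: (ccont_inv (fun t => t - z)%C).
- apply: (ccont_inv (fun t => (t - z0) ^ n)%C).
  + exact: (ccont_pow (fun t => t - z0)%C).
  + exact: Cpow_nz.
Qed.

Section Transform.

Variable g : C -> C.
Hypothesis Hg : forall z, in_box z0 (4 * a) z -> ccont g z.

Let gk_regular n z : Cmod (z - z0)%C < a / 2 -> regular (fun t => g t * kernel n z t)%C.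
Proof.
move=> Hz t Hb Ht. apply: ccont_mult; [exact: Hg|exact: kernel_ccont].
Qed.

Let center : Cmod (z0 - z0)%C < a / 2.
Proof. have -> : (z0 - z0 = 0)%C by ring. rewrite Cmod_0. lra. Qed.

Lemma transform_step n z : Cmod (z - z0)%C < a / 2 ->
  transform g n z = (transform g n z0 + (z - z0) * transform g (S n) z)%C.
Proof.
move=> Hz. rewrite -(Cmult_1_l (transform g n z0)) -weighted_lin;
  [|exact: gk_regular|exact: gk_regular].
apply: weighted_ext => t Ht. have [_ [H1 H2]] := outside_hole z t ltac:(lra) Ht.
rewrite /kernel Cpow_S. have := Cpow_nz _ n H1 => H3. field. by split.
Qed.

(** Taylor's formula for a function whose first [n] coefficients vanish. *)
Lemma transform_expand n z : Cmod (z - z0)%C < a / 2 ->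
  (forall k, (k < n)%nat -> transform g k z0 = 0%C) ->
  transform g 0 z = ((z - z0) ^ n * transform g n z)%C.
Proof.
move=> Hz. elim: n => [|n IH] H; first by rewrite /=; ring.
rewrite IH; last by move=> k Hk; apply: H; lia.
rewrite (transform_step n z) // (H n); last lia.
rewrite Cpow_S. ring.
Qed.

Variable S0 : R.
Hypothesis HS : forall z, in_box z0 (4 * a) z -> Cmod (g z) <= S0.

Let S0_ge0 : 0 <= S0.
Proof.
apply: Rle_trans (Cmod_ge_0 (g z0)) _. apply: HS.
split; rewrite Rminus_diag Rabs_R0; lra.
Qed.

Lemma transform_bound n z : Cmod (z - z0)%C < a / 2 ->
  Cmod (transform g n z) <= 8 * (4 * a) ^ 2 * (S0 * (2 / a ^ n)).
Proof.
move=> Hz. have Han : 0 < a ^ n by apply: pow_lt.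
apply: weighted_le.
- apply: Rmult_le_pos => //. apply: Rlt_le. apply: Rdiv_lt_0_compat; lra.
- exact: gk_regular.
- move=> t Hb Ht. have [H1 [H2 H3]] := outside_hole z t ltac:(lra) Ht.
  rewrite Cmod_mult.
  apply: Rmult_le_compat; try exact: Cmod_ge_0; first exact: HS.
  rewrite /kernel Cmod_mult Cmod_div // Cmod_inv; last exact: Cpow_nz.
  rewrite Cmod_pow.
  have Hp := proj1 (Cmod_gt_0 _) H3.
  have Hp2 : 0 < / a ^ n by apply: Rinv_0_lt_compat.
  apply: Rmult_le_compat.
  + apply: Rlt_le. apply: Rdiv_lt_0_compat => //. exact: (proj1 (Cmod_gt_0 _)).
  + apply: Rlt_le. apply: Rinv_0_lt_compat. apply: pow_lt. lra.
  + apply/Rle_div_l => //. lra.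
  + apply: Rinv_le_contravar => //. apply: pow_incr. lra.
Qed.

Lemma transform_lipschitz n : exists L, 0 <= L /\ forall z w,
  Cmod (z - z0)%C < a / 2 -> Cmod (w - z0)%C < a / 2 ->
  Cmod (transform g n z - transform g n w)%C <= L * Cmod (z - w)%C.
Proof.
have Han : 0 < a ^ n by apply: pow_lt.
have HK : 0 <= 4 / a * / a ^ n.
{ apply: Rlt_le. apply: Rmult_lt_0_compat; last exact: Rinv_0_lt_compat.
  apply: Rdiv_lt_0_compat; lra. }
exists (8 * (4 * a) ^ 2 * (S0 * (4 / a * / a ^ n))). split.
{ apply: Rmult_le_pos; first by have := pow2_ge_0 (4 * a); lra.
  exact: Rmult_le_pos. }
move=> z w Hz Hw.
have -> : 8 * (4 * a) ^ 2 * (S0 * (4 / a * / a ^ n)) * Cmod (z - w)%C =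
  8 * (4 * a) ^ 2 * (S0 * (4 / a * / a ^ n * Cmod (z - w)%C)) by ring.
have -> : (transform g n z - transform g n w)%C =
  weighted (fun t => g t * (kernel n z t - kernel n w t))%C.
{ rewrite -weighted_minus; [|exact: gk_regular|exact: gk_regular].
  apply: weighted_ext => t _. ring. }
have Hzw := Cmod_ge_0 (z - w)%C.
apply: weighted_le.
- apply: Rmult_le_pos => //. exact: Rmult_le_pos.
- move=> t Hb Ht. apply: ccont_mult; first exact: Hg.
  apply: ccont_minus; exact: kernel_ccont.
- move=> t Hb Ht. have [H1 [H2 H3]] := outside_hole z t ltac:(lra) Ht.
  have [H4 [_ H5]] := outside_hole w t ltac:(lra) Ht.
  rewrite Cmod_mult.
  apply: Rmult_le_compat; try exact: Cmod_ge_0; first exact: HS.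
  have Hn := Cpow_nz _ n H2.
  have -> : (kernel n z t - kernel n w t =
    (t - z0) / (t - z) * / (t - w) * / (t - z0) ^ n * (z - w))%C.
  { rewrite /kernel. field. by []. }
  rewrite !Cmod_mult Cmod_inv // !Cmod_inv // Cmod_pow.
  apply: Rmult_le_compat_r => //.
  have P1 := proj1 (Cmod_gt_0 _) H3. have P2 := proj1 (Cmod_gt_0 _) H5.
  have P3 := proj1 (Cmod_gt_0 _) H2.
  have Q1 := Rinv_0_lt_compat _ P1. have Q2 := Rinv_0_lt_compat _ P2.
  have Q3 : 0 < / Cmod (t - z0)%C ^ n.
  { apply: Rinv_0_lt_compat. by apply: pow_lt. }
  apply: Rmult_le_compat.
  + apply: Rmult_le_pos; last lra. apply: Rmult_le_pos; lra.
  + lra.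
  + have E : 4 / a = 2 * (2 / a) by field; lra.
    rewrite E. apply: Rmult_le_compat; [|lra| |].
    * apply: Rmult_le_pos; lra.
    * apply/Rle_div_l => //. lra.
    * have -> : 2 / a = / (a / 2) by field; lra.
      apply: Rinv_le_contravar; lra.
  + apply: Rinv_le_contravar => //. apply: pow_incr. lra.
Qed.

End Transform.

(** The difference quotient at [z] has zero weighted integral by
    [weighted_integral_zero], which is Cauchy's formula with the constant [2 i pi]
    replaced by [transform 1 0 z]. This factor is Lipschitz and nonzero at
    the centre, so one can divide by it there. *)
Lemma transform_formula (g : C -> C) z :
  (forall z, in_box z0 (4 * a) z -> exists l, has_cderiv g z l) ->
  Cmod (z - z0)%C < a / 2 ->
  transform g 0 z = (g z * transform (fun _ => 1%C) 0 z)%C.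
Proof.
move=> Hg Hz. have [l Hl] := Hg z (disc_in_box z0 (4 * a) z ltac:(lra)).
have Hgc : forall w, in_box z0 (4 * a) w -> ccont g w.
{ move=> w /Hg [l']. exact: has_cderiv_ccont. }
have E0 : weighted (fun t => diff_quotient g z l t * (t - z0))%C = 0%C.
{ apply: (weighted_integral_zero z0 (3 * a) (4 * a) (annular a) (annular' a) H3a H34
    deriv (annular'_cont a) annular_supp (diff_quotient g z l) z).
  - move=> t /Hg [l' Hl']. exact: (diff_quotient_ccont g z l t l').
  - move=> t /Hg [l' Hl'] Hne. exact: (diff_quotient_cderiv g z l t l'). }
apply: Csub_eq0. rewrite -[RHS]E0 /transform.
have -> : (weighted (fun t => g t * kernel 0 z t) -
    g z * weighted (fun t => 1 * kernel 0 z t) =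
  1 * weighted (fun t => g t * kernel 0 z t) +
    - g z * weighted (fun t => 1 * kernel 0 z t))%C by ring.
rewrite -weighted_lin.
- apply: weighted_ext => t Ht. have [_ [H1 H2]] := outside_hole z t ltac:(lra) Ht.
  have M := diff_quotient_mul g z l t.
  have -> : (diff_quotient g z l t * (t - z0) =
    diff_quotient g z l t * (t - z) * (t - z0) / (t - z))%C by field.
  rewrite M /kernel /=. field. done.
- move=> t Hb Ht. apply: ccont_mult; [exact: Hgc|exact: kernel_ccont].
- move=> t Hb Ht. apply: ccont_mult; [exact: ccont_const|exact: kernel_ccont].
Qed.

Lemma transform_center g : transform g 0 z0 = weighted g.
Proof.
apply: weighted_ext => t Ht.
have Ht0 : (t - z0)%C <> 0%C by move=> E; rewrite E Cmod_0 in Ht; lra.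
rewrite /kernel /=. field. done.
Qed.

Lemma mean_value (g : C -> C) :
  (forall z, in_box z0 (4 * a) z -> exists l, has_cderiv g z l) ->
  weighted g = (g z0 * mass)%C.
Proof.
move=> Hg. rewrite /mass -!transform_center. apply: transform_formula => //.
have -> : (z0 - z0 = 0)%C by ring. rewrite Cmod_0. lra.
Qed.

End Formulas.

(** * Local structure of holomorphic functions *)

Lemma quotient_lipschitz (N c : C -> C) (D : C -> Prop) B L Lc k :
  0 < k -> 0 <= L -> 0 <= Lc -> 0 <= B ->
  (forall z, D z -> k <= Cmod (c z)) -> (forall z, D z -> Cmod (N z) <= B) ->
  (forall z w, D z -> D w -> Cmod (N z - N w)%C <= L * Cmod (z - w)%C) ->
  (forall z w, D z -> D w -> Cmod (c z - c w)%C <= Lc * Cmod (z - w)%C) ->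
  forall z w, D z -> D w ->
  Cmod (N z / c z - N w / c w)%C <= (L / k + B * Lc / k / k) * Cmod (z - w)%C.
Proof.
move=> Hk HL HLc HB Hc HN HNl Hcl z w Hz Hw.
have Cz := Hc z Hz. have Cw := Hc w Hw.
have Hcz : c z <> 0%C by move=> E; rewrite E Cmod_0 in Cz; lra.
have Hcw : c w <> 0%C by move=> E; rewrite E Cmod_0 in Cw; lra.
have -> : (N z / c z - N w / c w =
  (N z - N w) * / c z + N w * (c w - c z) * / c z * / c w)%C by field.
apply: Rle_trans (Cmod_triangle _ _) _.
rewrite !Cmod_mult !Cmod_inv //.
have Hd := Cmod_ge_0 (z - w)%C.
have I1 : / Cmod (c z) <= / k by apply: Rinv_le_contravar.
have I2 : / Cmod (c w) <= / k by apply: Rinv_le_contravar.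
have J1 : 0 < / Cmod (c z) by apply: Rinv_0_lt_compat; lra.
have J2 : 0 < / Cmod (c w) by apply: Rinv_0_lt_compat; lra.
have T1 : Cmod (N z - N w)%C * / Cmod (c z) <= L * Cmod (z - w)%C * / k.
{ apply: Rmult_le_compat; [exact: Cmod_ge_0|lra|exact: HNl|done]. }
have T2 : Cmod (N w) * Cmod (c w - c z)%C * / Cmod (c z) * / Cmod (c w) <=
  B * (Lc * Cmod (z - w)%C) * / k * / k.
{ have P1 := Cmod_ge_0 (N w). have P2 := Cmod_ge_0 (c w - c z)%C.
  apply: Rmult_le_compat; [|lra| |done].
  - apply: Rmult_le_pos; last lra. exact: Rmult_le_pos.
  - apply: Rmult_le_compat; [|lra| |done].
    + exact: Rmult_le_pos.
    + apply: Rmult_le_compat => //; first exact: HN.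
      rewrite Cmod_minus_sym. exact: Hcl. }
rewrite /Rdiv. lra.
Qed.

Lemma least_nat (P : nat -> Prop) :
  (exists n, P n) -> exists m, P m /\ forall k, (k < m)%nat -> ~ P k.
Proof.
move=> [n Hn]. apply: NNPP => Hno.
have H : forall k, ~ P k.
{ apply: (well_founded_ind Wf_nat.lt_wf) => k IH Hk. apply: Hno. by exists k. }
exact: (H n).
Qed.

Lemma small_geometric (x K : R) : (forall n, x <= K * (1 / 2) ^ n) -> 0 <= K -> x <= 0.
Proof.
move=> H HK. apply: Rnot_lt_le => Hx.
have [N HN] := pow_lt_1_zero (1 / 2) ltac:(rewrite Rabs_right; lra)
  (x / (K + 1)) ltac:(apply: Rdiv_lt_0_compat; lra).
have H1 := HN N (le_n N). have H2 := H N.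
have Hp : 0 < (1 / 2) ^ N by apply: pow_lt; lra.
rewrite Rabs_right in H1; last lra.
have H3 : (1 / 2) ^ N * (K + 1) < x by apply/Rlt_div_r; lra.
nra.
Qed.

(** By Cauchy's formula [f - f p] is the quotient of [transform g 0] by [c]. If
    the Taylor coefficients of [g] do not all vanish, the first nonzero one gives
    the order [m]; otherwise [transform g 0 z] is bounded by a geometric sequence
    in the order of the remainder, hence is zero. *)
Lemma local_normal_form (f : C -> C) (p : C) (R0 : R) : 0 < R0 ->
  (forall z, disc p R0 z -> exists l, has_cderiv f z l) ->
  (exists d L, 0 < d /\ 0 <= L /\ forall z w, disc p d z -> disc p d w ->
     Cmod (f z - f w)%C <= L * Cmod (z - w)%C) /\
  ((exists d, 0 < d /\ forall z, disc p d z -> f z = f p) \/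
  (exists (m : nat) (u : C -> C) (d L : R), 0 < d /\ (1 <= m)%nat /\ u p <> 0%C /\ 0 <= L /\
     (forall z, disc p d z -> f z = (f p + (z - p) ^ m * u z)%C) /\
     (forall z w, disc p d z -> disc p d w ->
        Cmod (u z - u w)%C <= L * Cmod (z - w)%C))).
Proof.
move=> HR Hf.
have [lp Hlp] := Hf p (disc_center p R0 HR).
have [d1 [Hd1 Hb]] := has_cderiv_ccont _ _ _ Hlp 1 Rlt_0_1.
pose r := Rmin R0 d1. have Hr : 0 < r by apply: Rmin_glb_lt.
have HrR : r <= R0 by exact: Rmin_l. have Hrd : r <= d1 by exact: Rmin_r.
pose a := r / 16. have Ha : 0 < a by rewrite /a; lra.
have Hbox : forall z, in_box p (4 * a) z -> disc p r z.
{ move=> z /in_box_disc. rewrite /disc /a. lra. }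
pose g z := (f z - f p)%C.
have Hgd : forall z, in_box p (4 * a) z -> exists l, has_cderiv g z l.
{ move=> z /Hbox Hz. have [l Hl] := Hf z (Rlt_le_trans _ _ _ Hz HrR).
  exists l => e He. have [d [Hd H]] := Hl e He. exists d. split=> // w Hw.
  have := H w Hw.
  by have -> : (g w - g z - l * (w - z) = f w - f z - l * (w - z))%C
    by rewrite /g; ring. }
have Hgc : forall z, in_box p (4 * a) z -> ccont g z.
{ move=> z /Hgd [l]. exact: has_cderiv_ccont. }
have Hg1 : forall z, in_box p (4 * a) z -> Cmod (g z) <= 1.
{ move=> z /Hbox Hz. apply: Rlt_le. exact: (Hb z (Rlt_le_trans _ _ _ Hz Hrd)). }
pose T := transform p a.
have Tform := transform_formula p a Ha. have Texp := transform_expand p a Ha.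
have Tbound := transform_bound p a Ha. have Tlip := transform_lipschitz p a Ha.
pose c := T (fun _ => 1%C) O.
have Hc0 : c p <> 0%C.
{ rewrite /c /T transform_center //. exact: mass_neq0. }
have [Lc [HLc Hcl]] := Tlip (fun _ => 1%C) (fun z _ => ccont_const _ z) 1
  (fun z _ => Req_le _ _ Cmod_1) O.
have Hc0p := proj1 (Cmod_gt_0 _) Hc0.
(* The radius is chosen so that [c] stays away from zero. *)
pose d := Rmin (a / 2) (Cmod (c p) / (2 * (Lc + 1))).
have Hd : 0 < d.
{ apply: Rmin_glb_lt; first lra. apply: Rdiv_lt_0_compat; lra. }
have Hda : d <= a / 2 by exact: Rmin_l.
have Hpa : Cmod (p - p)%C < a / 2.
{ have -> : (p - p = 0)%C by ring. rewrite Cmod_0. lra. }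
have Hcz : forall z, disc p d z -> Cmod (c p) / 2 <= Cmod (c z).
{ move=> z Hz. rewrite /disc in Hz.
  have H1 := Hcl p z Hpa ltac:(lra).
  have H2 := Cmod_triangle_minus (c p) (c z).
  have H3 : Lc * Cmod (p - z)%C <= Cmod (c p) / 2.
  { rewrite Cmod_minus_sym.
    have : Cmod (z - p)%C <= Cmod (c p) / (2 * (Lc + 1)).
    { apply: Rlt_le. apply: Rlt_le_trans Hz _. exact: Rmin_r. }
    move=> H4. have H5 := Cmod_ge_0 (z - p)%C.
    have : Cmod (z - p)%C * (2 * (Lc + 1)) <= Cmod (c p).
    { apply/Rle_div_r => //. lra. }
    nra. }
  rewrite -/T -/c in H1. lra. }
have Hcz0 : forall z, disc p d z -> c z <> 0%C.
{ move=> z /Hcz H E. rewrite E Cmod_0 in H. lra. }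
have Hk : 0 < Cmod (c p) / 2 by lra.
have HB : forall m, 0 <= 8 * (4 * a) ^ 2 * (1 * (2 / a ^ m)).
{ move=> m. have : 0 < 2 / a ^ m by apply: Rdiv_lt_0_compat; [lra|exact: pow_lt].
  have := pow2_ge_0 (4 * a). nra. }
have Hquot : forall m, exists L, 0 <= L /\ forall z w, disc p d z -> disc p d w ->
  Cmod (T g m z / c z - T g m w / c w)%C <= L * Cmod (z - w)%C.
{ move=> m. have [L [HL Hl]] := Tlip g Hgc 1 Hg1 m.
  exists (L / (Cmod (c p) / 2) +
     8 * (4 * a) ^ 2 * (1 * (2 / a ^ m)) * Lc / (Cmod (c p) / 2) / (Cmod (c p) / 2)).
  split.
  - have Hik := Rinv_0_lt_compat _ Hk. have HBm := HB m.
    apply: Rplus_le_le_0_compat; repeat apply: Rmult_le_pos => //;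
      by [lra | exact: Rlt_le].
  - apply: (quotient_lipschitz _ _ (disc p d)) => //; rewrite /disc.
    + move=> z Hz. apply: Tbound => //. lra.
    + move=> z w Hz Hw. apply: Hl; lra.
    + move=> z w Hz Hw. apply: Hcl; lra. }
have Hfg : forall z, disc p d z -> f z = (f p + T g O z / c z)%C.
{ move=> z Hz. rewrite /T Tform //; last by rewrite /disc in Hz; lra.
  have := Hcz0 z Hz. rewrite /c /T /g => Hne. by field. }
split.
{ have [L [HL Hl]] := Hquot O. exists d, L. split=> //. split=> // z w Hz Hw.
  rewrite (Hfg z) // (Hfg w) //. apply: Rle_trans (Hl z w Hz Hw). right. congr Cmod. ring. }
case: (classic (exists n, T g n p <> 0%C)) => [Hex|Hall].
- right. have [m [Hm Hmin]] := least_nat _ Hex.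
  have Hm' : forall k, (k < m)%nat -> T g k p = 0%C.
  { move=> k /Hmin H. exact: NNPP. }
  have [L [HL Hl]] := Hquot m.
  exists m, (fun z => T g m z / c z)%C, d, L.
  split=> //. split; last split; last split=> //; last split=> //.
  + case: (m) Hm => [|m'] Hm; last lia.
    exfalso. apply: Hm. rewrite /T Tform // /g. ring.
  + move=> E. apply: Hm. have -> : T g m p = (T g m p / c p * c p)%C by field.
    rewrite E. ring.
  + move=> z Hz. have Hza : Cmod (z - p)%C < a / 2 by rewrite /disc in Hz; lra.
    have Hcz' := Hcz0 z Hz.
    rewrite (Hfg z Hz) {1}/T (Texp g Hgc m z Hza Hm') -/T. by field.
- left. exists d. split=> // z Hz.
  have Hza : Cmod (z - p)%C < a / 2 by rewrite /disc in Hz; lra.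
  have H0 : forall n, T g n p = 0%C.
  { move=> n. apply: NNPP => H. apply: Hall. by exists n. }
  have Hle : Cmod (T g O z) <= 0.
  { apply: (small_geometric _ (8 * (4 * a) ^ 2 * 2)); last first.
    { have := pow2_ge_0 (4 * a). lra. }
    move=> n. rewrite /T (Texp g Hgc n z Hza (fun k _ => H0 k)) Cmod_mult Cmod_pow.
    have Hb' := Tbound g Hgc 1 Hg1 n z Hza.
    have Hp : 0 < a ^ n by apply: pow_lt.
    have H1 : Cmod (z - p)%C ^ n <= (1 / 2) ^ n * a ^ n.
    { rewrite -Rpow_mult_distr. apply: pow_incr. split; first exact: Cmod_ge_0. lra. }
    apply: (Rle_trans _ ((1 / 2) ^ n * a ^ n * (8 * (4 * a) ^ 2 * (1 * (2 / a ^ n))))).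
    - apply: Rmult_le_compat => //; [|exact: Cmod_ge_0]. apply: pow_le. exact: Cmod_ge_0.
    - right. field. lra. }
  have : T g O z = 0%C.
  { apply: Cmod_eq_0. have := Cmod_ge_0 (T g O z). lra. }
  rewrite (Hfg z Hz) => ->. have Hcz' := Hcz0 z Hz. by field.
Qed.

(** * Quantitative open mapping *)

Lemma Cpow_Bernoulli (m : nat) : exists K, 0 <= K /\ forall t : C,
  Cmod t <= 1 -> Cmod ((1 + t) ^ m - 1 - RtoC (INR m) * t)%C <= K * Cmod t ^ 2.
Proof.
elim: m => [|m [K [HK IH]]].
- exists 0. split; first lra. move=> t _.
  have -> : ((1 + t) ^ 0 - 1 - RtoC (INR 0) * t = 0)%C by rewrite /=; ring.
  rewrite Cmod_0. lra.
- have Hm := pos_INR m. exists (INR m + 2 * K). split; first lra.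
  move=> t Ht. have H := IH t Ht.
  set e := ((1 + t) ^ m - 1 - RtoC (INR m) * t)%C in H.
  have -> : ((1 + t) ^ S m - 1 - RtoC (INR (S m)) * t =
    RtoC (INR m) * (t * t) + (1 + t) * e)%C.
  { rewrite S_INR RtoC_plus /e Cpow_S. ring. }
  apply: Rle_trans (Cmod_triangle _ _) _.
  rewrite !Cmod_mult Cmod_R Rabs_right; last lra.
  have H1 : Cmod (1 + t)%C <= 2.
  { have := Cmod_triangle 1 t. rewrite Cmod_1. lra. }
  have := Cmod_ge_0 e. have := Cmod_ge_0 (1 + t)%C. nra.
Qed.

(** Two points that are close compared with their modulus are separated by the
    power map as much as by its derivative, up to a factor. *)
Lemma Cpow_separation (k : nat) : exists kappa, 0 < kappa <= 1 /\
  forall a b : C, 0 < Cmod a -> Cmod (b - a)%C <= kappa * Cmod a ->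
  Cmod (b - a)%C * Cmod a ^ k / 2 <= Cmod (b ^ S k - a ^ S k)%C.
Proof.
have [K [HK H]] := Cpow_Bernoulli (S k).
have [kappa [Hkap [Hk1 Hk2]]] := pos_min 1 (/ (2 * (K + 1))) Rlt_0_1
  ltac:(apply: Rinv_0_lt_compat; lra).
have HKk : K * kappa <= 1 / 2.
{ have E : K * / (2 * (K + 1)) = 1 / 2 - / (2 * (K + 1)) by field; lra. nra. }
exists kappa. split=> // a b Ha Hab.
have Ha0 : a <> 0%C by exact: (proj2 (Cmod_gt_0 _)).
set t := ((b - a) / a)%C.
have Et : Cmod t * Cmod a = Cmod (b - a)%C.
{ rewrite /t Cmod_div //. field. lra. }
have Ht0 := Cmod_ge_0 t.
have Htk : Cmod t <= kappa by nra.
have -> : (b ^ S k - a ^ S k = a ^ S k * ((1 + t) ^ S k - 1))%C.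
{ have Eb : b = (a * (1 + t))%C by rewrite /t; field.
  rewrite [X in (X ^ _ - _)%C]Eb Cpow_mult_l. ring. }
rewrite Cmod_mult Cmod_pow -Et.
have H1 := H t ltac:(lra).
have H2 := Cmod_triangle_minus (RtoC (INR (S k)) * t)%C ((1 + t) ^ S k - 1)%C.
rewrite (Cmod_minus_sym (RtoC _ * t)%C) Cmod_mult Cmod_R Rabs_right in H2; last first.
{ have := pos_INR (S k). lra. }
have H3 : 1 <= INR (S k) by rewrite S_INR; have := pos_INR k; lra.
have H4 : Cmod t / 2 <= Cmod ((1 + t) ^ S k - 1)%C.
{ have : K * Cmod t ^ 2 <= Cmod t / 2 by nra. nra. }
have -> : Cmod t * Cmod a * Cmod a ^ k / 2 = Cmod a ^ S k * (Cmod t / 2).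
{ rewrite /=. field. }
apply: Rmult_le_compat_l => //. apply: pow_le. lra.
Qed.

Lemma de_Moivre t n : ((cos t, sin t) ^ n)%C = (cos (INR n * t), sin (INR n * t)).
Proof.
elim: n => [|n IH].
- by rewrite /= Rmult_0_l cos_0 sin_0.
- rewrite Cpow_S IH S_INR Rmult_plus_distr_r Rmult_1_l cos_plus sin_plus.
  rewrite /Cmult /=. congr (_, _); ring.
Qed.

(** One of [c], [i c], [- c] and [- i c] is in the left half-plane; [w] is an
    [m]-th root of the corresponding power of [i]. *)
Lemma descent_direction (m : nat) (c : C) : (1 <= m)%nat -> c <> 0%C ->
  exists w, Cmod w = 1 /\ Re (c * w ^ m)%C < 0.
Proof.
move=> Hm Hc.
have Hm' : INR m <> 0 by apply: not_0_INR; lia.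
have Hroot : forall t, exists w, Cmod w = 1 /\ (w ^ m)%C = (cos t, sin t).
{ move=> t. exists (cos (t / INR m), sin (t / INR m)). split.
  - rewrite /Cmod /=. have := sin2_cos2 (t / INR m). rewrite /Rsqr => H.
    transitivity (sqrt 1); last exact: sqrt_1. congr sqrt. lra.
  - rewrite de_Moivre. have -> : INR m * (t / INR m) = t by field. by []. }
case: c Hc => x y Hc.
have [w0 [A0 B0]] := Hroot 0. have [w1 [A1 B1]] := Hroot (PI / 2).
have [w2 [A2 B2]] := Hroot PI. have [w3 [A3 B3]] := Hroot (3 * (PI / 2)).
rewrite cos_0 sin_0 in B0. rewrite cos_PI2 sin_PI2 in B1.
rewrite cos_PI sin_PI in B2. rewrite cos_3PI2 sin_3PI2 in B3.
case: (Rtotal_order x 0) => [H|[H|H]].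
- exists w0. split=> //. rewrite B0 /Re /=. lra.
- case: (Rtotal_order y 0) => [Hy|[Hy|Hy]].
  + exists w3. split=> //. rewrite B3 /Re /=. lra.
  + case: Hc. by rewrite H Hy.
  + exists w1. split=> //. rewrite B1 /Re /=. lra.
- exists w2. split=> //. rewrite B2 /Re /=. lra.
Qed.

Definition power_like (f : C -> C) (s : C) : Prop :=
  exists (m : nat) (u : C -> C) (d : R), 0 < d /\ (1 <= m)%nat /\ u s <> 0%C /\
    ccont u s /\ forall z, disc s d z -> f z = (f s + (z - s) ^ m * u z)%C.

Lemma Cmod_plus_sq (a b : C) :
  Cmod (a + b)%C ^ 2 = Cmod a ^ 2 + 2 * Re (Cconj a * b)%C + Cmod b ^ 2.
Proof.
rewrite !Cmod_sqr. case: a => p q. case: b => x y. rewrite /Re /=. ring.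
Qed.

Lemma Re_real_mult (x : R) (z : C) : Re (RtoC x * z)%C = x * Re z.
Proof. case: z => p q. rewrite /Re /=. ring. Qed.

(** The minimum principle: move from [s] in the direction for which the leading
    term [u s * (z - s)^m] has a negative scalar product with [f s - w]. *)
Lemma power_like_descent (f : C -> C) (s w : C) (e : R) :
  power_like f s -> f s <> w -> 0 < e ->
  exists z, disc s e z /\ Cmod (f z - w)%C < Cmod (f s - w)%C.
Proof.
move=> [m [u [d [Hd [Hm [Hu0 [Hu Hf]]]]]]] Hne He.
set q := (f s - w)%C.
have Hq : q <> 0%C by move=> E; apply: Hne; exact: Csub_eq0.
have Hqp := proj1 (Cmod_gt_0 _) Hq.
have Hc : (Cconj q * u s)%C <> 0%C.
{ apply: Cmult_neq_0 => // E. have := Cmod_conj q. rewrite E Cmod_0. lra. }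
have [v [Hv Hneg]] := descent_direction m _ Hm Hc.
set eta := - Re (Cconj q * u s * v ^ m)%C.
have Heta : 0 < eta by rewrite /eta; lra.
have [e2 [He2 [U1 U2]]] := pos_min 1 (eta / (2 * Cmod q)) Rlt_0_1
  ltac:(apply: Rdiv_lt_0_compat; lra).
have [d2 [Hd2 Hcont]] := Hu e2 He2.
set M := Cmod (u s) + 1. have HM : 0 < M by rewrite /M; have := Cmod_ge_0 (u s); lra.
have HM2 : 0 < M ^ 2 by apply: pow_lt.
have [t1 [Ht1 [T1 T2]]] := pos_min d e Hd He.
have [t2 [Ht2 [T3 T4]]] := pos_min 1 (eta / M ^ 2) Rlt_0_1
  ltac:(exact: Rdiv_lt_0_compat).
have [t3 [Ht3 [T5 T6]]] := pos_min t1 t2 Ht1 Ht2.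
have [t4 [Ht4 [T7 T8]]] := pos_min t3 d2 Ht3 Hd2.
set t := t4 / 2. have Ht : 0 < t by rewrite /t; lra.
have Htlt : t < eta / M ^ 2 by rewrite /t; lra.
pose z := (s + RtoC t * v)%C.
have Hzs : Cmod (z - s)%C = t.
{ have -> : (z - s = RtoC t * v)%C by rewrite /z; ring.
  rewrite Cmod_mult Hv Cmod_R Rabs_right; lra. }
exists z. split; first by rewrite /disc Hzs /t; lra.
have Hfz : (f z - w = q + RtoC (t ^ m) * (v ^ m * u z))%C.
{ rewrite Hf; last by rewrite /disc Hzs /t; lra.
  have -> : (z - s = RtoC t * v)%C by rewrite /z; ring.
  rewrite Cpow_mult_l -RtoC_pow /q. ring. }
have Huz : Cmod (u z - u s)%C < e2.
{ apply: Hcont. rewrite /disc Hzs /t. lra. }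
have Hvm : Cmod (v ^ m)%C = 1 by rewrite Cmod_pow Hv pow1.
have Hmod : Cmod (v ^ m * u z)%C <= M.
{ rewrite Cmod_mult Hvm. have := Cmod_triangle_minus (u z) (u s). rewrite /M. lra. }
have Hre : Re (Cconj q * (v ^ m * u z))%C <= - (eta / 2).
{ have -> : (Cconj q * (v ^ m * u z) = Cconj q * u s * v ^ m +
    Cconj q * v ^ m * (u z - u s))%C by ring.
  have H1 := re_le_Cmod (Cconj q * v ^ m * (u z - u s))%C.
  rewrite !Cmod_mult Hvm Cmod_conj Rmult_1_r in H1.
  have H2 : Cmod q * Cmod (u z - u s)%C <= Cmod q * (eta / (2 * Cmod q)).
  { apply: Rmult_le_compat_l; lra. }
  have E : Cmod q * (eta / (2 * Cmod q)) = eta / 2 by field; lra.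
  have H3 := Rle_abs (Re (Cconj q * v ^ m * (u z - u s))%C).
  rewrite E in H2.
  have -> : Re (Cconj q * u s * v ^ m + Cconj q * v ^ m * (u z - u s))%C =
    Re (Cconj q * u s * v ^ m)%C + Re (Cconj q * v ^ m * (u z - u s))%C by [].
  rewrite /eta in H2 Heta |- *. lra. }
have Htm : 0 < t ^ m by apply: pow_lt.
have Htm1 : t ^ m <= t.
{ case: (m) Hm => [|m'] Hm'; first lia. rewrite /=.
  have : t ^ m' <= 1.
  { rewrite -(pow1 m'). apply: pow_incr. rewrite /t. lra. }
  nra. }
have Hsq : Cmod (f z - w)%C ^ 2 < Cmod q ^ 2.
{ rewrite Hfz Cmod_plus_sq.
  have -> : Re (Cconj q * (RtoC (t ^ m) * (v ^ m * u z)))%C =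
    t ^ m * Re (Cconj q * (v ^ m * u z))%C.
  { have -> : (Cconj q * (RtoC (t ^ m) * (v ^ m * u z)) =
      RtoC (t ^ m) * (Cconj q * (v ^ m * u z)))%C by ring.
    exact: Re_real_mult. }
  rewrite (Cmod_mult (RtoC _)) Cmod_R Rabs_right; last lra.
  have H1 : Cmod (v ^ m * u z)%C ^ 2 <= M ^ 2.
  { apply: pow_incr. split=> //. exact: Cmod_ge_0. }
  have H2 : t * M ^ 2 < eta by apply/Rlt_div_r.
  rewrite Rpow_mult_distr.
  have H3 : (t ^ m) ^ 2 * Cmod (v ^ m * u z)%C ^ 2 <= t ^ m * (t * M ^ 2).
  { have -> : (t ^ m) ^ 2 * Cmod (v ^ m * u z)%C ^ 2 =
      t ^ m * (t ^ m * Cmod (v ^ m * u z)%C ^ 2) by ring.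
    apply: Rmult_le_compat_l; first lra.
    apply: Rmult_le_compat => //; [lra|exact: pow2_ge_0]. }
  nra. }
apply: Rnot_le_lt => Hle. have := pow_incr _ _ 2 (conj (Cmod_ge_0 q) Hle). lra.
Qed.

(** A point of the disc where [|f - w|] is minimal is not on the boundary, since
    [|f - w|] is smaller at the centre; there [f] takes the value [w] by the
    minimum principle. *)
Lemma open_mapping (f : C -> C) (K : C -> Prop) (z : C) (r mu : R) :
  0 < r -> compact_set K ->
  (forall t, Cmod (t - z)%C <= r -> K t /\ ccont f t /\ power_like f t) ->
  (forall t, Cmod (t - z)%C = r -> mu <= Cmod (f t - f z)%C) ->
  forall w, Cmod (w - f z)%C < mu / 2 ->
  exists t, Cmod (t - z)%C <= r /\ f t = w.
Proof.
move=> Hr HK Hf Hmu w Hw.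
have Hzz : Cmod (z - z)%C <= r.
{ have -> : (z - z = 0)%C by ring. rewrite Cmod_0. lra. }
have HKr : compact_set (fun t => K t /\ Cmod (t - z)%C <= r).
{ apply: compact_inter_closed => // t Ht.
  exists (Cmod (t - z)%C - r). split; first lra.
  move=> t' Ht'. rewrite /disc in Ht'.
  have := Cmod_dist t t' z. rewrite (Cmod_minus_sym t t'). lra. }
have [s [[_ Hs] Hmin]] := compact_min _ (fun t => Cmod (f t - w)%C) z HKr
  (conj (proj1 (Hf z Hzz)) Hzz) (fun t => Cmod_ge_0 _) ltac:(
   move=> t [_ Ht] e He; have [d [Hd H]] := proj1 (proj2 (Hf t Ht)) e He;
   exists d; split=> // t' /H; rewrite /disc => Hd';
   have := Cmod_dist (f t) (f t') w; rewrite (Cmod_minus_sym (f t) (f t')); lra).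
have Hsz : Cmod (f s - w)%C < mu / 2.
{ apply: Rle_lt_trans (Hmin z (conj (proj1 (Hf z Hzz)) Hzz)) _.
  by rewrite Cmod_minus_sym. }
exists s. split=> //. apply: NNPP => Hne.
have Hsr : Cmod (s - z)%C < r.
{ case: (Rle_lt_or_eq_dec _ _ Hs) => // E. have := Hmu s E.
  have := Cmod_dist (f s) w (f z). lra. }
have [t [Ht Hlt]] := power_like_descent f s w (r - Cmod (s - z)%C)
  (proj2 (proj2 (Hf s Hs))) Hne ltac:(lra).
have Htr : Cmod (t - z)%C <= r.
{ rewrite /disc in Ht. have := Cmod_dist t s z. lra. }
have := Hmin t (conj (proj1 (Hf t Htr)) Htr). lra.
Qed.

(** * Distances to the boundary under an injective holomorphic map *)

Section Geometry.

Variables (f : C -> C) (U : C -> Prop).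
Hypothesis U_open : open U.
Hypothesis K_compact : compact_set (closure_set U).
Hypothesis f_hol : forall p, closure_set U p ->
  exists d, 0 < d /\ forall z, disc p d z -> exists l, has_cderiv f z l.
Hypothesis f_inj : injective_on f (closure_set U).

Let K := closure_set U.

(** Every neighbourhood of a point of the closure contains a disc of [U], on
    which [f] is injective, hence not constant. *)
Lemma normal_form p : K p ->
  exists (m : nat) (u : C -> C) (d L : R), 0 < d <= 1 /\ u p <> 0%C /\ 0 <= L /\
     (forall z, disc p d z -> f z = (f p + (z - p) ^ S m * u z)%C) /\
     (forall z w, disc p d z -> disc p d w ->
        Cmod (u z - u w)%C <= L * Cmod (z - w)%C).
Proof.
move=> Hp. have [d0 [Hd0 Hf]] := f_hol p Hp.
case: (proj2 (local_normal_form f p d0 Hd0 Hf)) => [[d [Hd Hconst]]|].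
- exfalso. have [y [Hy HyU]] := proj1 (closure_disc U p) Hp d Hd.
  have [e [He HeU]] := proj1 (open_disc U) U_open y HyU.
  rewrite /disc in Hy.
  have [s2 [Hs [S1 S2]]] := pos_min e (d - Cmod (y - p)%C) He ltac:(lra).
  pose s := s2 / 2. pose y' := (y + RtoC s)%C.
  have Hyy : Cmod (y' - y)%C = s.
  { have -> : (y' - y = RtoC s)%C by rewrite /y'; ring.
    rewrite Cmod_R Rabs_right // /s. lra. }
  have Hy'U : U y' by apply: HeU; rewrite /disc Hyy /s; lra.
  have E : y' = y.
  { apply: f_inj; try exact: subset_closure.
    rewrite (Hconst y) // (Hconst y') //.
    rewrite /disc. have := Cmod_dist y' y p. rewrite Hyy /s. lra. }
  have : Cmod (y' - y)%C = 0.
  { rewrite E. have -> : (y - y = 0)%C by ring. exact: Cmod_0. }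
  rewrite Hyy /s. lra.
- move=> [m [u [d [L [Hd [Hm [Hu [HL [Hfu Hlip]]]]]]]]].
  case: m Hm Hfu => [|m] Hm Hfu; first lia.
  exists m, u, (Rmin d 1), L.
  have D1 := Rmin_l d 1. have D2 := Rmin_r d 1.
  split; [|split=> //; split=> //; split].
  + split=> //. apply: Rmin_glb_lt => //. lra.
  + move=> z Hz. apply: Hfu. exact: Rlt_le_trans Hz D1.
  + move=> z w Hz Hw. apply: Hlip; [exact: Rlt_le_trans Hz D1|exact: Rlt_le_trans Hw D1].
Qed.

Lemma f_power_like p : K p -> power_like f p.
Proof.
move=> /normal_form [m [u [d [L [Hd [Hu [HL [Hf Hlip]]]]]]]].
exists (S m), u, d. split; [lra|split; [lia|split=> //; split=> //]].
move=> e He. exists (Rmin d (e / (L + 1))).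
have He' : 0 < e / (L + 1) by apply: Rdiv_lt_0_compat; lra.
split; first by apply: Rmin_glb_lt; lra.
move=> w Hw. rewrite /disc in Hw.
have D1 := Rmin_l d (e / (L + 1)). have D2 := Rmin_r d (e / (L + 1)).
have H := Hlip w p ltac:(rewrite /disc; lra) (disc_center p d (proj1 Hd)).
have H2 : Cmod (w - p)%C * (L + 1) < e by apply/Rlt_div_r; lra.
have := Cmod_ge_0 (w - p)%C. rewrite /disc. nra.
Qed.

Lemma f_ccont p : K p -> ccont f p.
Proof.
move=> /f_hol [d [Hd H]]. have [l Hl] := H p (disc_center p d Hd).
exact: has_cderiv_ccont Hl.
Qed.

Lemma f_bounded : exists B, 0 < B /\ forall z, K z -> Cmod (f z) <= B.
Proof.
apply: compact_bound => // z Hz.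
have [d [Hd H]] := f_ccont z Hz 1 Rlt_0_1.
exists (Cmod (f z) + 1), d. split=> // w /H. rewrite /disc.
have := Cmod_triangle_minus (f w) (f z). lra.
Qed.

Lemma f_lipschitz : exists L, 0 < L /\ forall z w, K z -> K w ->
  Cmod (f z - f w)%C <= L * Cmod (z - w)%C.
Proof.
have [B [HB Hbd]] := f_bounded.
have [n Hn] : exists n : nat, forall z, K z -> forall w, K w ->
  Cmod (z - w)%C < / (INR n + 1) -> Cmod (f z - f w)%C <= INR n * Cmod (z - w)%C.
{ apply: (compact_uniform K (fun n z => forall w, K w ->
    Cmod (z - w)%C < / (INR n + 1) ->
    Cmod (f z - f w)%C <= INR n * Cmod (z - w)%C)) => //.
  - move=> n m z Hnm H w Hw Hzw.
    have H1 := inv_INR_antimono _ _ Hnm. have H2 := le_INR _ _ Hnm.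
    have := H w Hw ltac:(lra). have := Cmod_ge_0 (z - w)%C. nra.
  - move=> p Hp. have [d0 [Hd0 Hf]] := f_hol p Hp.
    have [d [L [Hd [HL H]]]] := proj1 (local_normal_form f p d0 Hd0 Hf).
    have [n1 Hn1] := INR_above L. have [n2 Hn2] := inv_INR_lt (d / 2) ltac:(lra).
    exists (max n1 n2), (d / 2). split; first lra.
    move=> z Hz w Hw Hzw. rewrite /disc in Hz.
    have M1 := le_INR _ _ (Nat.le_max_l n1 n2).
    have M2 := inv_INR_antimono _ _ (Nat.le_max_r n1 n2).
    have Hw' : disc p d w.
    { rewrite /disc. have := Cmod_dist w z p. rewrite (Cmod_minus_sym w z). lra. }
    have := H z w ltac:(rewrite /disc; lra) Hw'.
    have := Cmod_ge_0 (z - w)%C. nra. }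
have Hn0 := pos_INR n.
exists (INR n + 2 * B * (INR n + 1)).
split; first by nra.
move=> z w Hz Hw.
have H0 := Cmod_ge_0 (z - w)%C.
case: (Rlt_dec (Cmod (z - w)%C) (/ (INR n + 1))) => H.
- have := Hn z Hz w Hw H.
  have : 0 <= 2 * B * (INR n + 1) * Cmod (z - w)%C.
  { apply: Rmult_le_pos => //. nra. }
  lra.
- have H1 : 1 <= (INR n + 1) * Cmod (z - w)%C.
  { have E : 1 = (INR n + 1) * / (INR n + 1) by field; lra.
    apply: (Rle_trans _ _ _ (Req_le _ _ E)). apply: Rmult_le_compat_l; lra. }
  have H2 := Cmod_triangle (f z) (- f w)%C. rewrite Cmod_opp in H2.
  have H3 := Hbd z Hz. have H4 := Hbd w Hw.
  have : 0 <= INR n * Cmod (z - w)%C by apply: Rmult_le_pos.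
  have : 2 * B * 1 <= 2 * B * ((INR n + 1) * Cmod (z - w)%C).
  { apply: Rmult_le_compat_l; lra. }
  rewrite /Cminus. lra.
Qed.

Let seg (z b : C) (t : R) : C := (z + RtoC t * (b - z))%C.

Let seg_dist z b s t : Cmod (seg z b s - seg z b t)%C = Rabs (s - t) * Cmod (b - z)%C.
Proof.
have -> : (seg z b s - seg z b t = RtoC (s - t) * (b - z))%C.
{ rewrite /seg RtoC_minus. ring. }
by rewrite Cmod_mult Cmod_R.
Qed.

Lemma segment_exit z b : U z -> ~ U b ->
  exists b', K b' /\ ~ U b' /\ Cmod (b' - z)%C <= Cmod (b - z)%C.
Proof.
move=> Hz Hb.
have E0 : seg z b 0 = z by rewrite /seg; ring.
have E1 : seg z b 1 = b by rewrite /seg; ring.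
have [t [Ht1 Ht2]] : {t | is_lub (fun t => 0 <= t <= 1 /\
    forall s, 0 <= s <= t -> U (seg z b s)) t}.
{ apply: completeness.
  - exists 1 => t [Ht _]. lra.
  - exists 0. split; first lra. move=> s Hs.
    have -> : s = 0 by lra. by rewrite E0. }
have Ht0 : 0 <= t.
{ apply: Ht1. split; first lra. move=> s Hs. have -> : s = 0 by lra. by rewrite E0. }
have Ht01 : t <= 1 by apply: Ht2 => s [Hs _]; lra.
have Hbelow : forall s, 0 <= s < t -> U (seg z b s).
{ move=> s Hs. apply: NNPP => Hn.
  have : t <= s.
  { apply: Ht2 => s' [Hs' HU]. apply: Rnot_lt_le => Hlt. apply: Hn.
    apply: HU. lra. }
  lra. }
have HD := Cmod_ge_0 (b - z)%C.
exists (seg z b t). split; last split.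
- apply/closure_disc => d Hd.
  case: (Rle_lt_or_eq_dec _ _ Ht0) => [Hlt|E]; last first.
  { exists z. split=> //. rewrite -E E0. exact: disc_center. }
  pose e := d / (Cmod (b - z)%C + 1).
  have He : 0 < e by apply: Rdiv_lt_0_compat; lra.
  exists (seg z b (Rmax 0 (t - e / 2))).
  have M1 := Rmax_l 0 (t - e / 2). have M2 := Rmax_r 0 (t - e / 2).
  have M3 : Rmax 0 (t - e / 2) < t by apply: Rmax_lub_lt; lra.
  split; last by apply: Hbelow.
  rewrite /disc seg_dist.
  have H1 : Rabs (Rmax 0 (t - e / 2) - t) <= e / 2 by apply: Rabs_le; lra.
  have H2 : e * (Cmod (b - z)%C + 1) = d by rewrite /e; field; lra.
  nra.
- move=> HUt.
  case: (Rle_lt_or_eq_dec _ _ Ht01) => [Hlt|E]; last by rewrite E E1 in HUt.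
  have [d [Hd HdU]] := proj1 (open_disc U) U_open _ HUt.
  pose e := Rmin (1 - t) (d / (Cmod (b - z)%C + 1)).
  have He1 : e <= 1 - t by exact: Rmin_l.
  have He2 : e <= d / (Cmod (b - z)%C + 1) by exact: Rmin_r.
  have He : 0 < e.
  { apply: Rmin_glb_lt; first lra. apply: Rdiv_lt_0_compat; lra. }
  have : t + e / 2 <= t.
  { apply: Ht1. split; first lra. move=> s Hs.
    case: (Rlt_dec s t) => Hst; first by apply: Hbelow; lra.
    apply: HdU. rewrite /disc seg_dist Rabs_right; last lra.
    have H2 : e * (Cmod (b - z)%C + 1) <= d by apply/Rle_div_r; lra.
    nra. }
  lra.
- have := seg_dist z b t 0. rewrite E0 => ->. rewrite Rabs_right; last lra. nra.
Qed.

(** A segment that leaves [U] passes through a boundary point, whose image is not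
    in [f(U)] because [f] is injective on the closure; and [f] increases
    distances by a bounded factor. *)
Lemma preimage_contains_disc : exists L, 0 < L /\ forall z r, U z -> 0 < r ->
  subset_of (disc (f z) r) (direct_image f U) -> subset_of (disc z (r / L)) U.
Proof.
have [L [HL Hlip]] := f_lipschitz.
exists L. split=> // z r Hz Hr Hsub b Hb. apply: NNPP => HbU.
have [b' [Hb'K [Hb'U Hb']]] := segment_exit z b Hz HbU.
rewrite /disc in Hb.
have [y [Hy Ey]] : direct_image f U (f b').
{ apply: Hsub. rewrite /disc.
  apply: Rle_lt_trans (Hlip b' z Hb'K (subset_closure _ _ Hz)) _.
  have H : Cmod (b - z)%C * L < r by apply/Rlt_div_r.
  have := Cmod_ge_0 (b' - z)%C. nra. }
apply: Hb'U. by rewrite -(f_inj y b' (subset_closure _ _ Hy) Hb'K Ey).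
Qed.

Let good (n : nat) (z : C) : Prop := U z -> forall r, 0 < r <= 1 ->
  subset_of (disc z r) U ->
  subset_of (disc (f z) (/ (INR n + 1) * r ^ n)) (direct_image f U).

Let image_of_disc z r mu : 0 < r ->
  (forall t, Cmod (t - z)%C <= r -> U t) ->
  (forall t, Cmod (t - z)%C = r -> mu <= Cmod (f t - f z)%C) ->
  subset_of (disc (f z) (mu / 2)) (direct_image f U).
Proof.
move=> Hr HU Hmu w Hw.
have [t [Ht <-]] := open_mapping f K z r mu Hr K_compact
  ltac:(move=> t /HU Ht; have HtK := subset_closure _ _ Ht;
        split=> //; split; [exact: f_ccont|exact: f_power_like]) Hmu w Hw.
exists t. split=> //. exact: HU.
Qed.

(** Around a point of [U] the image contains a fixed disc. *)
Let good_inside p : U p ->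
  exists n d, 0 < d /\ forall z, disc p d z -> good n z.
Proof.
move=> Hp. have HpK : K p by exact: subset_closure.
have [m [u [d [L [Hd [Hu [HL [Hf Hlip]]]]]]]] := normal_form p HpK.
have [e [He HeU]] := proj1 (open_disc U) U_open p Hp.
have Hup := proj1 (Cmod_gt_0 _) Hu.
have [r1 [Hr1 [R1 R2]]] := pos_min d e ltac:(lra) He.
have [r2 [Hr2 [R3 R4]]] := pos_min r1 (Cmod (u p) / (L + 1)) Hr1
  ltac:(apply: Rdiv_lt_0_compat; lra).
pose rho := r2 / 2. have Hrho : 0 < rho by rewrite /rho; lra.
have Hrhop : 0 < rho ^ S m by apply: pow_lt.
pose mu := rho ^ S m * (Cmod (u p) / 2).
have Hmu : 0 < mu by apply: Rmult_lt_0_compat; lra.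
have Himg : subset_of (disc (f p) (mu / 2)) (direct_image f U).
{ apply: (image_of_disc p rho) => //.
  - move=> t Ht. apply: HeU. rewrite /disc. rewrite /rho in Ht. lra.
  - move=> t Ht. have Htd : disc p d t by rewrite /disc Ht /rho; lra.
    rewrite (Hf t Htd).
    have -> : (f p + (t - p) ^ S m * u t - f p = (t - p) ^ S m * u t)%C by ring.
    rewrite Cmod_mult Cmod_pow Ht. apply: Rmult_le_compat_l; first lra.
    have H1 := Hlip p t (disc_center p d (proj1 Hd)) Htd.
    rewrite Cmod_minus_sym (Cmod_minus_sym p) Ht in H1.
    have H2 : rho * (L + 1) <= Cmod (u p) / 2.
    { have : Cmod (u p) / (L + 1) * (L + 1) = Cmod (u p) by field; lra.
      rewrite /rho. nra. }
    have := Cmod_triangle_minus (u p) (u t). rewrite (Cmod_minus_sym (u p)). nra. }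
have [d1 [Hd1 Hc]] := f_ccont p HpK (mu / 4) ltac:(lra).
have [n Hn] := inv_INR_lt (mu / 4) ltac:(lra).
exists n, d1. split=> // z Hz _ r Hr _ w Hw. apply: Himg. rewrite /disc.
have H1 := Hc z Hz. rewrite /disc in H1, Hw.
have H2 : / (INR n + 1) * r ^ n <= mu / 4.
{ have : r ^ n <= 1 by rewrite -(pow1 n); apply: pow_incr; lra.
  have := inv_INR_pos n. have : 0 < r ^ n by apply: pow_lt; lra. nra. }
have := Cmod_dist w (f z) (f p). lra.
Qed.

(** The open mapping lemma is applied on a circle around [z] of radius
    comparable to [r]. As [p] is not in [U], it is at distance at least [r] from
    [z], so that the power map centred at [p] separates [z] from the circle by
    [r^(m+1)] up to a factor; the variation of [u] is negligible close to [p]. *)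
Let good_boundary p : K p -> ~ U p ->
  exists n d, 0 < d /\ forall z, disc p d z -> good n z.
Proof.
move=> Hp HpU.
have [m [u [d [L [Hd [Hu [HL [Hf Hlip]]]]]]]] := normal_form p Hp.
have Hup := proj1 (Cmod_gt_0 _) Hu.
have [kappa [Hkap Hsep]] := Cpow_separation m.
have H2m : 0 < 2 ^ S m by apply: pow_lt; lra.
pose eps := Rmin (d / 4) (Cmod (u p) / (8 * 2 ^ S m * (L + 1))).
have HD : 0 < 8 * 2 ^ S m * (L + 1) by nra.
have Heps : 0 < eps.
{ apply: Rmin_glb_lt; first lra. exact: Rdiv_lt_0_compat. }
have E1 : eps <= d / 4 by exact: Rmin_l.
have E2 : eps * (8 * 2 ^ S m * (L + 1)) <= Cmod (u p).
{ apply/Rle_div_r => //. exact: Rmin_r. }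
have Hmu : 0 < kappa * Cmod (u p) / 32 by nra.
have [n1 Hn1] := inv_INR_lt _ Hmu.
exists (max n1 (S m)), eps. split=> // z Hz HzU r Hr HrU.
rewrite /disc in Hz.
set a := (z - p)%C in Hz.
have Har : r <= Cmod a.
{ apply: Rnot_lt_le => H. apply: HpU. apply: HrU. rewrite /disc Cmod_minus_sym. exact: H. }
pose rho := kappa / 2 * r.
have Hrho : 0 < rho by rewrite /rho; nra.
have Hrhor : rho <= r / 2 by rewrite /rho; nra.
have Hzd : disc p d z by rewrite /disc -/a; lra.
have Ham : 0 < Cmod a ^ m by apply: pow_lt; lra.
have Hlow : forall t, Cmod (t - z)%C = rho ->
    rho * Cmod a ^ m * (Cmod (u p) / 8) <= Cmod (f t - f z)%C.
{ move=> t Ht. set b := (t - p)%C.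
  have Eba : (b - a = t - z)%C by rewrite /a /b; ring.
  have Hb : Cmod b <= 2 * Cmod a.
  { have := Cmod_triangle_minus b a. rewrite Eba Ht. lra. }
  have Htd : disc p d t by rewrite /disc -/b; lra.
  have -> : (f t - f z = (b ^ S m - a ^ S m) * u z - - (b ^ S m * (u t - u z)))%C.
  { rewrite (Hf t) // (Hf z) // /a /b. ring. }
  have H1 := Cmod_triangle_minus ((b ^ S m - a ^ S m) * u z)%C
    (- (b ^ S m * (u t - u z)))%C.
  rewrite Cmod_opp (Cmod_mult _ (u z)) (Cmod_mult _ (u t - u z)%C) Cmod_pow in H1.
  have H2 := Hsep a b ltac:(lra) ltac:(rewrite Eba Ht /rho; nra).
  rewrite Eba Ht in H2.
  have H3 := Hlip t z Htd Hzd. rewrite Ht in H3.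
  have H4 := Hlip p z (disc_center p d (proj1 Hd)) Hzd.
  rewrite (Cmod_minus_sym p z) -/a in H4.
  have H5 : Cmod (u p) / 2 <= Cmod (u z).
  { have := Cmod_triangle_minus (u p) (u z).
    have : 1 <= 2 ^ S m by apply: pow_R1_Rle; lra.
    have := Cmod_ge_0 a. nra. }
  have H6 : Cmod b ^ S m * Cmod (u t - u z)%C <=
    rho * Cmod a ^ m * (Cmod (u p) / 8).
  { apply: (Rle_trans _ ((2 * Cmod a) ^ S m * (L * rho))).
    - apply: Rmult_le_compat => //; [|exact: Cmod_ge_0|].
      + apply: pow_le. exact: Cmod_ge_0.
      + apply: pow_incr. split=> //. exact: Cmod_ge_0.
    - rewrite Rpow_mult_distr -[Cmod a ^ S m]/(Cmod a * Cmod a ^ m).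
      have -> : 2 ^ S m * (Cmod a * Cmod a ^ m) * (L * rho) =
        rho * Cmod a ^ m * (Cmod a * (2 ^ S m * L)) by ring.
      apply: Rmult_le_compat_l; first by nra.
      have : Cmod a * (2 ^ S m * L) <= eps * (2 ^ S m * (L + 1)).
      { apply: Rmult_le_compat; [lra|nra|lra|nra]. }
      lra. }
  have H7 : rho * Cmod a ^ m / 2 * (Cmod (u p) / 2) <=
    Cmod (b ^ S m - a ^ S m)%C * Cmod (u z).
  { apply: Rmult_le_compat => //; [nra|lra]. }
  have : 0 <= rho * Cmod a ^ m * Cmod (u p).
  { apply: Rmult_le_pos; nra. }
  lra. }
have Himg : subset_of (disc (f z) (rho * Cmod a ^ m * (Cmod (u p) / 8) / 2))
  (direct_image f U).
{ apply: (image_of_disc z rho) => //.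
  move=> t Ht. apply: HrU. rewrite /disc. lra. }
move=> w Hw. apply: Himg. rewrite /disc in Hw |- *.
apply: Rlt_le_trans Hw _.
set n := max n1 (S m).
have N1 := inv_INR_antimono _ _ (Nat.le_max_l n1 (S m)). rewrite -/n in N1.
have N2 : r ^ n <= r ^ S m.
{ have -> : n = (S m + (n - S m))%nat by rewrite /n; lia.
  rewrite pow_add. have : r ^ (n - S m) <= 1.
  { rewrite -(pow1 (n - S m)). apply: pow_incr. lra. }
  have : 0 < r ^ S m by apply: pow_lt; lra. nra. }
apply: (Rle_trans _ (kappa * Cmod (u p) / 32 * r ^ S m)).
- apply: Rmult_le_compat => //; try lra.
  + apply: Rlt_le. exact: inv_INR_pos.
  + apply: pow_le. lra.
- have N3 : r ^ m <= Cmod a ^ m by apply: pow_incr; lra.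
  rewrite /rho -[r ^ S m]/(r * r ^ m).
  have -> : kappa * Cmod (u p) / 32 * (r * r ^ m) =
    kappa * Cmod (u p) / 32 * r * r ^ m by ring.
  have -> : kappa / 2 * r * Cmod a ^ m * (Cmod (u p) / 8) / 2 =
    kappa * Cmod (u p) / 32 * r * Cmod a ^ m by field.
  apply: Rmult_le_compat_l => //. nra.
Qed.

(** The reverse comparison loses a power, since [f] may have critical points on
    the boundary of [U], near which it contracts discs. *)
Lemma image_contains_disc : exists c N, 0 < c <= 1 /\ forall z r, U z -> 0 < r <= 1 ->
  subset_of (disc z r) U -> subset_of (disc (f z) (c * r ^ N)) (direct_image f U).
Proof.
have [n Hn] : exists n : nat, forall z, K z -> good n z.
{ apply: compact_uniform => //.
  - move=> n m z Hnm H HU r Hr Hsub w Hw. apply: (H HU r Hr Hsub).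
    apply: Rlt_le_trans Hw _.
    apply: Rmult_le_compat; [exact: Rlt_le (inv_INR_pos _)|apply: pow_le; lra| |].
    + exact: inv_INR_antimono.
    + have -> : m = (n + (m - n))%nat by lia.
      rewrite pow_add. have : r ^ (m - n) <= 1.
      { rewrite -(pow1 (m - n)). apply: pow_incr. lra. }
      have : 0 < r ^ n by apply: pow_lt; lra. nra.
  - move=> z Hz. case: (classic (U z)) => HU; [exact: good_inside|exact: good_boundary]. }
exists (/ (INR n + 1)), n. split.
- split; first exact: inv_INR_pos. rewrite -{2}Rinv_1.
  apply: Rinv_le_contravar; have := pos_INR n; lra.
- move=> z r Hz Hr Hsub. exact: (Hn z (subset_closure _ _ Hz) Hz r Hr Hsub).
Qed.

End Geometry.

(** * Test functions *)

Lemma continuity_2d_pt_continuous (u : C -> R) (z : C) :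
  continuity_2d_pt (fun x y => u (x, y)) (Re z) (Im z) -> continuous u z.
Proof.
case: z => x y H. apply/filterlim_locally => e.
have [d Hd] := H e. exists d. move=> [p q] [H1 H2]. exact: Hd.
Qed.

Lemma continuous_continuity_2d_pt (u : C -> R) x y :
  continuous u (x, y) -> continuity_2d_pt (fun x y => u (x, y)) x y.
Proof.
move=> H e. have [d Hd] := proj1 (filterlim_locally _ _) H e.
exists d => p q H1 H2. apply: (Hd (p, q)). by split.
Qed.

Lemma partials_app w1 w2 u :
  partials (w1 ++ w2) u = partials w1 (partials w2 u).
Proof. by rewrite /partials fold_right_app. Qed.

Lemma size_length (T : Type) (w : list T) : seq.size w = length w.
Proof. by elim: w => //= a w ->. Qed.

Lemma is_derive_value (g : R -> R) x (l l' : R) :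
  is_derive g x l -> l = l' -> is_derive g x l'.
Proof. by move=> H <-. Qed.

(** A partial derivative depends on the values at nearby points only. *)
Lemma partials_zero (O : C -> Prop) (u : C -> R) :
  open O -> (forall z, O z -> u z = 0) ->
  forall w z, O z -> partials w u z = 0.
Proof.
move=> HO Hu. elim=> [|d w IH] z Hz; first exact: Hu.
have [e [He HeO]] := proj1 (open_disc O) HO z Hz.
case: z Hz HeO => x y Hz HeO.
have He2 : 0 < e / 2 by lra.
have H0 : forall t, Rabs (t - t) < e / 2 by move=> t; rewrite Rminus_diag Rabs_R0.
rewrite /= /partial. case: d.
- rewrite (Derive_ext_loc _ (fun _ => 0)); first exact: Derive_const.
  exists (mkposreal _ He2) => t Ht. apply: IH. apply: HeO. exact: disc_of_parts.
- rewrite (Derive_ext_loc _ (fun _ => 0)); first exact: Derive_const.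
  exists (mkposreal _ He2) => t Ht. apply: IH. apply: HeO. exact: disc_of_parts.
Qed.

(** A class of functions containing the weights, and stable under partial
    derivatives, so that its members are smooth. *)
Inductive elementary : (C -> R) -> Prop :=
| elementary_flat k c e :
    elementary (fun z => flat k (c + e * (Re z ^ 2 + Im z ^ 2)))
| elementary_re : elementary Re
| elementary_im : elementary Im
| elementary_const k : elementary (fun _ => k)
| elementary_plus u v : elementary u -> elementary v ->
    elementary (fun z => u z + v z)
| elementary_mult u v : elementary u -> elementary v ->
    elementary (fun z => u z * v z).

(** The line through [z] parallel to an axis, parametrised by the coordinate
    that varies. *)
Definition axis_line (d : bool) (z : C) (t : R) : C :=
  if d then (t, Im z) else (Re z, t).

Definition coordinate (d : bool) (z : C) : R := if d then Re z else Im z.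

Lemma axis_line_coordinate d z : axis_line d z (coordinate d z) = z.
Proof. by case: z => x y; case: d. Qed.

Lemma partialE d u z :
  partial d u z = Derive (fun t => u (axis_line d z t)) (coordinate d z).
Proof. by case: d. Qed.

Lemma elementary_deriv u d : elementary u -> exists u', elementary u' /\
  forall z, is_derive (fun t => u (axis_line d z t)) (coordinate d z) (u' z).
Proof.
elim=> [k c e| | |k|{}u v Hu [u' [Eu Du]] Hv [v' [Ev Dv]]
  |{}u v Hu [u' [Eu Du]] Hv [v' [Ev Dv]]].
- exists (fun z => 2 * e * coordinate d z *
    (- INR k * flat (S k) (c + e * (Re z ^ 2 + Im z ^ 2)) +
     flat (S (S k)) (c + e * (Re z ^ 2 + Im z ^ 2)))).
  split.
  + apply: elementary_mult; last first.
    { apply: elementary_plus; last exact: elementary_flat.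
      apply: elementary_mult; [exact: elementary_const|exact: elementary_flat]. }
    apply: elementary_mult; first exact: elementary_const.
    case: d; [exact: elementary_re|exact: elementary_im].
  + move=> z.
    have H := is_derive_comp (V := R_NormedModule) (flat k)
      (fun t => c + e * (Re (axis_line d z t) ^ 2 + Im (axis_line d z t) ^ 2))
      (coordinate d z) _ (2 * e * coordinate d z) (flat_derive k _).
    apply: is_derive_value.
    * apply: H. case: d; rewrite /= /Re /Im /=; auto_derive => //; ring.
    * rewrite /= !axis_line_coordinate /scal /= /mult /=. ring.
- exists (fun _ => if d then 1 else 0). split; first exact: elementary_const.
  move=> z. case: d; [exact: (is_derive_id (K := R_AbsRing))|].
  exact: (is_derive_const (V := R_NormedModule)).
- exists (fun _ => if d then 0 else 1). split; first exact: elementary_const.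
  move=> z. case: d; [exact: (is_derive_const (V := R_NormedModule))|].
  exact: (is_derive_id (K := R_AbsRing)).
- exists (fun _ => 0). split; first exact: elementary_const.
  move=> z. exact: (is_derive_const (V := R_NormedModule)).
- exists (fun z => u' z + v' z). split; first exact: elementary_plus.
  move=> z. exact: (is_derive_plus (V := R_NormedModule)).
- exists (fun z => u' z * v z + u z * v' z).
  split; first by apply: elementary_plus; exact: elementary_mult.
  move=> z. apply: is_derive_value.
  + apply: (Derive.is_derive_mult (fun t => u (axis_line d z t))
      (fun t => v (axis_line d z t))); [exact: Du|exact: Dv].
  + by rewrite /= !axis_line_coordinate.
Qed.

Lemma elementary_cont u : elementary u -> cont2 (fun x y => u (x, y)).
Proof.
elim=> [k c e| | |k|{}u v Hu IHu Hv IHv|{}u v Hu IHu Hv IHv] x y.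
- apply: (continuity_1d_2d_pt_comp (flat k) (fun x y => c + e * (x ^ 2 + y ^ 2))).
  + apply/continuity_pt_filterlim. exact: flat_continuous.
  + apply: continuity_2d_pt_plus; first exact: continuity_2d_pt_const.
    apply: continuity_2d_pt_mult; first exact: continuity_2d_pt_const.
    apply: (continuity_2d_pt_ext (fun x y => (x - 0) ^ 2 + (y - 0) ^ 2));
      last exact: sq_dist_cont.
    move=> p q. by rewrite !Rminus_0_r.
- exact: continuity_2d_pt_id1.
- exact: continuity_2d_pt_id2.
- exact: continuity_2d_pt_const.
- exact: continuity_2d_pt_plus.
- exact: continuity_2d_pt_mult.
Qed.

Lemma elementary_partial u d : elementary u -> elementary (partial d u).
Proof.
move=> /(elementary_deriv u d) [u' [Eu Du]].
have -> // : partial d u = u'.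
apply: functional_extensionality => z. rewrite partialE. exact: is_derive_unique.
Qed.

Lemma elementary_partials u w : elementary u -> elementary (partials w u).
Proof. move=> H. elim: w => [|d w IH] //=. exact: elementary_partial. Qed.

Lemma continuous_bounded_on_rectangle u a b c d : cont2 u -> a <= b -> c <= d ->
  exists B, forall x y, a <= x <= b -> c <= y <= d -> Rabs (u x y) <= B.
Proof.
move=> Hu Hab Hcd.
apply: (rectangle_induction (fun a b c d => exists B, forall x y,
  a <= x <= b -> c <= y <= d -> Rabs (u x y) <= B)) => //.
- move=> a' b' c' d' [B1 H1] [B2 H2] [B3 H3] [B4 H4].
  exists (Rmax (Rmax B1 B2) (Rmax B3 B4)) => x y Hx Hy.
  have M1 := Rmax_l (Rmax B1 B2) (Rmax B3 B4).
  have M2 := Rmax_r (Rmax B1 B2) (Rmax B3 B4).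
  have M3 := Rmax_l B1 B2. have M4 := Rmax_r B1 B2.
  have M5 := Rmax_l B3 B4. have M6 := Rmax_r B3 B4.
  case: (Rle_dec x ((a' + b') / 2)) => Hx'; case: (Rle_dec y ((c' + d') / 2)) => Hy'.
  + have := H1 x y ltac:(lra) ltac:(lra). lra.
  + have := H3 x y ltac:(lra) ltac:(lra). lra.
  + have := H2 x y ltac:(lra) ltac:(lra). lra.
  + have := H4 x y ltac:(lra) ltac:(lra). lra.
- move=> x y _ _. have [e He] := Hu x y (mkposreal 1 Rlt_0_1). rewrite /= in He.
  exists e. split; first exact: cond_pos.
  move=> a' b' c' d' H1 H2 H3 H4 H5 H6 H7 H8.
  exists (Rabs (u x y) + 1) => x' y' Hx' Hy'.
  have : Rabs (u x' y' - u x y) < 1.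
  { apply: He; apply: Rabs_def1; lra. }
  have := Rabs_triang (u x y) (u x' y' - u x y).
  have -> : u x y + (u x' y' - u x y) = u x' y' by ring. lra.
Qed.

Lemma exists_last_or_nil {T : Type} (w : list T) :
  w = nil \/ exists w' d, w = w' ++ d :: nil.
Proof.
elim/rev_ind: w => [|d w _]; [by left|by right; exists w, d].
Qed.

Lemma far_open : open (fun z : C => 3 < Cmod z).
Proof.
apply/open_disc => z Hz. exists (Cmod z - 3). split; first lra.
move=> w Hw. rewrite /disc in Hw. have := Cmod_triangle_minus z w.
rewrite Cmod_minus_sym. lra.
Qed.

(** Induction on the order, removing the derivative that is taken first: it is
    again elementary and zero far away. *)
Lemma elementary_bounded k : forall u, elementary u ->
  (forall z, 3 < Cmod z -> u z = 0) ->
  exists B, 0 <= B /\ forall w z, (length w <= k)%nat -> Rabs (partials w u z) <= B.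
Proof.
have H0 : forall u, elementary u -> (forall z, 3 < Cmod z -> u z = 0) ->
  exists B, 0 <= B /\ forall z, Rabs (u z) <= B.
{ move=> u Hu Hfar.
  have [B HB] := continuous_bounded_on_rectangle (fun x y => u (x, y))
    (-3) 3 (-3) 3 (elementary_cont u Hu) ltac:(lra) ltac:(lra).
  have HB0 : 0 <= B.
  { apply: Rle_trans (Rabs_pos _) (HB 0 0 _ _); lra. }
  exists B. split=> // z.
  case: (Rlt_dec 3 (Cmod z)) => Hz; first by rewrite Hfar // Rabs_R0.
  case: z Hz => x y Hz. have [H1 [H2 _]] := Cmod_split (x, y).
  have E1 : Rabs x <= 3 by apply: Rle_trans H1 _; apply: Rnot_lt_le.
  have E2 : Rabs y <= 3 by apply: Rle_trans H2 _; apply: Rnot_lt_le.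
  apply: (HB x y); [move/Rabs_le_between: E1|move/Rabs_le_between: E2]; lra. }
elim: k => [|k IH] u Hu Hfar.
- have [B [HB HBu]] := H0 u Hu Hfar. exists B. split=> // w z.
  case: w => [|d w] /= Hw; last lia. exact: HBu.
- have [B0 [HB0 HBu]] := H0 u Hu Hfar.
  have Hpf : forall d z, 3 < Cmod z -> partial d u z = 0.
  { move=> d. exact: (partials_zero _ u far_open Hfar (d :: nil)). }
  have [B1 [HB1 H1]] := IH _ (elementary_partial u true Hu) (Hpf true).
  have [B2 [HB2 H2]] := IH _ (elementary_partial u false Hu) (Hpf false).
  exists (B0 + B1 + B2). split; first lra.
  move=> w z. move=> Hw. case: (exists_last_or_nil w) => [E|[w' [d E]]]; rewrite E in Hw |- * => {E}.
  + have := HBu z. rewrite /=. lra.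
  + rewrite partials_app /=. rewrite length_app /= in Hw.
    case: d => //.
    * have := H1 w' z ltac:(lia). lra.
    * have := H2 w' z ltac:(lia). lra.
Qed.

Definition rescale (z0 : C) (r : R) (z : C) : C :=
  ((Re z - Re z0) / r, (Im z - Im z0) / r).

Lemma rescale_axis_line d z0 r z t :
  rescale z0 r (axis_line d z t) =
  axis_line d (rescale z0 r z) ((t - coordinate d z0) / r).
Proof. by case: d. Qed.

Lemma rescaled_deriv u z0 r c d z l : r <> 0 ->
  is_derive (fun t => u (axis_line d (rescale z0 r z) t))
    (coordinate d (rescale z0 r z)) l ->
  is_derive (fun t => c * u (rescale z0 r (axis_line d z t))) (coordinate d z)
    (c * / r * l).
Proof.
move=> Hr H.
apply: (is_derive_ext (fun t => c *
  u (axis_line d (rescale z0 r z) ((t - coordinate d z0) / r)))).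
{ move=> t. by rewrite rescale_axis_line. }
have E : coordinate d (rescale z0 r z) = (coordinate d z - coordinate d z0) / r.
{ by case: d {H}. }
rewrite E in H.
have Hc := is_derive_comp (V := R_NormedModule)
  (fun t => u (axis_line d (rescale z0 r z) t)) (fun t => (t - coordinate d z0) / r)
  (coordinate d z) l (/ r) H.
apply: is_derive_value.
- apply: (is_derive_scal _ _ c). apply: Hc. auto_derive => //. field. done.
- rewrite /scal /= /mult /=. ring.
Qed.

(** Each derivative costs a factor [1 / r], so that the derivatives of order [k]
    of the weight of radius [r] are [O(r^-k)]. *)
Lemma partials_rescale u z0 r w : elementary u -> r <> 0 ->
  partials w (fun z => u (rescale z0 r z)) =
  (fun z => (/ r) ^ length w * partials w u (rescale z0 r z)).
Proof.
move=> Hu Hr. elim: w => [|d w IH].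
- apply: functional_extensionality => z /=. ring.
- rewrite [LHS]/= IH. apply: functional_extensionality => z.
  have [v [_ Hv]] := elementary_deriv _ d (elementary_partials u w Hu).
  rewrite [partials (d :: w) u]/= !partialE (is_derive_unique _ _ _ (Hv _)).
  apply: is_derive_unique.
  apply: is_derive_value; first exact: rescaled_deriv (Hv _).
  rewrite /=. ring.
Qed.

Lemma rescaled_smooth u z0 r : elementary u -> r <> 0 ->
  smooth_real (fun z => u (rescale z0 r z)).
Proof.
move=> Hu Hr w z. rewrite partials_rescale //.
have Hw := elementary_partials u w Hu.
have Hd : forall d, ex_derive (fun t => (/ r) ^ length w *
    partials w u (rescale z0 r (axis_line d z t))) (coordinate d z).
{ move=> d. have [v [_ Hv]] := elementary_deriv _ d Hw.
  eexists. exact: rescaled_deriv (Hv _). }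
split; [|split; [exact: (Hd true)|exact: (Hd false)]].
apply: continuity_2d_pt_continuous.
apply: continuity_2d_pt_mult; first exact: continuity_2d_pt_const.
move=> e. have [d Hdl] := elementary_cont _ Hw ((Re z - Re z0) / r)
  ((Im z - Im z0) / r) e.
have Hd' : 0 < d * Rabs r.
{ apply: Rmult_lt_0_compat; [exact: cond_pos|exact: Rabs_pos_lt]. }
have Hdiv : forall p a b, Rabs (p - a) < d * Rabs r ->
  Rabs ((p - b) / r - (a - b) / r) < d.
{ move=> p a b H. have -> : (p - b) / r - (a - b) / r = (p - a) / r by field.
  rewrite Rabs_div //. apply/Rlt_div_l => //. exact: Rabs_pos_lt. }
exists (mkposreal _ Hd') => p q Hp Hq. apply: Hdl; exact: Hdiv.
Qed.

Lemma partials_const0 w : partials w (fun _ => 0) = (fun _ => 0).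
Proof.
apply: functional_extensionality => z.
exact: (partials_zero (fun _ => True) (fun _ => 0) open_true).
Qed.

Lemma const0_smooth : smooth_real (fun _ => 0).
Proof.
move=> w z. rewrite partials_const0. split; [|split].
- exact: continuous_const.
- exact: ex_derive_const.
- exact: ex_derive_const.
Qed.

Definition unit_weight (z : C) : R :=
  flat 0 (-1 + 1 * (Re z ^ 2 + Im z ^ 2)) * flat 0 (9 + -1 * (Re z ^ 2 + Im z ^ 2)).

Lemma unit_weight_elementary : elementary unit_weight.
Proof. apply: elementary_mult; exact: elementary_flat. Qed.

Lemma weight_rescale z0 r : r <> 0 ->
  weight z0 r = (fun z => RtoC (unit_weight (rescale z0 r z))).
Proof.
move=> Hr. apply: functional_extensionality => z. congr RtoC.
have -> : (Re z - Re z0) ^ 2 + (Im z - Im z0) ^ 2 =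
  r ^ 2 * (Re (rescale z0 r z) ^ 2 + Im (rescale z0 r z) ^ 2).
{ rewrite /rescale /Re /Im /=. field. done. }
rewrite /annular /unit_weight; congr (flat 0 _ * flat 0 _); field; done.
Qed.

Lemma weight_smooth z0 r : r <> 0 -> smooth (weight z0 r).
Proof.
move=> Hr. rewrite weight_rescale //. split; last exact: const0_smooth.
exact: (rescaled_smooth unit_weight z0 r unit_weight_elementary Hr).
Qed.

Lemma weight_derivatives k : exists B, forall z0 r, 0 < r <= 1 ->
  derivatives_bounded k (B * (/ r) ^ k) (weight z0 r).
Proof.
have Hfar : forall z, 3 < Cmod z -> unit_weight z = 0.
{ move=> z Hz. rewrite /unit_weight (flat_neg 0 (9 + _)) ?Rmult_0_r // -Cmod_sqr.
  have : 3 ^ 2 <= Cmod z ^ 2 by apply: pow_incr; lra. lra. }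
have [B [HB0 HB]] := elementary_bounded k _ unit_weight_elementary Hfar.
exists B => z0 r Hr w z /ssrnat.leP. rewrite size_length => Hw.
have Hir : 1 <= / r by rewrite -Rinv_1; apply: Rinv_le_contravar; lra.
have Hirk : 1 <= (/ r) ^ k by apply: pow_R1_Rle.
rewrite weight_rescale; last lra. split.
- rewrite (partials_rescale unit_weight z0 r w unit_weight_elementary); last lra.
  have Hpw : 0 <= (/ r) ^ length w by apply: pow_le; lra.
  rewrite Rabs_mult (Rabs_right ((/ r) ^ length w)); last lra.
  rewrite Rmult_comm. apply: Rmult_le_compat => //.
  + exact: Rabs_pos.
  + exact: HB.
  + exact: Rle_pow.
- rewrite partials_const0 Rabs_R0. apply: Rmult_le_pos => //. lra.
Qed.

Lemma square_integral_CI A F : (forall z, ccont F z) ->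
  square_integral A F = CI (- A) A (- A) A F.
Proof.
move=> HF. have Hre := ccont_re2 _ HF. have Him := ccont_im2 _ HF.
have Hin : forall x, RInt (V := C_R_CompleteNormedModule)
    (fun y => F (x, y)) (- A) A =
  (RInt (fun y => re2 F x y) (- A) A, RInt (fun y => im2 F x y) (- A) A).
{ move=> x. apply: is_RInt_unique.
  apply: (is_RInt_fct_extend_pair (U := R_NormedModule) (V := R_NormedModule)
    (fun y => F (x, y))).
  - apply: RInt_correct. exact: (cont2_ex_RInt (re2 F)).
  - apply: RInt_correct. exact: (cont2_ex_RInt (im2 F)). }
rewrite /square_integral.
rewrite (RInt_ext (V := C_R_CompleteNormedModule) _
  (fun x => (RInt (fun y => re2 F x y) (- A) A, RInt (fun y => im2 F x y) (- A) A)));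
  last by move=> x _; exact: Hin.
apply: (is_RInt_unique (V := C_R_CompleteNormedModule) _ _ _
  (CI (- A) A (- A) A F)).
apply: (is_RInt_fct_extend_pair (U := R_NormedModule) (V := R_NormedModule)
    (fun x => (RInt (fun y => re2 F x y) (- A) A, RInt (fun y => im2 F x y) (- A) A))).
- apply: RInt_correct. exact: (cont2_ex_RInt_outer (re2 F)).
- apply: RInt_correct. exact: (cont2_ex_RInt_outer (im2 F)).
Qed.

Lemma CI_support a b c d a' b' c' d' F :
  a' <= a -> a <= b -> b <= b' -> c' <= c -> c <= d -> d <= d' ->
  (forall z, ccont F z) ->
  (forall x y, x < a \/ b < x \/ y < c \/ d < y -> F (x, y) = 0%C) ->
  CI a' b' c' d' F = CI a b c d F.
Proof.
move=> H1 H2 H3 H4 H5 H6 HF H0. rewrite /CI; congr (_, _);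
  apply: II_support => //; try (exact: ccont_re2); try (exact: ccont_im2);
  by move=> x y H; rewrite /re2 /im2 H0.
Qed.

(** * Tempered growth *)

(** Polynomial growth in the inverse distance to the boundary, the distance
    being tested by the discs contained in [V]. *)
Definition growth (V : C -> Prop) (g : C -> C) : Prop :=
  exists (N : nat) (B : R), forall z r, V z -> 0 < r <= 1 ->
    subset_of (disc z r) V -> Cmod (g z) * r ^ N <= B.

(** By the mean value formula [g z * mass] is the pairing of [g] with the weight
    centred at [z] of radius comparable to [r]. A distribution of order [k] on
    the compact set bounds it by [O(r^-k)], and the mass is at least of the order
    of [r^2]. *)
Lemma tempered_growth (Y V K : C -> Prop) (g : C -> C) :
  compact_set K -> subset_of K Y -> subset_of V K ->
  tempered_holomorphic Y V g -> growth V g.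
Proof.
move=> HK HKY HVK [Hg [T [[_ HT] Hres]]].
have [k [M HTK]] := HT K HK HKY.
have [B HB] := weight_derivatives k.
pose kap := flat 0 1 * flat 0 1 / 2.
have Hkap : 0 < kap.
{ have : 0 < flat 0 1 by apply: flat0_gt0; lra. rewrite /kap. nra. }
exists (k + 2)%nat, (16 ^ (k + 2) * (M * B / kap)) => z0 r1 Hz0 Hr1 Hsub.
pose r := r1 / 16. have Hr : 0 < r by rewrite /r; lra.
have Hgd : forall z, in_box z0 (4 * r) z -> exists l, has_cderiv g z l.
{ move=> z /in_box_disc Hz. apply: ex_derive_has_cderiv. apply: Hg.
  apply: Hsub. rewrite /disc. rewrite /r in Hz. lra. }
have Hgc : forall z, ccont (fun z => g z * weight z0 r z)%C z.
{ move=> z. apply: weighted_ccont => // w Hw _. have [l Hl] := Hgd w Hw.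
  exact: has_cderiv_ccont Hl. }
have Hsupp : forall z, 3 * r <= Cmod (z - z0)%C -> weight z0 r z = 0%C.
{ exact: weight_supp. }
have HV : forall z, Cmod (z - z0)%C <= 3 * r -> V z.
{ move=> z Hz. apply: Hsub. rewrite /disc /r in Hz |- *. lra. }
have Htest : forall O : C -> Prop, subset_of V O -> test_function O (weight z0 r).
{ move=> O HVO. split; first by apply: weight_smooth; lra.
  exists (fun z => K z /\ Cmod (z - z0)%C <= 3 * r). split; last split.
  - apply: compact_inter_closed => // z Hz.
    exists (Cmod (z - z0)%C - 3 * r). split; first lra.
    move=> w Hw. rewrite /disc in Hw.
    have := Cmod_dist z w z0. rewrite (Cmod_minus_sym z w). lra.
  - move=> z [_ Hz]. apply: HVO. exact: HV.
  - move=> z Hz. apply: Hsupp. apply: Rnot_lt_le => H. apply: Hz.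
    split; last lra. apply: HVK. apply: HV. lra. }
pose A := Rabs (Re z0) + Rabs (Im z0) + 4 * r.
have P1 := Rabs_pos (Re z0). have P2 := Rabs_pos (Im z0).
have HT2 : T (weight z0 r) = (g z0 * mass z0 r)%C.
{ rewrite -(mean_value z0 r Hr g Hgd).
  have -> : T (weight z0 r) = square_integral A (fun z => g z * weight z0 r z)%C.
  { apply: Hres; first by apply: Htest.
    move=> z Hz. apply: Hsupp. apply: Rnot_lt_le => H. apply: Hz.
    have [H1 [H2 _]] := Cmod_sub_split z z0.
    have H3 := Rabs_triang (Re z - Re z0) (Re z0).
    have H4 := Rabs_triang (Im z - Im z0) (Im z0).
    have F1 : Re z - Re z0 + Re z0 = Re z by ring.
    have F2 : Im z - Im z0 + Im z0 = Im z by ring.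
    rewrite F1 in H3. rewrite F2 in H4. rewrite /in_square /A. split; lra. }
  rewrite square_integral_CI //.
  have [Q1 Q2] := proj1 (Rabs_le_between (Re z0) _) (Rle_refl _).
  have [Q3 Q4] := proj1 (Rabs_le_between (Im z0) _) (Rle_refl _).
  apply: CI_support => //; rewrite /A; try lra.
  move=> x y Hxy. rewrite Hsupp; first ring.
  have [H1 [H2 _]] := Cmod_sub_split (x, y) z0.
  move: Hxy H1 H2. rewrite -[Re (x, y)]/x -[Im (x, y)]/y.
  rewrite /Rabs. repeat case: Rcase_abs; lra. }
have Hb := HTK (weight z0 r) (B * (/ r) ^ k) (Htest Y (fun z Hz => HKY z (HVK z Hz)))
  ltac:(move=> z Hz; apply: Hsupp; apply: Rnot_lt_le => H; apply: Hz;
        apply: HVK; apply: HV; lra)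
  (HB z0 r ltac:(rewrite /r; lra)).
rewrite HT2 Cmod_mult in Hb.
have H1 : Cmod (g z0) * (kap * r ^ 2) <= M * (B * (/ r) ^ k).
{ apply: Rle_trans Hb. apply: Rmult_le_compat_l; [exact: Cmod_ge_0|exact: mass_ge]. }
have Hrk : 0 < r ^ k by apply: pow_lt.
have H2 : Cmod (g z0) * r ^ (k + 2) <= M * B / kap.
{ apply/(Rle_div_r _ _ kap) => //. rewrite pow_add.
  have H3 : Cmod (g z0) * (kap * r ^ 2) * r ^ k <= M * (B * (/ r) ^ k) * r ^ k.
  { apply: Rmult_le_compat_r => //. lra. }
  have E : M * (B * (/ r) ^ k) * r ^ k = M * B.
  { rewrite pow_inv. field. lra. }
  rewrite E in H3. nra. }
have E : r1 = 16 * r by rewrite /r; field.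
rewrite E Rpow_mult_distr.
have H16 : 0 < 16 ^ (k + 2) by apply: pow_lt; lra.
have -> : Cmod (g z0) * (16 ^ (k + 2) * r ^ (k + 2)) =
  16 ^ (k + 2) * (Cmod (g z0) * r ^ (k + 2)) by ring.
apply: Rmult_le_compat_l => //. lra.
Qed.

(** * Dominated extension of linear functionals *)

Section HahnBanach.

Variable E : ModuleSpace R_Ring.
(** [N x c] stands for a bound [c] on the norm of [x]. A relation allows norms
    that are infinite on part of the space. *)
Variable N : E -> R -> Prop.
Hypothesis N_zero : N zero 0.
Hypothesis N_plus : forall x y a b, N x a -> N y b -> N (plus x y) (a + b).
Hypothesis N_scal : forall t x a, N x a -> N (scal t x) (Rabs t * a).

Record dominated_graph (G : E * R -> Prop) : Prop := {
  graph_zero : G (zero, 0);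
  graph_plus : forall x a y b, G (x, a) -> G (y, b) -> G (plus x y, a + b);
  graph_scal : forall t x a, G (x, a) -> G (scal t x, t * a);
  graph_dom : forall x a c, G (x, a) -> N x c -> a <= c
}.

(** Two values at the same point give a nonzero multiple of their difference as
    value at [zero], against domination. *)
Lemma graph_functional G x a b :
  dominated_graph G -> G (x, a) -> G (x, b) -> a = b.
Proof.
move=> HG.
have H : forall a b, G (x, a) -> G (x, b) -> a <= b.
{ move=> a' b' Ha Hb.
  have H1 := graph_plus _ HG _ _ _ _ Ha (graph_scal _ HG (-1) _ _ Hb).
  have E0 : plus x (scal (-1) x) = zero.
  { have -> : scal (-1) x = opp x by exact: (scal_opp_one x). exact: plus_opp_r. }
  rewrite E0 in H1. have := graph_dom _ HG _ _ _ H1 N_zero. lra. }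
move=> Ha Hb. have := H _ _ Ha Hb. have := H _ _ Hb Ha. lra.
Qed.

Lemma scal_cancel (t : R) (x v : E) : t <> 0 ->
  scal (/ t) (plus x (scal t v)) = plus (scal (/ t) x) v.
Proof.
move=> Ht. rewrite scal_distr_l scal_assoc. congr plus.
have -> : mult (/ t) t = one by rewrite /mult /one /=; field.
exact: scal_one.
Qed.

(** The value at [v] is a supremum that domination keeps below the upper
    bounds; if no [x + v] has a finite norm there is no constraint. *)
Lemma extension_value G v : dominated_graph G -> exists c : R,
  forall x a t d, G (x, a) -> N (plus x (scal t v)) d -> a + t * c <= d.
Proof.
move=> HG.
suff [c [Hc1 Hc2]] : exists c,
  (forall x a d, G (x, a) -> N (plus x v) d -> a + c <= d) /\
  (forall x a d, G (x, a) -> N (plus x (opp v)) d -> a - c <= d).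
{ exists c => x a t d Hx Hd.
  have Hinv : forall s, s <> 0 -> N (scal (/ s) (plus x (scal t v))) (Rabs (/ s) * d).
  { move=> s Hs. exact: N_scal. }
  case: (Rtotal_order t 0) => [Ht|[Ht|Ht]].
  - have Hpos : 0 < / (- t) by apply: Rinv_0_lt_compat; lra.
    have H1 := Hinv (- t) ltac:(lra). rewrite Rabs_right in H1; last lra.
    have Ev : scal t v = scal (- t) (opp v).
    { by rewrite -[RHS]/(scal (opp t) (opp v)) scal_opp_l scal_opp_r opp_opp. }
    rewrite Ev scal_cancel in H1; last lra.
    have := Hc2 _ _ _ (graph_scal _ HG (/ (- t)) _ _ Hx) H1.
    move=> H2. have H3 : (/ - t * a - c) * (- t) <= / - t * d * (- t).
    { apply: Rmult_le_compat_r => //. lra. }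
    have E1 : (/ - t * a - c) * (- t) = a + t * c by field; lra.
    have E2 : / - t * d * (- t) = d by field; lra.
    rewrite E1 E2 in H3. exact: H3.
  - rewrite Ht in Hd |- *. rewrite (scal_zero_l v) plus_zero_r in Hd.
    have := graph_dom _ HG _ _ _ Hx Hd. lra.
  - have Hpos : 0 < / t by apply: Rinv_0_lt_compat.
    have H1 := Hinv t ltac:(lra). rewrite Rabs_right in H1; last lra.
    rewrite scal_cancel in H1; last lra.
    have := Hc1 _ _ _ (graph_scal _ HG (/ t) _ _ Hx) H1.
    move=> H2. have H3 : (/ t * a + c) * t <= / t * d * t.
    { apply: Rmult_le_compat_r => //. lra. }
    have E1 : (/ t * a + c) * t = a + t * c by field; lra.
    have E2 : / t * d * t = d by field; lra.
    rewrite E1 E2 in H3. exact: H3. }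
pose A c := exists x a d, G (x, a) /\ N (plus x (opp v)) d /\ c = a - d.
case: (classic (exists c, A c)) => [Hex|Hno].
- have Hcross : forall x a d c, G (x, a) -> N (plus x v) d -> A c -> c <= d - a.
  { move=> x a d c Hx Hd [y [b [e [Hy [He ->]]]]].
    have H1 := graph_plus _ HG _ _ _ _ Hx Hy.
    have H2 := N_plus _ _ _ _ Hd He.
    have Ee : plus (plus x v) (plus y (opp v)) = plus x y.
    { rewrite (plus_comm y) -plus_assoc (plus_assoc v) plus_opp_r plus_zero_l.
      by []. }
    rewrite Ee in H2. have := graph_dom _ HG _ _ _ H1 H2. lra. }
  have [m [Hm1 Hm2]] : {m | is_lub A m}.
  { apply: completeness => //.
    have [c [x [a [d [Hx [Hd _]]]]]] := Hex.
    have Hx' := graph_scal _ HG (-1) _ _ Hx. have Hd' := N_scal (-1) _ _ Hd.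
    have Eo : scal (-1) (plus x (opp v)) = plus (scal (-1) x) v.
    { rewrite scal_distr_l. congr plus.
      have -> : scal (-1) (opp v) = opp (opp v) by exact: (scal_opp_one (opp v)).
      exact: opp_opp. }
    rewrite Eo in Hd'.
    exists (Rabs (-1) * d - -1 * a) => c' Hc'. exact: Hcross Hx' Hd' Hc'. }
  exists m. split.
  + move=> x a d Hx Hd. have : m <= d - a.
    { apply: Hm2 => c Hc. exact: Hcross Hx Hd Hc. }
    lra.
  + move=> x a d Hx Hd. have : a - d <= m by apply: Hm1; exists x, a, d.
    lra.
- exists 0. split=> x a d Hx Hd.
  + exfalso. apply: Hno.
    have Hx' := graph_scal _ HG (-1) _ _ Hx. have Hd' := N_scal (-1) _ _ Hd.
    have Eo : scal (-1) (plus x v) = plus (scal (-1) x) (opp v).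
    { rewrite scal_distr_l. congr plus. exact: (scal_opp_one v). }
    rewrite Eo in Hd'. eexists. exists (scal (-1) x), (-1 * a), (Rabs (-1) * d).
    by split; [|split].
  + exfalso. apply: Hno. exists (a - d), x, a, d. by [].
Qed.

Lemma dominated_graph_extend G v : dominated_graph G -> exists G' c,
  dominated_graph G' /\ (forall p, G p -> G' p) /\ G' (v, c).
Proof.
move=> HG. have [c Hc] := extension_value G v HG.
exists (fun p => exists x a t, G (x, a) /\ p = (plus x (scal t v), a + t * c)), c.
split; last split.
- split.
  + exists zero, 0, 0. split; first exact: graph_zero.
    rewrite (scal_zero_l v) plus_zero_r. congr (_, _). ring.
  + move=> _ _ _ _ [x [a [t [Hx [-> ->]]]]] [y [b [s [Hy [-> ->]]]]].
    exists (plus x y), (a + b), (t + s). split; first exact: graph_plus.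
    congr (_, _); last ring.
    rewrite (scal_distr_r t s v) -!plus_assoc. congr plus.
    by rewrite !plus_assoc (plus_comm _ y).
  + move=> s _ _ [x [a [t [Hx [-> ->]]]]].
    exists (scal s x), (s * a), (s * t). split; first exact: graph_scal.
    congr (_, _); last ring.
    by rewrite scal_distr_l scal_assoc.
  + move=> _ _ d [x [a [t [Hx [-> ->]]]]] Hd. exact: Hc Hx Hd.
- move=> [x a] Hx. exists x, a, 0. split=> //.
  rewrite (scal_zero_l v) plus_zero_r. congr (_, _). ring.
- exists zero, 0, 1. split; first exact: graph_zero.
  rewrite plus_zero_l. congr (_, _); last ring. by rewrite (scal_one v).
Qed.

(** In Zorn's lemma the empty set is added to the graphs that extend [G0], to
    bound the empty chain. *)
Lemma maximal_graph G0 : dominated_graph G0 -> exists G, dominated_graph G /\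
  (forall p, G0 p -> G p) /\ forall x, exists a, G (x, a).
Proof.
move=> HG0.
pose P (X : E * R -> Prop) := (forall p, ~ X p) \/
  (dominated_graph X /\ forall p, G0 p -> X p).
have [F HFP Htot|A [HA Hmax]] := @classical_sets.Zorn_bigcup _ P.
- case: (classic (exists X, F X /\ exists p, X p)) => [[X0 [HX0 [p0 Hp0]]]|Hno];
    last first.
  { left => p [X HX Hp]. apply: Hno. exists X. split=> //. by exists p. }
  have Hgood : forall X p, F X -> X p -> dominated_graph X.
  { move=> X p HX Hp. case: (HFP X HX) => [H|[H _]] //. by case: (H p). }
  have HX0g : dominated_graph X0 by exact: Hgood HX0 Hp0.
  right. split; last first.
  { move=> p Hp. exists X0 => //. case: (HFP X0 HX0) => [H|[_ H]]; last exact: H.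
    by case: (H p0). }
  split.
  + exists X0 => //. exact: graph_zero.
  + move=> x a y b [X HX Hx] [Y HY Hy]. case: (Htot X Y HX HY) => Hsub.
    * exists Y => //. apply: (graph_plus _ (Hgood _ _ HY Hy)) => //. exact: Hsub.
    * exists X => //. apply: (graph_plus _ (Hgood _ _ HX Hx)) => //. exact: Hsub.
  + move=> t x a [X HX Hx]. exists X => //. exact: (graph_scal _ (Hgood _ _ HX Hx)).
  + move=> x a c [X HX Hx]. exact: (graph_dom _ (Hgood _ _ HX Hx)).
- case: HA => [Hempty|[HA HG0A]].
  { exfalso. apply: (Hmax G0); last by right.
    split; first by move=> p /Hempty.
    move=> H. exact: (Hempty _ (H _ (graph_zero _ HG0))). }
  exists A. split=> //. split=> // v.
  have [G' [c [HG' [Hsub Hv]]]] := dominated_graph_extend A v HA.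
  exists c. apply: NNPP => Hnv. apply: (Hmax G').
  + split=> // H. exact: Hnv (H _ Hv).
  + right. split=> // p /HG0A. exact: Hsub.
Qed.

Theorem Hahn_Banach (S : E -> Prop) (u : E -> R) :
  S zero -> (forall x y, S x -> S y -> S (plus x y)) ->
  (forall t x, S x -> S (scal t x)) ->
  (forall x y, S x -> S y -> u (plus x y) = u x + u y) ->
  (forall t x, S x -> u (scal t x) = t * u x) ->
  (forall x c, S x -> N x c -> u x <= c) ->
  exists T : E -> R,
    (forall x y, T (plus x y) = T x + T y) /\
    (forall t x, T (scal t x) = t * T x) /\
    (forall x, S x -> T x = u x) /\
    (forall x c, N x c -> T x <= c).
Proof.
move=> S0 SP SS uP uS uN.
have [G [HG [HG0 Htot]]] := maximal_graph (fun p => S p.1 /\ p.2 = u p.1)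
  ltac:(split=> /= [|x a y b [Hx ->] [Hy ->]|t x a [Hx ->]|x a c [Hx ->] Hc];
   [split=> //; have := uS 0 zero S0; rewrite (scal_zero_l zero); lra
   |split; [exact: SP|by rewrite uP]
   |split; [exact: SS|by rewrite uS]
   |exact: uN]).
pose T x := proj1_sig (constructive_indefinite_description _ (Htot x)).
have HT : forall x, G (x, T x).
{ move=> x. exact: (proj2_sig (constructive_indefinite_description _ (Htot x))). }
exists T. split; last split; last split.
- move=> x y. apply: (graph_functional G (plus x y)) => //.
  exact: (graph_plus _ HG).
- move=> t x. apply: (graph_functional G (scal t x)) => //.
  exact: (graph_scal _ HG).
- move=> x Hx. apply: (graph_functional G x) => //. exact: HG0.
- move=> x c. exact: (graph_dom _ HG).
Qed.

End HahnBanach.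

(** * From growth to distributions *)

Lemma partials_lin u v a b w : smooth_real u -> smooth_real v ->
  partials w (fun z => a * u z + b * v z) =
  (fun z => a * partials w u z + b * partials w v z).
Proof.
move=> Hu Hv. elim: w => [|d w IH] //.
rewrite [LHS]/= IH. apply: functional_extensionality => z.
have [_ [Ux Uy]] := Hu w z. have [_ [Vx Vy]] := Hv w z.
rewrite /= /partial. case: d.
- rewrite Derive_plus ?Derive_scal //; exact: ex_derive_scal.
- rewrite Derive_plus ?Derive_scal //; exact: ex_derive_scal.
Qed.

Lemma smooth_real_lin u v a b : smooth_real u -> smooth_real v ->
  smooth_real (fun z => a * u z + b * v z).
Proof.
move=> Hu Hv w z. rewrite partials_lin //.
have [Uc [Ux Uy]] := Hu w z. have [Vc [Vx Vy]] := Hv w z.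
split; [|split].
- apply: (continuous_plus (V := R_NormedModule)).
  + exact: (continuous_scal_r (V := R_NormedModule) a (partials w u)).
  + exact: (continuous_scal_r (V := R_NormedModule) b (partials w v)).
- apply: (ex_derive_plus (V := R_NormedModule)); exact: ex_derive_scal.
- apply: (ex_derive_plus (V := R_NormedModule)); exact: ex_derive_scal.
Qed.

Lemma smooth_real_partial u d : smooth_real u -> smooth_real (partial d u).
Proof.
move=> Hu w z. have := Hu (w ++ d :: nil) z. by rewrite partials_app.
Qed.

(** Taylor's estimate, by induction on the order: go from [b] to [z] along the
    two sides of a rectangle and apply the mean value theorem on each, the
    partial derivatives being estimated at the previous order. *)
Lemma flat_point_bound k B b : forall u, smooth_real u ->
  (forall w z, (length w <= k)%nat -> Rabs (partials w u z) <= B) ->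
  (forall w, partials w u b = 0) ->
  forall z s, Rabs (Re z - Re b) <= s -> Rabs (Im z - Im b) <= s ->
  Rabs (u z) <= (2 * s) ^ k * B.
Proof.
elim: k => [|k IH] u Hu HB Hb z s Hx Hy.
- rewrite /= Rmult_1_l. exact: (HB nil z).
- have Hs : 0 <= s by have := Rabs_pos (Re z - Re b); lra.
  have Hpart : forall d t, Rabs (Re t - Re b) <= s -> Rabs (Im t - Im b) <= s ->
    Rabs (partial d u t) <= (2 * s) ^ k * B.
  { move=> d t Ht1 Ht2. apply: (IH (partial d u)) => //.
    - exact: smooth_real_partial.
    - move=> w t' Hw. have := HB (w ++ d :: nil) t'. rewrite partials_app.
      apply. rewrite length_app /=. lia.
    - move=> w. have := Hb (w ++ d :: nil). by rewrite partials_app. }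
  have Hb0 : u b = 0 by exact: (Hb nil).
  case: z Hx Hy => x y Hx Hy. change (Rabs (x - Re b) <= s) in Hx. change (Rabs (y - Im b) <= s) in Hy.
  have [c1 [E1 C1]] := MVT_cor4 (fun t => u (t, y)) (fun t => partial true u (t, y))
    (Re b) (Rabs (x - Re b)) (fun c _ => Derive_correct _ _ (proj1 (proj2 (Hu nil (c, y)))))
    x (Rle_refl _).
  have [c2 [E2 C2]] := MVT_cor4 (fun t => u (Re b, t)) (fun t => partial false u (Re b, t))
    (Im b) (Rabs (y - Im b))
    (fun c _ => Derive_correct _ _ (proj2 (proj2 (Hu nil (Re b, c)))))
    y (Rle_refl _).
  have Eb : u (Re b, Im b) = 0 by rewrite -Hb0; case: (b).
  have P1 := Hpart true (c1, y) ltac:(exact: Rle_trans C1 Hx) Hy.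
  have P2 := Hpart false (Re b, c2)
    ltac:(change (Rabs (Re b - Re b) <= s); by rewrite Rminus_diag Rabs_R0)
    ltac:(exact: Rle_trans C2 Hy).
  have Eu : u (x, y) = (u (x, y) - u (Re b, y)) + (u (Re b, y) - u (Re b, Im b)).
  { rewrite Eb. ring. }
  rewrite Eu E1 E2. apply: Rle_trans (Rabs_triang _ _) _. rewrite !Rabs_mult.
  have T1 : Rabs (partial true u (c1, y)) * Rabs (x - Re b) <= (2 * s) ^ k * B * s.
  { apply: Rmult_le_compat => //; exact: Rabs_pos. }
  have T2 : Rabs (partial false u (Re b, c2)) * Rabs (y - Im b) <= (2 * s) ^ k * B * s.
  { apply: Rmult_le_compat => //; exact: Rabs_pos. }
  have -> : (2 * s) ^ S k = 2 * s * (2 * s) ^ k by []. lra.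
Qed.

Lemma test_function_off (V : C -> Prop) phi b : test_function V phi -> ~ V b ->
  (exists d, 0 < d /\ forall z, disc b d z -> phi z = 0%C).
Proof.
move=> [_ [K [HK [HKV Hsupp]]]] Hb.
have [d [Hd H]] := compact_away K b HK (fun h => Hb (HKV b h)).
exists d. split=> // z /H. exact: Hsupp.
Qed.

Lemma disc_open b d : open (disc b d).
Proof.
apply/open_disc => z Hz. rewrite /disc in Hz.
exists (d - Cmod (z - b)%C). split; first lra.
move=> w Hw. rewrite /disc in Hw |- *. have := Cmod_dist w z b. lra.
Qed.

Lemma test_function_bound V phi k B b z : test_function V phi -> ~ V b ->
  derivatives_bounded k B phi ->
  Cmod (phi z) <= 2 * ((2 * Cmod (z - b)%C) ^ k * B).
Proof.
move=> Hphi Hb HB.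
have [d [Hd H0]] := test_function_off V phi b Hphi Hb.
have Hsm := proj1 Hphi.
have Hbd : forall w z, (length w <= k)%nat ->
   Rabs (partials w (fun z => Re (phi z)) z) <= B /\
   Rabs (partials w (fun z => Im (phi z)) z) <= B.
{ move=> w t Hw. apply: HB. apply/ssrnat.leP. by rewrite size_length. }
have [H1 [H2 _]] := Cmod_split (z - b)%C.
have [_ [_ H3]] := Cmod_split (phi z).
have B1 := flat_point_bound k B b (fun z => Re (phi z)) (proj1 Hsm)
  (fun w t Hw => proj1 (Hbd w t Hw))
  (fun w => partials_zero (disc b d) (fun z => Re (phi z)) (disc_open b d)
     (fun t Ht => f_equal Re (H0 t Ht)) w b (disc_center b d Hd)) z _ H1 H2.
have B2 := flat_point_bound k B b (fun z => Im (phi z)) (proj2 Hsm)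
  (fun w t Hw => proj2 (Hbd w t Hw))
  (fun w => partials_zero (disc b d) (fun z => Im (phi z)) (disc_open b d)
     (fun t Ht => f_equal Im (H0 t Ht)) w b (disc_center b d Hd)) z _ H1 H2.
lra.
Qed.

(** Any point outside [V] at a distance comparable to [r] serves as centre for
    Taylor's estimates. The restriction [r <= 1] costs a factor that the
    diameter of [V] controls. *)
Lemma inscribed_disc (V : C -> Prop) R0 : 0 < R0 -> open V ->
  (forall z, V z -> Cmod z <= R0) -> forall z, V z ->
  exists r b, 0 < r <= 1 /\ subset_of (disc z r) V /\ ~ V b /\
    Cmod (z - b)%C <= (8 * R0 + 8) * r.
Proof.
move=> HR HV Hbd z Hz.
pose P r := 0 <= r <= 1 /\ subset_of (disc z r) V.
have [d [Hd Hdisc]] := proj1 (open_disc V) HV z Hz.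
have [m [Hm1 Hm2]] : {m | is_lub P m}.
{ apply: completeness.
  - exists 1 => r [Hr _]. lra.
  - exists 0. split; first lra. move=> w Hw. rewrite /disc in Hw.
    have := Cmod_ge_0 (w - z)%C. lra. }
have Hm : 0 < m.
{ apply: (Rlt_le_trans _ (Rmin d 1)); first by apply: Rmin_glb_lt; lra.
  apply: Hm1. split.
  - have := Rmin_r d 1. have : 0 < Rmin d 1 by apply: Rmin_glb_lt; lra. lra.
  - move=> w Hw. apply: Hdisc. exact: Rlt_le_trans Hw (Rmin_l _ _). }
have Hm3 : m <= 1 by apply: Hm2 => r [Hr _]; lra.
have Hhalf : subset_of (disc z (m / 2)) V.
{ apply: NNPP => Hn. have : m <= m / 2; last lra.
  apply: Hm2 => r [Hr Hsub]. apply: Rnot_lt_le => Hlt. apply: Hn => w Hw.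
  apply: Hsub. rewrite /disc in Hw |- *. lra. }
case: (Rle_dec (2 * m) 1) => H2m.
- have [b [Hb1 Hb2]] : exists b, disc z (2 * m) b /\ ~ V b.
  { apply: NNPP => Hn. have : 2 * m <= m; last lra.
    apply: Hm1. split; first lra. move=> w Hw. apply: NNPP => Hnw. apply: Hn.
    by exists w. }
  exists (m / 2), b. split; first lra. split=> //. split=> //.
  rewrite /disc Cmod_minus_sym in Hb1. nra.
- exists (m / 2), (RtoC (R0 + 1)). split; first lra. split=> //. split.
  + move=> /Hbd. rewrite Cmod_R Rabs_right; lra.
  + have H1 := Hbd z Hz.
    have H2 := Cmod_triangle z (- RtoC (R0 + 1))%C.
    rewrite Cmod_opp Cmod_R Rabs_right in H2; last lra.
    rewrite /Cminus. nra.
Qed.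

Lemma compact_union (K L : C -> Prop) : compact_set K -> compact_set L ->
  compact_set (fun z => K z \/ L z).
Proof.
move=> HK HL I W HW Hcov.
have [l1 H1] := HK I W HW (fun x Hx => Hcov x (or_introl Hx)).
have [l2 H2] := HL I W HW (fun x Hx => Hcov x (or_intror Hx)).
exists (l1 ++ l2) => x [/H1|/H2] [i [Hi Hx]]; exists i; split=> //;
  apply: in_or_app; [by left|by right].
Qed.

Lemma smooth_lin (a b : C) phi psi : smooth phi -> smooth psi ->
  smooth (fun z => a * phi z + b * psi z)%C.
Proof.
move=> [H1 H2] [H3 H4].
have Ha := smooth_real_lin _ _ (Re a) (- Im a) H1 H2.
have Hb := smooth_real_lin _ _ (Re b) (- Im b) H3 H4.
have Ha' := smooth_real_lin _ _ (Im a) (Re a) H1 H2.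
have Hb' := smooth_real_lin _ _ (Im b) (Re b) H3 H4.
have S1 := smooth_real_lin _ _ 1 1 Ha Hb.
have S2 := smooth_real_lin _ _ 1 1 Ha' Hb'.
split.
- have -> // : (fun z => Re (a * phi z + b * psi z)%C) = (fun z =>
    1 * (Re a * Re (phi z) + - Im a * Im (phi z)) +
    1 * (Re b * Re (psi z) + - Im b * Im (psi z))).
  apply: functional_extensionality => z. rewrite /Re /Im /=. ring.
- have -> // : (fun z => Im (a * phi z + b * psi z)%C) = (fun z =>
    1 * (Im a * Re (phi z) + Re a * Im (phi z)) +
    1 * (Im b * Re (psi z) + Re b * Im (psi z))).
  apply: functional_extensionality => z. rewrite /Re /Im /=. ring.
Qed.

Lemma test_function_lin V (a b : C) phi psi :
  test_function V phi -> test_function V psi ->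
  test_function V (fun z => a * phi z + b * psi z)%C.
Proof.
move=> [H1 [K [HK [HKV HsK]]]] [H2 [L [HL [HLV HsL]]]].
split; first exact: smooth_lin.
exists (fun z => K z \/ L z). split; first exact: compact_union.
split; first by move=> z [/HKV|/HLV].
move=> z Hz. rewrite HsK ?HsL; [ring|tauto|tauto].
Qed.

Lemma smooth_ccont phi z : smooth phi -> ccont phi z.
Proof.
move=> [H1 H2]. case: z => x y. apply/ccont_parts. split.
- apply: (continuous_continuity_2d_pt (fun z => Re (phi z))). exact: (proj1 (H1 nil _)).
- apply: (continuous_continuity_2d_pt (fun z => Im (phi z))). exact: (proj1 (H2 nil _)).
Qed.

Section Extension.

Variables (V : C -> Prop) (g : C -> C) (R0 : R).
Hypothesis HR0 : 0 < R0.
Hypothesis V_open : open V.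
Hypothesis V_bounded : forall z, V z -> Cmod z <= R0.
Hypothesis g_hol : holomorphic_on V g.

Let pairing_ccont phi z : test_function V phi -> ccont (fun z => g z * phi z)%C z.
Proof.
move=> Hphi. apply: ccont_cutoff; first exact: smooth_ccont (proj1 Hphi).
case: (classic (V z)) => Hz; [left|right].
- have [l Hl] := ex_derive_has_cderiv _ _ (g_hol z Hz). exact: has_cderiv_ccont Hl.
- exact: (test_function_off V).
Qed.

Lemma test_function_zero phi z : test_function V phi -> ~ V z -> phi z = 0%C.
Proof.
move=> [_ [K [_ [HKV Hs]]]] Hz. apply: Hs => HK. exact: Hz (HKV z HK).
Qed.

Definition pairing (phi : C -> C) : C :=
  square_integral R0 (fun z => g z * phi z)%C.

Lemma pairing_square phi A : test_function V phi -> supported_in (in_square A) phi ->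
  square_integral A (fun z => g z * phi z)%C = pairing phi.
Proof.
move=> Hphi HA.
have Hc := fun z => pairing_ccont phi z Hphi.
rewrite /pairing !square_integral_CI //.
case: (Rlt_dec A 0) => HA0.
- have H0 : forall z, (g z * phi z = 0)%C.
  { move=> z. rewrite HA; first ring. move=> [H1 _].
    have := Rabs_pos (Re z). lra. }
  rewrite !(CI_ext _ _ _ _ _ (fun _ => 0%C) H0).
  rewrite /CI; congr (_, _);
  rewrite (II_const _ _ _ _ 0) (II_const _ _ _ _ 0); ring.
- have Hbig : forall A', 0 <= A' ->
    (forall z, ~ in_square A' z -> (g z * phi z = 0)%C) ->
    CI (- (Rmax A R0)) (Rmax A R0) (- (Rmax A R0)) (Rmax A R0)
      (fun z => g z * phi z)%C = CI (- A') A' (- A') A' (fun z => g z * phi z)%C \/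
    Rmax A R0 < A'.
  { move=> A' HA' H0. case: (Rlt_dec (Rmax A R0) A') => Hlt; [by right|left].
    apply: CI_support => //; try lra.
    move=> x y Hxy. apply: H0 => -[/Rabs_le_between H1 /Rabs_le_between H2].
    change (- A' <= x <= A') in H1. change (- A' <= y <= A') in H2. lra. }
  have M1 := Rmax_l A R0. have M2 := Rmax_r A R0.
  case: (Hbig A) => [|z Hz|E1|]; [lra| |  |lra].
  { rewrite HA //. ring. }
  case: (Hbig R0) => [|z Hz|E2|]; [lra| |  |lra].
  { rewrite (test_function_zero phi z) //; first ring.
    move=> /V_bounded H. apply: Hz. have [H1 [H2 _]] := Cmod_split z.
    split; lra. }
  by rewrite -E1 -E2.
Qed.

Lemma pairing_lin a b phi psi : test_function V phi -> test_function V psi ->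
  pairing (fun z => a * phi z + b * psi z)%C = (a * pairing phi + b * pairing psi)%C.
Proof.
move=> H1 H2. have H3 := test_function_lin V a b phi psi H1 H2.
have C1 := fun z => pairing_ccont _ z H1. have C2 := fun z => pairing_ccont _ z H2.
have C3 := fun z => pairing_ccont _ z H3.
rewrite /pairing !square_integral_CI //.
rewrite -!CI_scal // -CI_plus.
- apply: CI_ext => z. ring.
- move=> z. apply: ccont_mult => //. exact: ccont_const.
- move=> z. apply: ccont_mult => //. exact: ccont_const.
Qed.

(** At distance [r] from the complement of [V] the test function is [O(r^k)],
    which compensates the growth [O(r^-k)] of [g]. *)
Lemma pairing_bound : growth V g -> exists k M, 0 <= M /\ forall phi B,
  test_function V phi -> derivatives_bounded k B phi -> Cmod (pairing phi) <= M * B.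
Proof.
move=> [k [G HG]].
pose D := 8 * R0 + 8. have HD : 0 < D by rewrite /D; lra.
pose G' := Rmax G 0. have HG' : 0 <= G' by exact: Rmax_r.
pose M := 2 * (2 * D) ^ k * G'.
have HM : 0 <= M.
{ apply: Rmult_le_pos => //. apply: Rmult_le_pos; first lra. apply: pow_le. lra. }
exists k, (8 * R0 ^ 2 * M). split.
{ apply: Rmult_le_pos => //. have := pow2_ge_0 R0. lra. }
move=> phi B Hphi HB.
have HB0 : 0 <= B.
{ have [H _] := HB nil 0%C isT. exact: Rle_trans (Rabs_pos _) H. }
rewrite /pairing square_integral_CI; last by move=> z; exact: pairing_ccont.
have -> : 8 * R0 ^ 2 * M * B = 2 * ((R0 - - R0) * ((R0 - - R0) * (M * B))) by ring.
apply: CI_le; try lra.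
{ move=> z. exact: pairing_ccont. }
move=> x y _ _. set z := (x, y). rewrite Cmod_mult.
case: (classic (V z)) => Hz; last first.
{ rewrite (test_function_zero phi z) // Cmod_0 Rmult_0_r. exact: Rmult_le_pos. }
have [r [b [Hr [Hsub [Hb Hzb]]]]] := inscribed_disc V R0 HR0 V_open V_bounded z Hz.
have Hphiz := test_function_bound V phi k B b z Hphi Hb HB.
have HGz := HG z r Hz Hr Hsub.
have Hg0 := Cmod_ge_0 (g z).
have H1 : (2 * Cmod (z - b)%C) ^ k <= (2 * D) ^ k * r ^ k.
{ rewrite -Rpow_mult_distr. apply: pow_incr. have := Cmod_ge_0 (z - b)%C.
  rewrite /D. lra. }
have H2 : Cmod (phi z) <= 2 * ((2 * D) ^ k * r ^ k * B).
{ apply: Rle_trans Hphiz _. apply: Rmult_le_compat_l; first lra.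
  exact: Rmult_le_compat_r. }
apply: (Rle_trans _ (Cmod (g z) * (2 * ((2 * D) ^ k * r ^ k * B)))).
{ exact: Rmult_le_compat_l. }
have -> : Cmod (g z) * (2 * ((2 * D) ^ k * r ^ k * B)) =
  2 * (2 * D) ^ k * (Cmod (g z) * r ^ k) * B by ring.
apply: Rmult_le_compat_r => //. apply: Rmult_le_compat_l.
{ apply: Rmult_le_pos; first lra. apply: pow_le. lra. }
apply: Rle_trans HGz _. exact: Rmax_l.
Qed.

End Extension.

Definition function_monoid : AbelianMonoid.
Proof.
apply: (AbelianMonoid.Pack (C -> C) (AbelianMonoid.Mixin (C -> C)
  (fun phi psi z => phi z + psi z)%C (fun _ => 0%C) _ _ _) (C -> C)).
- move=> phi psi. apply: functional_extensionality => z. ring.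
- move=> phi psi chi. apply: functional_extensionality => z. ring.
- move=> phi. apply: functional_extensionality => z. ring.
Defined.

Definition function_group : AbelianGroup.
Proof.
apply: (AbelianGroup.Pack (C -> C) (AbelianGroup.Class (C -> C)
  (AbelianMonoid.class function_monoid)
  (AbelianGroup.Mixin function_monoid (fun phi z => - phi z)%C _)) (C -> C)).
move=> phi. apply: functional_extensionality => z. exact: Cplus_opp_r.
Defined.

Definition function_space : ModuleSpace R_Ring.
Proof.
apply: (ModuleSpace.Pack R_Ring (C -> C) (ModuleSpace.Class R_Ring (C -> C)
  (AbelianGroup.class function_group)
  (ModuleSpace.Mixin R_Ring function_group (fun t phi z => RtoC t * phi z)%C
    _ _ _ _)) (C -> C)).
- move=> s t phi. apply: functional_extensionality => z.
  by rewrite RtoC_mult Cmult_assoc.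
- move=> phi. apply: functional_extensionality => z. exact: Cmult_1_l.
- move=> t phi psi. apply: functional_extensionality => z.
  exact: Cmult_plus_distr_l.
- move=> s t phi. apply: functional_extensionality => z.
  by rewrite RtoC_plus Cmult_plus_distr_r.
Defined.

(** The norm on test functions that the pairing is dominated by: [M] times the
    bound on the derivatives of order at most [k]. *)
Definition norm_bound (k : nat) (M : R) (phi : function_space) (c : R) : Prop :=
  smooth phi /\ exists B, derivatives_bounded k B phi /\ c = M * B.

Lemma derivatives_bounded_plus k B1 B2 phi psi : smooth phi -> smooth psi ->
  derivatives_bounded k B1 phi -> derivatives_bounded k B2 psi ->
  derivatives_bounded k (B1 + B2) (fun z => phi z + psi z)%C.
Proof.
move=> [P1 P2] [Q1 Q2] H1 H2 w z Hw.
have [A1 A2] := H1 w z Hw. have [A3 A4] := H2 w z Hw.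
have E1 := partials_lin _ _ 1 1 w P1 Q1. have E2 := partials_lin _ _ 1 1 w P2 Q2.
have F1 : (fun z => Re (phi z + psi z)%C) = (fun z => 1 * Re (phi z) + 1 * Re (psi z)).
{ apply: functional_extensionality => t. rewrite /Re /=. ring. }
have F2 : (fun z => Im (phi z + psi z)%C) = (fun z => 1 * Im (phi z) + 1 * Im (psi z)).
{ apply: functional_extensionality => t. rewrite /Im /=. ring. }
rewrite F1 F2 E1 E2 !Rmult_1_l.
split; apply: Rle_trans (Rabs_triang _ _) _; lra.
Qed.

Lemma derivatives_bounded_scal k B t phi : smooth phi ->
  derivatives_bounded k B phi ->
  derivatives_bounded k (Rabs t * B) (fun z => RtoC t * phi z)%C.
Proof.
move=> [P1 P2] H w z Hw. have [A1 A2] := H w z Hw.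
have E1 := partials_lin _ _ t 0 w P1 P1. have E2 := partials_lin _ _ t 0 w P2 P2.
have F1 : (fun z => Re (RtoC t * phi z)%C) = (fun z => t * Re (phi z) + 0 * Re (phi z)).
{ apply: functional_extensionality => u. rewrite /Re /=. ring. }
have F2 : (fun z => Im (RtoC t * phi z)%C) = (fun z => t * Im (phi z) + 0 * Im (phi z)).
{ apply: functional_extensionality => u. rewrite /Im /=. ring. }
rewrite F1 F2 E1 E2 !Rmult_0_l !Rplus_0_r !Rabs_mult.
split; apply: Rmult_le_compat_l => //; exact: Rabs_pos.
Qed.

Lemma derivatives_bounded_Ci k B phi : smooth phi -> derivatives_bounded k B phi ->
  derivatives_bounded k B (fun z => Ci * phi z)%C.
Proof.
move=> [P1 P2] H w z Hw. have [A1 A2] := H w z Hw.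
have E2 := partials_lin _ _ (-1) 0 w P2 P2.
have F1 : (fun z => Re (Ci * phi z)%C) = (fun z => -1 * Im (phi z) + 0 * Im (phi z)).
{ apply: functional_extensionality => u. rewrite /Re /Im /=. ring. }
have F2 : (fun z => Im (Ci * phi z)%C) = (fun z => Re (phi z)).
{ apply: functional_extensionality => u. rewrite /Re /Im /=. ring. }
rewrite F1 F2 E2 Rmult_0_l Rplus_0_r. split=> //.
by rewrite Rabs_mult Rabs_left ?Ropp_involutive ?Rmult_1_l; lra.
Qed.

Lemma scal_as_lin (a : C) (phi : C -> C) :
  (fun z => a * phi z)%C = (fun z => a * phi z + 0 * phi z)%C.
Proof. apply: functional_extensionality => z. ring. Qed.

Lemma plus_as_lin (phi psi : C -> C) :
  (fun z => phi z + psi z)%C = (fun z => 1 * phi z + 1 * psi z)%C.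
Proof. apply: functional_extensionality => z. ring. Qed.

Lemma smooth_scal (a : C) phi : smooth phi -> smooth (fun z => a * phi z)%C.
Proof. move=> H. rewrite scal_as_lin. exact: smooth_lin. Qed.

Lemma test_function_scal V (a : C) phi : test_function V phi ->
  test_function V (fun z => a * phi z)%C.
Proof. move=> H. rewrite scal_as_lin. exact: test_function_lin. Qed.

Lemma const0_test_function V : test_function V (fun _ => 0%C).
Proof.
split; first by split; exact: const0_smooth.
exists (fun _ => False). split; [|split] => //.
move=> I W _ _. by exists nil.
Qed.

(** The pairing with [g] is bounded by the derivatives up to a fixed order on
    the test functions on [V], so it extends by the Hahn-Banach theorem to all
    test functions. *)
Lemma growth_tempered (Y V : C -> Prop) (g : C -> C) (R0 : R) : 0 < R0 ->
  open V -> (forall z, V z -> Cmod z <= R0) ->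
  holomorphic_on V g -> growth V g -> tempered_holomorphic Y V g.
Proof.
move=> HR0 HV Hbd Hg Hgrowth. split=> //.
have [k [M [HM Hpair]]] := pairing_bound V g R0 HR0 HV Hbd Hg Hgrowth.
have Hlin := pairing_lin V g R0 Hg.
have Hsc : forall a phi, test_function V phi ->
  pairing g R0 (fun z => a * phi z)%C = (a * pairing g R0 phi)%C.
{ move=> a phi H.
  rewrite scal_as_lin Hlin //. ring. }
have Hre_plus : forall phi psi, test_function V phi -> test_function V psi ->
  Re (pairing g R0 (fun z => phi z + psi z)%C) =
  Re (pairing g R0 phi) + Re (pairing g R0 psi).
{ move=> phi psi H1 H2. by rewrite plus_as_lin Hlin // !Cmult_1_l. }
have Hre_scal : forall t phi, test_function V phi ->
  Re (pairing g R0 (fun z => RtoC t * phi z)%C) = t * Re (pairing g R0 phi).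
{ move=> t phi H. by rewrite Hsc // Re_real_mult. }
have [T [TP [TS [Text Tdom]]]] := Hahn_Banach function_space (norm_bound k M)
  ltac:(split; [by split; exact: const0_smooth|];
        exists 0; split; [|ring]; move=> w z _;
        rewrite (partials_const0 w) Rabs_R0; lra)
  ltac:(move=> phi psi a b [P1 [B1 [D1 ->]]] [P2 [B2 [D2 ->]]];
        split; [rewrite -[plus phi psi]/(fun z => phi z + psi z)%C plus_as_lin; exact: smooth_lin|];
        exists (B1 + B2); split; [exact: derivatives_bounded_plus|ring])
  ltac:(move=> t phi a [P1 [B1 [D1 ->]]]; split; [exact: smooth_scal|];
        exists (Rabs t * B1); split; [exact: derivatives_bounded_scal|ring])
  (test_function V) (fun phi => Re (pairing g R0 phi))
  (const0_test_function V)
  ltac:(move=> phi psi H1 H2; rewrite -[plus phi psi]/(fun z => phi z + psi z)%C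
          plus_as_lin; exact: test_function_lin)
  (fun t phi => test_function_scal V (RtoC t) phi)
  Hre_plus Hre_scal
  ltac:(move=> phi c Hphi [_ [B [HB ->]]];
        apply: Rle_trans (Rle_abs _) _;
        apply: Rle_trans (proj1 (Cmod_split _)) _; exact: Hpair).
(* A complex linear functional is determined by its real part. *)
pose S phi : C := (T phi, - T (fun z => Ci * phi z)%C).
exists S.
have TS' : forall t phi, T (fun z => RtoC t * phi z)%C = t * T phi.
{ exact: TS. }
have TP' : forall phi psi, T (fun z => phi z + psi z)%C = T phi + T psi.
{ exact: TP. }
have TC : forall (a : C) phi, T (fun z => a * phi z)%C =
    Re a * T phi + Im a * T (fun z => Ci * phi z)%C.
{ move=> a phi.
  have -> : (fun z => a * phi z)%C =
    (fun z => RtoC (Re a) * phi z + RtoC (Im a) * (Ci * phi z))%C.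
  { apply: functional_extensionality => z.
    case: a => p q. case: (phi z) => x y.
    rewrite /RtoC /Ci /Cmult /Cplus /Re /Im /=. congr (_, _); ring. }
  rewrite (TP' (fun z => RtoC (Re a) * phi z)%C) TS'.
  by rewrite (TS' (Im a) (fun z => Ci * phi z)%C). }
have SC : forall a phi, S (fun z => a * phi z)%C = (a * S phi)%C.
{ move=> a phi. rewrite /S.
  have -> : (fun z => Ci * (a * phi z))%C = (fun z => (Ci * a) * phi z)%C.
  { apply: functional_extensionality => z. ring. }
  rewrite (TC a) (TC (Ci * a)%C). case: a => p q.
  rewrite /Cmult /Re /Im /=. congr (_, _); ring. }
have SP : forall phi psi, S (fun z => phi z + psi z)%C = (S phi + S psi)%C.
{ move=> phi psi. rewrite /S.
  have -> : (fun z => Ci * (phi z + psi z))%C = (fun z => Ci * phi z + Ci * psi z)%C.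
  { apply: functional_extensionality => z. ring. }
  rewrite !TP' /Cplus /=. congr (_, _). ring. }
have Tabs : forall phi B, smooth phi -> derivatives_bounded k B phi ->
    Rabs (T phi) <= M * B.
{ move=> phi B Hs HB. apply: Rabs_le. split.
  - have H1 : T (fun z => RtoC (-1) * phi z)%C <= M * (Rabs (-1) * B).
    { apply: Tdom. split; first exact: smooth_scal.
      exists (Rabs (-1) * B). split=> //. exact: derivatives_bounded_scal. }
    rewrite TS' Rabs_left in H1; lra.
  - apply: Tdom. split=> //. by exists B. }
split.
- split.
  + move=> a b phi psi _ _. by rewrite SP !SC.
  + move=> K _ _. exists k, (2 * M) => phi B [Hs _] _ HB.
    have [_ [_ H]] := Cmod_split (S phi). apply: Rle_trans H _.
    have H1 := Tabs phi B Hs HB.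
    have H2 := Tabs _ B (smooth_scal Ci phi Hs) (derivatives_bounded_Ci k B phi Hs HB).
    rewrite [Re _]/= [Im _]/= Rabs_Ropp. lra.
- move=> phi A Hphi HA.
  rewrite (pairing_square V g R0 HR0 Hbd Hg phi A Hphi HA).
  rewrite /S Text // Text; last exact: test_function_scal.
  rewrite Hsc //. case: (pairing g R0 phi) => x y.
  rewrite /Ci /Cmult /Re /=. congr (_, _). ring.
Qed.

Theorem theorem2p3p2 (X : C -> Prop) (f : C -> C) (U : C -> Prop) (h : C -> C)
  (HX : open X)
  (Hf : holomorphic_on X f)
  (HU : Op_c_sa X U)
  (Hinj : injective_on f (closure_set U))
  (Hh : holomorphic_on (direct_image f U) h) :
  tempered_holomorphic (fun _ => True) (direct_image f U) h <->
  tempered_holomorphic X U (fun z => h (f z)).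
Proof.
have [U_open [_ [K_compact K_sub]]] := HU.
have f_hol : forall p, closure_set U p -> exists d, 0 < d /\
  forall z, disc p d z -> exists l, has_cderiv f z l.
{ move=> p /K_sub Hp. have [d [Hd H]] := proj1 (open_disc X) HX p Hp.
  exists d. split=> // z /H Hz. apply: ex_derive_has_cderiv. exact: Hf. }
have HUX : subset_of U X by move=> z /subset_closure; exact: K_sub.
have [L [HL Hpre]] := preimage_contains_disc f U U_open K_compact f_hol Hinj.
have [c [N [Hc Himg]]] := image_contains_disc f U U_open K_compact f_hol Hinj.
have fU_open : open (direct_image f U).
{ apply/open_disc => _ [z [Hz <-]].
  have [d [Hd HdU]] := proj1 (open_disc U) U_open z Hz.
  have Hr : 0 < Rmin d 1 <= 1.
  { split; [apply: Rmin_glb_lt; lra|exact: Rmin_r]. }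
  exists (c * Rmin d 1 ^ N). split.
  - apply: Rmult_lt_0_compat; [lra|apply: pow_lt; lra].
  - apply: (Himg z (Rmin d 1) Hz Hr) => w Hw. apply: HdU.
    exact: Rlt_le_trans Hw (Rmin_l _ _). }
have [BU [HBU U_bounded]] := compact_bounded _ K_compact.
have [Bf [HBf f_bounded]] := f_bounded f U K_compact f_hol.
have fK_compact : compact_set (direct_image f (closure_set U)).
{ apply: compact_image => // z Hz.
  have [d [Hd H]] := f_hol z Hz.
  have [l Hl] := H z (disc_center z d Hd).
  exact: (has_cderiv_ccont f z l Hl). }
have hf_hol : holomorphic_on U (fun z => h (f z)).
{ move=> z Hz.
  have [dh Hdh] : ex_derive (K := C_AbsRing) (V := C_NormedModule) h (f z).
  { apply: Hh. by exists z. }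
  have [df Hdf] := Hf z (HUX z Hz).
  (* The chain rule takes the inner derivative in the normed module that
     underlies the ring of complex numbers; the norms coincide. *)
  have Hdf' : is_derive (K := C_AbsRing) (V := AbsRing_NormedModule C_AbsRing) f z df.
  { case: Hdf => [[H1 H2 H3] H4]. split; [split|] => //. }
  eexists.
  exact: (is_derive_comp (K := C_AbsRing) (V := C_NormedModule) h f z dh df Hdh Hdf'). }
split=> H.
- have [n [B HB]] := tempered_growth _ _ (direct_image f (closure_set U)) h
    fK_compact (fun _ _ => I)
    (fun w Hw => match Hw with ex_intro z (conj Hz E) =>
       ex_intro _ z (conj (subset_closure U z Hz) E) end) H.
  apply: (growth_tempered X U _ BU HBU U_open) => //.
  + move=> z Hz. apply: U_bounded. exact: subset_closure.
  + exists (N * n)%nat, (B / c ^ n) => z r Hz Hr Hsub.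
    have Hcn : 0 < c ^ n by apply: pow_lt; lra.
    apply/(Rle_div_r _ _ (c ^ n)) => //.
    have HrN : 0 < r ^ N by apply: pow_lt; lra.
    have HrN1 : r ^ N <= 1 by rewrite -(pow1 N); apply: pow_incr; lra.
    have H1 := HB (f z) (c * r ^ N) (ex_intro _ z (conj Hz eq_refl))
      ltac:(nra) (Himg z r Hz Hr Hsub).
    rewrite Rpow_mult_distr -pow_mult in H1. lra.
- have [n [B HB]] := tempered_growth _ _ (closure_set U) _ K_compact K_sub
    (fun z => subset_closure U z) H.
  apply: (growth_tempered _ _ _ Bf HBf fU_open) => //.
  + move=> _ [z [Hz <-]]. apply: f_bounded. exact: subset_closure.
  + pose L' := Rmax L 1. have HL1 := Rmax_l L 1. have HL2 := Rmax_r L 1.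
    exists n, (B * L' ^ n) => _ r [z [Hz <-]] Hr Hsub.
    have HLn : 0 < L' ^ n by apply: pow_lt; rewrite /L'; lra.
    have HrL : 0 < r / L' <= 1.
    { split; first by apply: Rdiv_lt_0_compat; rewrite /L'; lra.
      apply/Rle_div_l; rewrite /L'; lra. }
    have Hsub' : subset_of (disc z (r / L')) U.
    { move=> w Hw. apply: (Hpre z r Hz (proj1 Hr) Hsub). apply: Rlt_le_trans Hw _.
      apply: Rmult_le_compat_l; first lra.
      apply: Rinv_le_contravar => //. }
    have H1 := HB z (r / L') Hz HrL Hsub'.
    have -> : r ^ n = (r / L') ^ n * L' ^ n.
    { rewrite -Rpow_mult_distr. congr (_ ^ _). field. rewrite /L'. lra. }
    rewrite -Rmult_assoc. apply: Rmult_le_compat_r => //. lra.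
Qed.
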